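(* Let $(N,J,g_N)$ be a Calabi-Yau manifold of real dimension $2m$ and let $F_0:M\to N$ be a compact almost calibrated Lagrangian immersion. Let $\alpha$ denote a choice of Lagrangian angle with $\cos\alpha>0$. Suppose $F:M\times[0,T)\to N$ is a smooth solution of the reparametrized Lagrangian mean curvature flow $$\frac{d}{dt}F=H-\tan\alpha\cdot JH,\qquad F(\cdot,0)=F_0 .$$ Then for each measurable set $\Omega\subset M$ and each time $t\in[0,T)$, $$\frac{1}{\epsilon}\cdot\operatorname{vol}_0(\Omega)\;\ge\;\operatorname{vol}_t(\Omega)\;\ge\;\epsilon\cdot\operatorname{vol}_0(\Omega),$$ where $\epsilon$ is the constant $$\epsilon:=\min_{M\times\{0\}}\cos\alpha>0$$ and $\operatorname{vol}_t$ denotes the measure on $M$ induced by $F_t:=F(\cdot,t)$, i.e. the Riemannian measure of the metric $F_t^*g_N$.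
   Context: $(N,J,g_N)$ is a Calabi-Yau manifold of real dimension $n=2m$: a Ricci-flat Kähler manifold with Kähler form $\omega_N$ and a parallel complex volume form (holomorphic $(m,0)$-form), denoted $dz$, normalized so that $|F^*dz|=d\mu$ for Lagrangian immersions (see below). An immersion $F:M\to N$ is Lagrangian if $\dim M=m$ and $F^*\omega_N=0$. Let $d\mu$ be the induced volume form on the (oriented) manifold $M$. For a Lagrangian immersion, $F^*dz=e^{i\phi}d\mu$ with a (in general multi-valued) phase function $\phi$. Let $A=\nabla dF$ be the second fundamental tensor and $H=\operatorname{trace}A$ the mean curvature vector field. The mean curvature $1$-form on $M$ is $\Theta_H(\cdot)=\langle H,J\cdot\rangle$, i.e. $\Theta_H(w)=\langle H,J\,dF(w)\rangle$. One has $d\phi=\Theta_H$. A Lagrangian angle is a potential $\alpha$ for $\Theta_H$, i.e. $d\alpha=\Theta_H$; it coincides with the phase up to a constant, $\alpha=\phi-\phi_0$. A Lagrangian immersion is almost calibrated if $\cos(\phi-\phi_0)>0$ for some constant $\phi_0$; equivalently, $\Theta_H=d\alpha$ for a globally defined Lagrangian angle $\alpha$ with $\cos\alpha>0$. In the flow, each $F_t=F(\cdot,t)$ is a Lagrangian immersion, and $H$ and $\alpha$ at time $t$ are the mean curvature vector and the Lagrangian angle of $F_t$. Here $\alpha$ is the smooth time-dependent function on $M\times[0,T)$ that extends the chosen angle at $t=0$ and satisfies $F_t^*(e^{-i\phi_0}dz)=e^{i\alpha(\cdot,t)}d\mu_t$ with the constant $\phi_0$ fixed in time (so $d\alpha(\cdot,t)=\Theta_H$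 for $F_t$). *)

(* Defs.v *)
From HB Require Import structures.
From mathcomp Require Import all_boot all_order all_algebra all_fingroup.
From mathcomp Require Import all_classical all_reals all_analysis.
From mathcomp Require Import complex.

Set Implicit Arguments.
Unset Strict Implicit.
Unset Printing Implicit Defensive.

Import Order.TTheory GRing.Theory Num.Theory.
Import numFieldNormedType.Exports.

Local Open Scope classical_set_scope.
Local Open Scope ring_scope.

Section SmoothFunctions.
Variable R : realType.

Definition partial n (i : 'I_n) (f : 'rV[R]_n -> R) : 'rV[R]_n -> R :=
  fun x => 'D_(delta_mx 0 i) f x.

Fixpoint Cr (r : nat) n (U : set 'rV[R]_n) (f : 'rV[R]_n -> R) : Prop :=
  match r with
  | 0%N => forall x, U x -> {for x, continuous f}
  | r'.+1 => (forall x, U x -> differentiable f x) /\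
             (forall i, Cr r' U (partial i f))
  end.

(* [S] need not be open: smooth on [S] means that, near every point of [S],
   [f] agrees on [S] with a C^oo function defined on an open set. On
   U x [0, T[ this is smoothness up to the initial time. *)
Definition smooth_on n (S : set 'rV[R]_n) (f : 'rV[R]_n -> R) : Prop :=
  forall x, S x -> exists (U : set 'rV[R]_n) (h : 'rV[R]_n -> R),
    [/\ open U, U x, (forall r, Cr r U h) &
        forall y, U y -> S y -> f y = h y].

End SmoothFunctions.

Section Manifolds.
Variable R : realType.

(* [cmap] and [cinv] are total functions; only their restrictions to [cdom]
   and to [cimg] (below) are meaningful. *)
Record chart (X : Type) (n : nat) := Chart {
  cdom : set X;
  cmap : X -> 'rV[R]_n;
  cinv : 'rV[R]_n -> X }.

Definition cimg X n (c : chart X n) : set 'rV[R]_n := cmap c @` cdom c.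

Record is_chart (X : topologicalType) n (c : chart X n) : Prop := IsChart {
  chart_open_dom : open (cdom c);
  chart_open_img : open (cimg c);
  chart_cancel : forall p, cdom c p -> cinv c (cmap c p) = p;
  chart_cmap_continuous : {within cdom c, continuous (cmap c)};
  chart_cinv_continuous : {within cimg c, continuous (cinv c)} }.

Record manifold (X : topologicalType) (n : nat) := Manifold {
  atlas : set (chart X n);
  chart_at : X -> chart X n;
  chart_at_atlas : forall p, atlas (chart_at p);
  chart_at_dom : forall p, cdom (chart_at p) p;
  atlas_chart : forall c, atlas c -> is_chart c;
  atlas_compatible : forall c d, atlas c -> atlas d -> forall j,
    smooth_on (cmap c @` (cdom c `&` cdom d))
              (fun x => cmap d (cinv c x) 0 j);
  manifold_hausdorff : hausdorff_space X;
  manifold_second_countable : @second_countable X }.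

(* d f / d x^i at p, where x are the coordinates of the chart c *)
Definition cpartial X n (c : chart X n) (i : 'I_n) (f : X -> R) (p : X) : R :=
  partial i (f \o cinv c) (cmap c p).

Definition csmooth X n (c : chart X n) (f : X -> R) : Prop :=
  smooth_on (cimg c) (f \o cinv c).

(* The differential at p of F, in the charts c and d. Tangent vectors are row
   vectors of components, and row i is dF (d/dx^i). *)
Definition dmap X Y m n (c : chart X m) (d : chart Y n) (F : X -> Y) (p : X) :
    'M[R]_(m, n) :=
  \matrix_(i, a) cpartial c i (fun q => cmap d (F q) 0 a) p.

Definition jac X n (c d : chart X n) (p : X) : 'M[R]_n := dmap c d id p.

Definition smooth_map (X Y : topologicalType) m n
    (AX : manifold X m) (AY : manifold Y n) (F : X -> Y) : Prop :=
  continuous F /\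
  forall c d, atlas AX c -> atlas AY d -> forall a,
    smooth_on (cmap c @` (cdom c `&` F @^-1` cdom d))
              (fun x => cmap d (F (cinv c x)) 0 a).

Definition smooth_fun (X : topologicalType) n (A : manifold X n) (f : X -> R) :
  Prop := forall c, atlas A c -> csmooth c f.

(* An orientation of X is given by an atlas with positive transition maps. *)
Definition oriented (X : topologicalType) n (A : manifold X n) : Prop :=
  forall c d, atlas A c -> atlas A d ->
  forall p, cdom c p -> cdom d p -> 0 < \det (jac c d p).

End Manifolds.

(* Tensor fields are given by their components in the charts of the atlas. *)
Section Riemannian.
Variables (R : realType) (X : topologicalType) (n : nat) (A : manifold R X n).

(* g c p i j = g (d/dx^i, d/dx^j) *)
Record is_metric (g : chart R X n -> X -> 'M[R]_n) : Prop := IsMetric {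
  metric_smooth : forall c, atlas A c -> forall i j,
    csmooth c (fun p => g c p i j);
  metric_sym : forall c p, atlas A c -> cdom c p -> (g c p)^T = g c p;
  metric_pos : forall c p, atlas A c -> cdom c p ->
    forall v : 'rV[R]_n, v != 0 -> 0 < (v *m g c p *m v^T) 0 0;
  metric_change : forall c d p, atlas A c -> atlas A d ->
    cdom c p -> cdom d p -> g c p = jac c d p *m g d p *m (jac c d p)^T }.

Variable g : chart R X n -> X -> 'M[R]_n.

(* Gamma^k_{ij} *)
Definition christoffel (c : chart R X n) (p : X) (k i j : 'I_n) : R :=
  2^-1 * \sum_l invmx (g c p) k l *
    (cpartial c i (fun q => g c q j l) p
     + cpartial c j (fun q => g c q i l) p
     - cpartial c l (fun q => g c q i j) p).

Definition ricci (c : chart R X n) (p : X) (j k : 'I_n) : R :=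
  \sum_i (cpartial c i (fun q => christoffel c q i j k) p
          - cpartial c j (fun q => christoffel c q i i k) p)
  + \sum_i \sum_l (christoffel c p i i l * christoffel c p l j k
                   - christoffel c p i j l * christoffel c p l i k).

(* (nabla_k J)_i^j, where J (d/dx^i) = \sum_j J_i^j d/dx^j *)
Definition nabla_endo (J : chart R X n -> X -> 'M[R]_n)
    (c : chart R X n) (p : X) (k i j : 'I_n) : R :=
  cpartial c k (fun q => J c q i j) p
  + \sum_l (christoffel c p j k l * J c p i l
            - christoffel c p l k i * J c p l j).

End Riemannian.

Section ComplexForms.
Variables (R : realType) (X : topologicalType) (n : nat) (A : manifold R X n).
Variable m : nat.

Local Notation multi_index := {ffun 'I_m -> 'I_n}.

Definition cis (a : R) : R[i] := (cos a +i* sin a)%C.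

Definition ccpartial (c : chart R X n) (k : 'I_n) (f : X -> R[i]) (p : X) :
    R[i] :=
  (cpartial c k (fun q => complex.Re (f q)) p +i*
   cpartial c k (fun q => complex.Im (f q)) p)%C.

Definition upd (I : multi_index) (a : 'I_m) (l : 'I_n) : multi_index :=
  [ffun b => if b == a then l else I b].

(* the value on (v_1, ..., v_m), the rows of V, of the m-form with components
   w_I = w (d/dx^(I 1), ..., d/dx^(I m)) *)
Definition form_eval (w : multi_index -> R[i]) (V : 'M[R]_(m, n)) : R[i] :=
  \sum_(I : multi_index) w I * \prod_a ((V a (I a))%:C)%C.

Record is_complex_form (w : chart R X n -> X -> multi_index -> R[i]) : Prop :=
  IsComplexForm {
  form_smooth : forall c, atlas A c -> forall I,
    csmooth c (fun p => complex.Re (w c p I)) /\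
    csmooth c (fun p => complex.Im (w c p I));
  form_alternating : forall c p, atlas A c -> cdom c p ->
    forall (I : multi_index) (s : 'S_m),
    w c p [ffun a => I (s a)] = (-1) ^+ s * w c p I;
  form_change : forall c d p, atlas A c -> atlas A d ->
    cdom c p -> cdom d p -> forall I,
    w c p I = form_eval (w d p) (\matrix_(a, j) jac c d p (I a) j) }.

(* (nabla_k w)_I *)
Definition nabla_form (g : chart R X n -> X -> 'M[R]_n)
    (w : chart R X n -> X -> multi_index -> R[i])
    (c : chart R X n) (p : X) (k : 'I_n) (I : multi_index) : R[i] :=
  ccpartial c k (fun q => w c q I) p
  - \sum_a \sum_l ((christoffel g c p l k (I a))%:C)%C * w c p (upd I a l).

End ComplexForms.

Section CalabiYau.
Variable R : realType.

Record is_kahler (X : topologicalType) n (A : manifold R X n)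
    (g J : chart R X n -> X -> 'M[R]_n) : Prop := IsKahler {
  kahler_metric : is_metric A g;
  kahler_J_smooth : forall c, atlas A c -> forall i j,
    csmooth c (fun p => J c p i j);
  kahler_J_change : forall c d p, atlas A c -> atlas A d ->
    cdom c p -> cdom d p -> J c p *m jac c d p = jac c d p *m J d p;
  kahler_J_sqr : forall c p, atlas A c -> cdom c p ->
    J c p *m J c p = - 1%:M;
  kahler_hermitian : forall c p, atlas A c -> cdom c p ->
    J c p *m g c p *m (J c p)^T = g c p;
  kahler_J_parallel : forall c p, atlas A c -> cdom c p -> forall k i j,
    nabla_endo g J c p k i j = 0 }.

(* the matrix of omega (v, w) = g (J v, w) *)
Definition kahler_form X n (g J : chart R X n -> X -> 'M[R]_n)
    (c : chart R X n) (p : X) : 'M[R]_n := J c p *m g c p.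

Record calabi_yau (N : topologicalType) (m : nat) := CalabiYau {
  cy_manifold : manifold R N (2 * m);
  cy_metric : chart R N (2 * m) -> N -> 'M[R]_(2 * m);
  cy_J : chart R N (2 * m) -> N -> 'M[R]_(2 * m);
  cy_dz : chart R N (2 * m) -> N -> {ffun 'I_m -> 'I_(2 * m)} -> R[i];
  cy_kahler : is_kahler cy_manifold cy_metric cy_J;
  cy_ricci_flat : forall c p, atlas cy_manifold c -> cdom c p ->
    forall j k, ricci cy_metric c p j k = 0;
  cy_dz_form : is_complex_form cy_manifold cy_dz;
  (* type (m, 0): dz (..., J v, ...) = i dz (..., v, ...) *)
  cy_dz_type : forall c p, atlas cy_manifold c -> cdom c p ->
    forall (I : {ffun 'I_m -> 'I_(2 * m)}) (a : 'I_m),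
    \sum_l ((cy_J c p (I a) l)%:C)%C * cy_dz c p (upd I a l)
    = (0 +i* 1)%C * cy_dz c p I;
  cy_dz_parallel : forall c p, atlas cy_manifold c -> cdom c p -> forall k I,
    nabla_form cy_metric cy_dz c p k I = 0;
  (* |dz| is the Riemannian volume on every Lagrangian plane, spanned here by
     the rows of V *)
  cy_dz_normalized : forall c p, atlas cy_manifold c -> cdom c p ->
    forall V : 'M[R]_(m, 2 * m), row_free V ->
    V *m kahler_form cy_metric cy_J c p *m V^T = 0 ->
    Normc.normc (form_eval (cy_dz c p) V)
    = Num.sqrt (\det (V *m cy_metric c p *m V^T)) }.

End CalabiYau.

Section LagrangianImmersions.
Variables (R : realType) (M N : topologicalType) (m : nat).
Variables (AM : manifold R M m) (CY : calabi_yau R N m).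

Local Notation AN := (cy_manifold CY).
Local Notation g := (cy_metric CY).
Local Notation J := (cy_J CY).
Local Notation n := (2 * m)%N.

(* Pullbacks do not depend on the chart d used around F p, and [chart_at] just
   provides one. *)
Definition pullback_metric (F : M -> N) (c : chart R M m) (p : M) : 'M[R]_m :=
  let d := chart_at AN (F p) in
  dmap c d F p *m g d (F p) *m (dmap c d F p)^T.

Definition pullback_kahler (F : M -> N) (c : chart R M m) (p : M) : 'M[R]_m :=
  let d := chart_at AN (F p) in
  dmap c d F p *m kahler_form g J d (F p) *m (dmap c d F p)^T.

(* (F^* dz) (d/dx^1, ..., d/dx^m) *)
Definition pullback_dz (F : M -> N) (c : chart R M m) (p : M) : R[i] :=
  let d := chart_at AN (F p) in
  form_eval (cy_dz CY d (F p)) (dmap c d F p).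

Record lagrangian_immersion (F : M -> N) : Prop := LagrangianImmersion {
  immersion_smooth : smooth_map AM AN F;
  immersion_injective : forall c d p, atlas AM c -> atlas AN d ->
    cdom c p -> cdom d (F p) -> row_free (dmap c d F p);
  immersion_lagrangian : forall c p, atlas AM c -> cdom c p ->
    pullback_kahler F c p = 0 }.

(* A (d/dx^i, d/dx^j) for A = nabla dF, as components in the chart d *)
Definition second_fundamental (F : M -> N) (c : chart R M m) (d : chart R N n)
    (p : M) (i j : 'I_m) : 'rV[R]_n :=
  \row_b (cpartial c i (cpartial c j (fun q => cmap d (F q) 0 b)) p
          - \sum_k christoffel (pullback_metric F) c p k i j
                   * dmap c d F p k b
          + \sum_a \sum_e christoffel g d (F p) b a e
                   * dmap c d F p i a * dmap c d F p j e).

Definition mean_curvature (F : M -> N) (c : chart R M m) (d : chart R N n)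
    (p : M) : 'rV[R]_n :=
  \sum_i \sum_j invmx (pullback_metric F c p) i j
                *: second_fundamental F c d p i j.

(* Theta_H (d/dx^i) = < H, J dF (d/dx^i) > *)
Definition mean_curvature_form (F : M -> N) (c : chart R M m) (p : M)
    (i : 'I_m) : R :=
  let d := chart_at AN (F p) in
  (mean_curvature F c d p *m g d (F p)
   *m (row i (dmap c d F p) *m J d (F p))^T) 0 0.

Definition lagrangian_angle (F : M -> N) (alpha : M -> R) : Prop :=
  smooth_fun AM alpha /\
  forall c p, atlas AM c -> cdom c p -> forall i,
    cpartial c i alpha p = mean_curvature_form F c p i.

(* F^* (e^(- i phi0) dz) = e^(i alpha) dmu, evaluated on (d/dx^1, ..., d/dx^m)
   in the charts of the oriented atlas of M *)
Definition phase_equation (phi0 : R) (F : M -> N) (alpha : M -> R) : Prop :=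
  forall c p, atlas AM c -> cdom c p ->
    cis (- phi0) * pullback_dz F c p
    = cis (alpha p) * ((Num.sqrt (\det (pullback_metric F c p)))%:C)%C.

(* [alpha] and [phi0] are witnesses that F is almost calibrated. *)
Definition almost_calibrated_with (phi0 : R) (F : M -> N) (alpha : M -> R) :
    Prop :=
  [/\ lagrangian_angle F alpha, phase_equation phi0 F alpha &
      forall p, 0 < cos (alpha p)].

Definition time_interval (T : \bar R) : set R :=
  [set t | 0 <= t /\ (t%:E < T)%E].

(* points of 'rV_(m + 1) are (x, t), the coordinates on M followed by time *)
Local Notation time z := (z 0 (rshift m ord0)).

Definition smooth_spacetime_fun (T : \bar R) (f : M -> R -> R) : Prop :=
  forall c, atlas AM c ->
    smooth_on [set z : 'rV[R]_(m + 1) |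
                cimg c (lsubmx z) /\ time_interval T (time z)]
              (fun z => f (cinv c (lsubmx z)) (time z)).

Definition smooth_spacetime_map (T : \bar R) (F : M -> R -> N) : Prop :=
  {within [set z : M * R | time_interval T z.2],
     continuous (fun z : M * R => F z.1 z.2)} /\
  forall c d, atlas AM c -> atlas AN d -> forall b,
    smooth_on [set z : 'rV[R]_(m + 1) |
                [/\ cimg c (lsubmx z), time_interval T (time z) &
                    cdom d (F (cinv c (lsubmx z)) (time z))]]
              (fun z => cmap d (F (cinv c (lsubmx z)) (time z)) 0 b).

(* dF/dt = V at (p, t), V being given in the chart d; the derivative is taken
   within [0, T[, so it is one-sided at t = 0. *)
Definition velocity (T : \bar R) (F : M -> R -> N) (d : chart R N n)
    (p : M) (t : R) (V : 'rV[R]_n) : Prop :=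
  (fun s => (s - t)^-1 *: (cmap d (F p s) - cmap d (F p t)))
    @ within (time_interval T) t^' --> V.

(* dF/dt = H - tan alpha . J H on M x [0, T[ *)
Definition reparametrized_LMCF (T : \bar R) (F : M -> R -> N)
    (alpha : M -> R -> R) : Prop :=
  forall c d p t, atlas AM c -> atlas AN d -> time_interval T t ->
    cdom c p -> cdom d (F p t) ->
    let H := mean_curvature (F^~ t) c d p in
    velocity T F d p t (H - tan (alpha p t) *: (H *m J d (F p t))).

End LagrangianImmersions.

Section Volume.
Variable R : realType.

(* Integral over R^n of a nonnegative Borel function as an iterated Lebesgue
   integral (Tonelli). *)
Fixpoint lebesgue_int (n : nat) : ('rV[R]_n -> \bar R) -> \bar R :=
  match n with
  | 0%N => fun f => f 0
  | k.+1 => fun f => (\int[lebesgue_measure]_x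
      lebesgue_int (fun v : 'rV[R]_k =>
                      f (row_mx (\row_(_ < 1) x) v : 'rV[R]_(1 + k))))%E
  end.

End Volume.

Notation borel M := (g_sigma_algebraType (@open M)).

(* The Riemannian measure of the metric h: the Borel measure whose density
   with respect to dx^1 ... dx^m is sqrt (det h) in every chart. The base
   point of M only says that M is nonempty. *)
Definition is_riemannian_measure (R : realType) (M : ptopologicalType) m
    (A : manifold R M m) (h : chart R M m -> M -> 'M[R]_m)
    (mu : {measure set (borel M) -> \bar R}) : Prop :=
  forall c (B : set (borel M)), atlas A c -> measurable B ->
    B `<=` cdom c ->
    mu B = lebesgue_int (fun x : 'rV[R]_m =>
      (\1_(cmap c @` B) x * Num.sqrt (\det (h c (cinv c x))))%:E).

Definition is_minimum (R : realType) (S : set R) (e : R) : Prop :=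
  S e /\ lbound S e.

(* Main.v *)
(* Along the flow the volume form satisfies [cos alpha dmu_t = cos alpha dmu_0].
   Indeed [H = J grad alpha], so that the velocity is
   [(J + tan alpha) grad alpha]. As [dz] is parallel and of type (m, 0), the
   time derivative of [F^* (e^(- i phi0) dz) = e^(i alpha) dmu] is the exterior
   derivative of its contraction with the velocity, which is
   [(i / cos alpha) iota_(grad alpha) dmu] and has no real part. The imaginary
   part shows that [alpha_t] is the Laplacian of [alpha] where
   [grad alpha = 0], so that the minimum of [cos alpha] over M does not
   decrease. With [eps <= cos alpha <= 1] at all times, the densities at times
   0 and t are within a factor [eps] of each other. *)
Require Import Defs.
From HB Require Import structures.
From mathcomp Require Import all_boot all_order all_algebra all_fingroup.
From mathcomp Require Import all_classical all_reals all_analysis.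
From mathcomp Require Import complex ring lra.

Set Implicit Arguments.
Unset Strict Implicit.
Unset Printing Implicit Defensive.

Import Order.TTheory GRing.Theory Num.Theory.
Import numFieldNormedType.Exports.
Local Open Scope classical_set_scope.
Local Open Scope ring_scope.

(** * Calculus on row vectors *)

(** The hypotheses give [cos alpha > 0] only at time 0, while the flow equation contains
    [tan alpha], whose value where the cosine vanishes is a convention. The conservation law escapes
    this circularity because [cos alpha dmu] is positive exactly where [cos alpha] is: as long as
    this quantity is positive its time derivative is zero, and a continuous function with this
    property that starts positive never moves. Nor is [d alpha = Theta_H] assumed at positive times.
    Both [H] and [d alpha] are computed in charts as the same trace of the cubic form [< A, J . >]:
    for [d alpha] by differentiating the phase equation, for [H] by the total symmetry of the form.
    Smoothness at time 0 means only that local extensions exist. Time derivatives are therefore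
    computed at positive times, on open sets of space-time, and time 0 is reached by continuity of
    the density in time. At a spatial minimum of [cos alpha] the gradient of [alpha] is known to
    vanish only where [sin alpha <> 0]. This is harmless, because the minimum to be excluded lies
    below [eps <= 1]. *)

Section Calculus.
Variable R : realType.

Section Partial.
Variable n : nat.
Implicit Types (f g : 'rV[R]_n -> R) (x : 'rV[R]_n) (i : 'I_n).

Lemma diff_partialE f x v : differentiable f x ->
  'D_v f x = \sum_i v 0 i * partial i f x.
Proof.
move=> df; rewrite deriveE// [v in LHS]row_sum_delta linear_sum.
by apply: eq_bigr => i _; rewrite linearZ /partial deriveE.
Qed.

Lemma partial_near f g x i : {near x, f =1 g} -> partial i f x = partial i g x.
Proof. exact: near_eq_derive. Qed.

(** The differential is a choice, by [get], of a continuous linear map with a little-o remainder.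
    Functions with the same germ satisfy the same predicate, so the choice is the same for both. In
    the unfolded predicate the base point appears as [lim (nbhs x)]. *)
Lemma differentiable_near f g x :
  {near x, f =1 g} -> differentiable f x -> differentiable g x.
Proof.
have key (f' g' : 'rV[R]_n -> R) (df : 'rV[R]_n -> R) : {near x, f' =1 g'} ->
    (forall y, f' y = f' (lim (nbhs x)) + df (y - lim (nbhs x)) +o_(y \near x) (y
      - lim (nbhs x))) ->
    forall y, g' y = g' (lim (nbhs x)) + df (y - lim (nbhs x)) +o_(y \near x) (y
      - lim (nbhs x)).
  move=> fg; have fgx : f' x = g' x by exact: nbhs_singleton fg.
  rewrite !lim_id// => /funext Hf.
  have /eqaddoP H : f' = (fun y => f' x + df (y - x)) +o_x (fun y => y - x) by exact: Hf.
  suff Hg : g' = (fun y => g' x + df (y - x)) +o_x (fun y => y - x).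
    by move=> y; rewrite {1}Hg.
  apply/eqaddoP => e e0.
  near=> y; have -> : (g' - (fun y0 => g' x + df (y0 - x))) y
     = (f' - (fun y0 => f' x + df (y0 - x))) y.
    by rewrite !fctE fgx; congr (_ - _); apply/esym; near: y.
  by near: y; exact: H.
move=> fg /diffP[dc df]; suff dE : 'd g x = 'd f x :> ('rV[R]_n -> R).
  by apply/diffP; rewrite dE; split => //; exact: key fg _.
rewrite /diff; congr (_ (get _)); apply/funext => h; apply/propext.
split=> -[hc H]; split=> //; [|exact: key fg H].
apply: key H; near do apply/esym.
Unshelve. all: by end_near. Qed.

Lemma partialD f g x i : differentiable f x -> differentiable g x ->
  partial i (fun y => f y + g y) x = partial i f x + partial i g x.
Proof. by move=> df dg; rewrite /partial deriveD//; exact: diff_derivable. Qed.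

Lemma partialB f g x i : differentiable f x -> differentiable g x ->
  partial i (fun y => f y - g y) x = partial i f x - partial i g x.
Proof. by move=> df dg; rewrite /partial deriveB//; exact: diff_derivable. Qed.

Lemma partialM f g x i : differentiable f x -> differentiable g x ->
  partial i (fun y => f y * g y) x = partial i f x * g x + f x * partial i g x.
Proof.
move=> df dg; rewrite /partial deriveM//; try exact: diff_derivable.
by rewrite addrC [g x *: _]mulrC.
Qed.

Lemma partial_cst a x i : partial i (fun=> a) x = 0.
Proof. exact: derive_cst. Qed.

Lemma differentiable_bigsum (I : Type) (r : seq I) (P : pred I)
    (f : I -> 'rV[R]_n -> R) x :
  (forall a, differentiable (f a) x) ->
  differentiable (fun y => \sum_(a <- r | P a) f a y) x.
Proof.
move=> df; elim: r => [|a r IH].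
  by under eq_fun do rewrite big_nil; exact: differentiable_cst.
under eq_fun do rewrite big_cons.
by case: (P a) => //; exact: differentiableD.
Qed.

Lemma partial_sum (I : Type) (r : seq I) (P : pred I)
    (f : I -> 'rV[R]_n -> R) x i :
  (forall a, differentiable (f a) x) ->
  partial i (fun y => \sum_(a <- r | P a) f a y) x
  = \sum_(a <- r | P a) partial i (f a) x.
Proof.
move=> df; elim: r => [|a r IH].
  by under eq_fun do rewrite big_nil; rewrite big_nil partial_cst.
under eq_fun do rewrite big_cons; rewrite big_cons.
case: ifP => // _; rewrite partialD ?IH//.
exact: differentiable_bigsum.
Qed.

Lemma differentiable_bigprod (I : Type) (r : seq I) (P : pred I)
    (f : I -> 'rV[R]_n -> R) x :
  (forall a, differentiable (f a) x) ->
  differentiable (fun y => \prod_(a <- r | P a) f a y) x.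
Proof.
move=> df; elim: r => [|a r IH].
  by under eq_fun do rewrite big_nil; exact: differentiable_cst.
under eq_fun do rewrite big_cons.
by case: (P a) => //; exact: differentiableM.
Qed.

Lemma partial_prod (I : finType) (f : I -> 'rV[R]_n -> R) x i :
  (forall a, differentiable (f a) x) ->
  partial i (fun y => \prod_a f a y) x
  = \sum_a partial i (f a) x * \prod_(b | b != a) f b x.
Proof.
move=> df.
(* The condition [b != a] drops every occurrence of [a], hence an induction over lists without
   repetition. *)
suff H : forall r : seq I, uniq r -> partial i (fun y => \prod_(a <- r) f a y) x
  = \sum_(a <- r) partial i (f a) x * \prod_(b <- r | b != a) f b x.
  by rewrite H ?index_enum_uniq.
elim=> [_|a r IH /= /andP[ar ur]].
  by under eq_fun do rewrite big_nil; rewrite big_nil partial_cst.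
under eq_fun do rewrite big_cons; rewrite !big_cons eqxx/=.
rewrite partialM//; last exact: differentiable_bigprod.
rewrite IH// mulr_sumr; congr (_ * _ + _).
  rewrite big_seq [RHS]big_seq_cond; apply: eq_big => // b; case: (boolP (b \in r)) => //=.
  by move=> br; apply/esym; apply: contra ar => /eqP <-.
rewrite [RHS]big_seq big_seq; apply: eq_bigr => b br.
rewrite big_cons; have -> : a != b by apply: contra ar => /eqP ->.
by rewrite mulrCA.
Qed.

End Partial.

Lemma differentiable_rV (V : normedModType R) k (g : V -> 'rV[R]_k) x :
  (forall b, differentiable (fun y => g y 0 b) x) -> differentiable g x.
Proof.
move=> dg; have -> : g = \sum_b (fun y => g y 0 b *: (delta_mx 0 b : 'rV[R]_k)).
  by apply/funext => y; rewrite fct_sumE -row_sum_delta.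
by apply: differentiable_sum => b; exact: differentiableZl.
Qed.

Lemma differentiable_comp_rV (V : normedModType R) k (f : 'rV[R]_k -> R) (g : V ->
  'rV[R]_k) x :
  (forall b, differentiable (fun y => g y 0 b) x) -> differentiable f (g x) ->
  differentiable (fun y => f (g y)) x.
Proof.
by move=> dg df; apply: (@differentiable_comp _ _ _ _ g f x) => //; exact: differentiable_rV.
Qed.

Lemma partial_comp n k (f : 'rV[R]_k -> R) (g : 'rV[R]_n -> 'rV[R]_k) x i :
  (forall b, differentiable (fun y => g y 0 b) x) -> differentiable f (g x) ->
  partial i (fun y => f (g y)) x
  = \sum_b partial i (fun y => g y 0 b) x * partial b f (g x).
Proof.
move=> dg df; have dgx := differentiable_rV dg.
rewrite {1}/partial deriveE; last exact: differentiable_comp_rV.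
rewrite (_ : (fun y => f (g y)) = f \o g)// diff_comp//= -deriveE// diff_partialE//.
apply: eq_bigr => b _; rewrite /partial; congr (_ * _).
rewrite -deriveE// derive_mx; last exact: diff_derivable.
by rewrite mxE.
Qed.

Lemma differentiable_comp1 (V : normedModType R) (f : R -> R) (g : V -> R) x :
  derivable f (g x) 1 -> differentiable g x -> differentiable (fun y => f (g y)) x.
Proof. by move=> /derivable1_diffP df dg; apply: (differentiable_comp dg df). Qed.

Lemma partial_comp1 n (f : R -> R) (g : 'rV[R]_n -> R) x i :
  derivable f (g x) 1 -> differentiable g x ->
  partial i (fun y => f (g y)) x = 'D_1 f (g x) * partial i g x.
Proof.
move=> df dg; have dff := df; move/derivable1_diffP: dff => dff.
rewrite {1}/partial deriveE; last exact: differentiable_comp1.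
rewrite (_ : (fun y => f (g y)) = f \o g)// diff_comp//= -[in LHS]deriveE// -deriveE//.
rewrite /partial -[X in 'D_X f _ = _]mulr1 deriveE// [LHS]linearZ /= -deriveE//.
by rewrite mulrC.
Qed.

Lemma Cr_sub r n (U U' : set 'rV[R]_n) f : U' `<=` U -> Cr r U f -> Cr r U' f.
Proof.
move=> UU; elim: r f => [|r IH] f /=; first by move=> H x /UU; exact: H.
by case=> H1 H2; split=> [x /UU|i]; [exact: H1|exact: IH].
Qed.

Lemma Cr_eq r n (U : set 'rV[R]_n) f h : open U -> (forall y, U y -> f y = h y) ->
  Cr r U f -> Cr r U h.
Proof.
move=> oU; have nU x : U x -> nbhs x U by move=> Ux; exact: open_nbhs_nbhs.
elim: r f h => [|r IH] f h fh /=.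
  move=> H x Ux; rewrite /prop_for /continuous_at -(fh x)//.
  have fhx : {near x, f =1 h} by apply: filterS (nU _ Ux) => y /fh.
  exact: cvg_trans (near_eq_cvg fhx) (H x Ux).
move=> [H1 H2]; split=> [x Ux|i].
  by apply: differentiable_near (H1 _ Ux); near=> y; apply: fh; near: y; exact: nU.
apply: IH (H2 i) => y Uy; apply: partial_near; near=> z; apply: fh; near: z; exact: nU.
Unshelve. all: by end_near. Qed.

(** One neighbourhood serves all orders [r], which makes the notion stable under partial
    derivatives. *)
Definition smooth_at n (f : 'rV[R]_n -> R) (x : 'rV[R]_n) :=
  exists2 U, open_nbhs x U & forall r, Cr r U f.

Lemma smooth_at_differentiable n (f : 'rV[R]_n -> R) x : smooth_at f x -> differentiable f x.
Proof. by case=> U [_ Ux] /(_ 1%N)[+ _]; apply. Qed.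

Lemma smooth_at_partial n (f : 'rV[R]_n -> R) x i : smooth_at f x -> smooth_at (partial i f) x.
Proof. by case=> U Ux H; exists U => // r; case: (H r.+1) => _; exact. Qed.

Lemma smooth_at_continuous n (f : 'rV[R]_n -> R) x : smooth_at f x -> {for x, continuous f}.
Proof. by case=> U [_ Ux] /(_ 0%N); apply. Qed.

Lemma smooth_at_near n (f g : 'rV[R]_n -> R) x : {near x, f =1 g} ->
  smooth_at f x -> smooth_at g x.
Proof.
rewrite /prop_near1 nbhsE => -[V [oV Vx] VE] [U [oU Ux] H].
exists (U `&` V); first by split; [exact: openI|].
move=> r; apply: (@Cr_eq _ _ _ f); [exact: openI|by move=> y [_ /VE]|].
by apply: Cr_sub (H r) => y [].
Qed.

(** Near an interior point of [S] the smooth extension agrees with [f], so smoothness on [S] becomes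
    genuine smoothness there. On [M x [0, T[] this applies at positive times. *)
Lemma smooth_on_at n (S : set 'rV[R]_n) f x : smooth_on S f -> nbhs x S -> smooth_at f x.
Proof.
move=> /(_ x) + nS; case; first exact: nbhs_singleton.
move=> U [h [oU Ux H E]]; apply: (@smooth_at_near _ h); last by exists U.
near=> y; apply/esym/E; near: y => //; exact: open_nbhs_nbhs.
Unshelve. all: by end_near. Qed.

Lemma is_derive_line (V : normedModType R) (f : V -> R) (y w : V) (s : R) :
  derivable f (y + s *: w) w ->
  is_derive s 1 (fun s => f (y + s *: w)) ('D_w f (y + s *: w)).
Proof.
move=> df; have E : (fun h : R => h^-1 *: (f (y + (h *: 1 + s) *: w) - f (y + s *: w)))
   = (fun h => h^-1 *: (f (h *: w + (y + s *: w)) - f (y + s *: w))).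
  by apply/funext => h; rewrite scalerDl [_%:A]mulr1 addrCA.
by apply: DeriveDef; rewrite /derivable/derive/= E.
Qed.

Lemma MVT_line (V : normedModType R) (f : V -> R) (y w : V) (h : R) : 0 < h ->
  (forall s, 0 <= s <= h -> derivable f (y + s *: w) w) ->
  exists2 s, 0 < s < h & f (y + h *: w) - f y = h * 'D_w f (y + s *: w).
Proof.
move=> h0 df.
have dl s : 0 <= s <= h -> is_derive s 1 (fun s => f (y + s *: w)) ('D_w f (y + s *: w)).
  by move=> /df; exact: is_derive_line.
have [||s] := @MVT R (fun s => f (y + s *: w)) (fun s => 'D_w f (y + s *: w)) 0 h h0.
- by move=> s; rewrite in_itv/= => /andP[s0 sh]; apply: dl; rewrite !ltW.
- apply: derivable_within_continuous => s; rewrite in_itv/= => sh.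
  by have [] := dl s sh.
by rewrite in_itv/= => sh; rewrite scale0r addr0 subr0 mulrC => E; exists s.
Qed.

Lemma derive_addr (V : normedModType R) (f : V -> R) (w x u : V) :
  'D_u (fun y => f (y + w)) x = 'D_u f (x + w).
Proof. by rewrite /derive/=; under eq_fun do rewrite -addrA. Qed.

(** Two applications of the mean value theorem: along [i] to the increment of [f] in direction [j],
    then along [j] to [partial i f]. *)
Lemma mixed_difference n (f : 'rV[R]_n -> R) (U : set 'rV[R]_n) x (i j : 'I_n) (h : R) :
  0 < h -> Cr 2 U f ->
  (forall a b, 0 <= a <= h -> 0 <= b <= h ->
     U (x + a *: delta_mx 0 i + b *: delta_mx 0 j)) ->
  exists a b, [/\ 0 < a < h, 0 < b < h &
   f (x + h *: delta_mx 0 i + h *: delta_mx 0 j) - f (x + h *: delta_mx 0 i)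
   - (f (x + h *: delta_mx 0 j) - f x)
   = h * (h * partial j (partial i f) (x + a *: delta_mx 0 i + b *: delta_mx 0 j))].
Proof.
move=> h0 [d1 d2] HU; set u : 'rV[R]_n := delta_mx 0 i; set v : 'rV[R]_n := delta_mx 0 j.
have h00 : 0 <= (0 : R) <= h by rewrite lexx ltW.
have hh : 0 <= h <= h by rewrite lexx ltW.
have du a b : 0 <= a <= h -> 0 <= b <= h -> differentiable f (x + a *: u + b *: v).
  by move=> ha hb; apply: d1; exact: HU.
have dt a : 0 <= a <= h -> differentiable (fun y => f (y + h *: v)) (x + a *: u).
  by move=> ah; apply: (@differentiable_comp _ _ _ _ (fun y => y + h *: v) f) => //; exact: du.
have du0 a : 0 <= a <= h -> differentiable f (x + a *: u).
  by move=> ah; have := du a 0 ah h00; rewrite scale0r addr0.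
have [a ah Ea] : exists2 a, 0 < a < h & f (x + h *: u + h *: v) - f (x + h *: u)
   - (f (x + h *: v) - f x) = h * 'D_u (fun y => f (y + h *: v) - f y) (x + a *: u).
  apply: (MVT_line h0) => s sh; apply: diff_derivable.
  by apply: differentiableB; [exact: dt|exact: du0].
have aW : 0 <= a <= h by case/andP: ah => *; rewrite !ltW.
have [b bh Eb] : exists2 b, 0 < b < h & partial i f (x + a *: u
  + h *: v) - partial i f (x + a *: u)
   = h * 'D_v (partial i f) (x + a *: u + b *: v).
  apply: (MVT_line h0) => s sh; apply: diff_derivable.
  by have [+ _] := d2 i; apply; exact: HU.
exists a, b; split => //; rewrite Ea; congr (_ * _).
rewrite deriveB; [|by apply: diff_derivable; exact: dt|by apply: diff_derivable; exact: du0].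
by rewrite -[RHS]Eb derive_addr.
Qed.

Lemma subr_subACA (A B C D : R) : A - B - (C - D) = A - C - (B - D).
Proof. by ring. Qed.

(** Schwarz's theorem. The second difference over a square of side [h] is symmetric in the two
    directions, so the two mixed derivatives take a common value, each at some point of the square.
    Continuity then compares their values at [x]. *)
Lemma partialC n (f : 'rV[R]_n -> R) x (i j : 'I_n) : smooth_at f x ->
  partial j (partial i f) x = partial i (partial j f) x.
Proof.
move=> [U [oU Ux] H]; have [_ d2] := H 2%N.
set u : 'rV[R]_n := delta_mx 0 i; set v : 'rV[R]_n := delta_mx 0 j.
have [_ /(_ j) cij] := d2 i; have [_ /(_ i) cji] := d2 j.
have phic : {for (0 : R * R), continuous (fun z : R * R => x + z.1 *: u + z.2 *: v)}.
  apply: cvgD; first (apply: cvgD; first exact: cvg_cst).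
    by apply: cvgZr_tmp; exact: cvg_fst.
  by apply: cvgZr_tmp; exact: cvg_snd.
apply/eqP; rewrite -subr_eq0 -normr_le0; apply/ler_addgt0Pl => e e0; rewrite addr0.
have nU : \forall z \near (0 : R * R), U (x + z.1 *: u + z.2 *: v).
  have := phic; rewrite /prop_for /continuous_at /= !scale0r !addr0 => /(_ U); apply.
  exact: open_nbhs_nbhs.
have cont (k : 'rV[R]_n -> R) : (forall y, U y -> {for y, continuous k}) ->
    \forall z \near (0 : R * R), `|k x - k (x + z.1 *: u + z.2 *: v)| < e / 2.
  move=> kc; have : k (x + z.1 *: u + z.2 *: v) @[z --> (0 : R * R)] --> k x.
    apply: (@cvg_comp _ _ _ (fun z : R * R => x + z.1 *: u + z.2 *: v) k _ (nbhs x));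
      last exact: kc.
    by have := phic; rewrite /prop_for /continuous_at /= !scale0r !addr0.
  by move/cvgrPdist_lt => /(_ (e / 2)); apply; rewrite divr_gt0.
have := cont _ cij; have := cont _ cji; have := nU.
move=> /nbhs_ballP[d1 /= d10 B1] /nbhs_ballP[d2' /= d20 B2] /nbhs_ballP[d3 /= d30 B3].
(* With this side the whole square lies in [U], and both mixed derivatives stay within [e / 2] of
   their values at [x] on it. *)
pose h := Num.min d1 (Num.min d2' d3) / 2.
have h0 : 0 < h by rewrite divr_gt0// !lt_min d10 d20 d30.
have hball d a b : h < d -> 0 <= a <= h -> 0 <= b <= h -> ball (0 : R * R) d (a, b).
  move=> hd /andP[a0 ah] /andP[b0 bh].
  by split; rewrite /ball /= sub0r normrN ger0_norm//; apply: le_lt_trans hd.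
have hm : h < Num.min d1 (Num.min d2' d3).
  by rewrite ltr_pdivrMr// ltr_pMr ?ltr1n// !lt_min d10 d20 d30.
move: hm; rewrite !lt_min => /and3P[hd1 hd2 hd3].
have [|a [b [ah bh E1]]] := @mixed_difference n f U x i j h h0 (H 2%N).
  by move=> a b ha hb; apply: (B1 (a, b)); exact: hball.
have [|a' [b' [ah' bh' E2]]] := @mixed_difference n f U x j i h h0 (H 2%N).
  by move=> s t hs ht; rewrite addrAC; apply: (B1 (t, s)); exact: hball.
have := B3 (a, b) (hball _ _ _ hd3 _ _); have := B2 (b', a') (hball _ _ _ hd2 _ _).
rewrite /= -/u -/v.
rewrite -/u -/v in E1 E2; clearbody h u v.
have -> : partial j (partial i f) (x + a *: u + b *: v)
  = partial i (partial j f) (x + b' *: u + a' *: v).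
  rewrite (addrAC x (b' *: u)); apply/(mulfI (lt0r_neq0 h0))/(mulfI (lt0r_neq0 h0)).
  apply: (eq_trans (esym E1)); apply: (eq_trans _ E2).
  rewrite (addrAC x (h *: v) (h *: u)); exact: subr_subACA.
set P := partial i _ (x + _ + _) => K1 K2.
rewrite -(subrKA P) (le_trans (ler_normD _ _))// (splitr e) ltW//.
have hW (s : R) : 0 < s < h -> 0 <= s <= h by case/andP=> *; rewrite !ltW.
apply: ltrD; first by apply: K2; exact: hW.
by rewrite distrC; apply: K1; exact: hW.
Qed.

Lemma derive_lt0_right (V : normedModType R) (f : V -> R) (z w : V) :
  derivable f z w -> 'D_w f z < 0 ->
  exists2 e : R, 0 < e & forall s, 0 < s < e -> f (z + s *: w) < f z.
Proof.
move=> df neg.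
have cf : h^-1 *: (f (h *: w + z) - f z) @[h --> 0^'] --> 'D_w f z by exact: df.
have : \forall h \near 0^', h^-1 *: (f (h *: w + z) - f z) < 0 by exact: cvgr_lt cf _ neg.
rewrite /prop_near1 /dnbhs /within /= => /nbhs_ballP[e /= e0 B]; exists e => // s /andP[s0 se].
have := B s; rewrite /ball /= sub0r normrN gtr0_norm// => /(_ se (lt0r_neq0 s0)).
by rewrite pmulr_rlt0 ?invr_gt0// subr_lt0 addrC.
Qed.

(** Only a one-sided comparison is assumed: in the maximum principle the minimum may lie at the last
    time under consideration. *)
Lemma derive_ge0_right (V : normedModType R) (f : V -> R) (z w : V) (d : R) : 0 < d ->
  derivable f z w -> (forall s, 0 < s < d -> f z <= f (z + s *: w)) -> 0 <= 'D_w f z.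
Proof.
move=> d0 df H; rewrite leNgt; apply/negP => /(derive_lt0_right df)[e e0 He].
pose s := Num.min d e / 2.
have m0 : 0 < Num.min d e by rewrite lt_min d0 e0.
have s0 : 0 < s by rewrite divr_gt0.
have : s < Num.min d e by rewrite ltr_pdivrMr// ltr_pMr ?ltr1n.
by rewrite lt_min => /andP[sd se]; have := H s; have := He s;
  rewrite s0 sd se leNgt => ->// /(_ isT).
Qed.

Lemma derive_dirN (V : normedModType R) (f : V -> R) (z w : V) :
  differentiable f z -> 'D_(- w) f z = - 'D_w f z.
Proof. by move=> df; rewrite !deriveE// linearN. Qed.

Lemma local_min_line n (f : 'rV[R]_n -> R) (z w : 'rV[R]_n) (d : R) : 0 < d ->
  (\forall y \near z, differentiable f y) -> (forall j, differentiable (partial j f) z) ->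
  (forall s, `|s| < d -> f z <= f (z + s *: w)) ->
  'D_w f z = 0 /\ 0 <= \sum_i \sum_j w 0 i * w 0 j * partial i (partial j f) z.
Proof.
move=> d0 ndf dk H; have df := nbhs_singleton ndf.
have D0 : 'D_w f z = 0.
  apply/eqP; rewrite eq_le; apply/andP; split; last first.
    apply: (derive_ge0_right d0); first exact: diff_derivable.
    by move=> s /andP[s0 sd]; apply: H; rewrite gtr0_norm.
  rewrite -oppr_ge0 -derive_dirN//; apply: (derive_ge0_right d0); first exact: diff_derivable.
  by move=> s /andP[s0 sd]; rewrite scalerN -scaleNr; apply: H; rewrite normrN gtr0_norm.
split => //; pose k y := \sum_j w 0 j * partial j f y.
have dk' : differentiable k z.
  by apply: differentiable_bigsum => j; apply: differentiableM => //;
    exact: differentiable_cst.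
have kE : 'D_w k z = \sum_i \sum_j w 0 i * w 0 j * partial i (partial j f) z.
  rewrite diff_partialE//; apply: eq_bigr => i _; rewrite partial_sum; last first.
    by move=> j; apply: differentiableM => //; exact: differentiable_cst.
  rewrite mulr_sumr; apply: eq_bigr => j _; rewrite partialM//.
  by rewrite partial_cst mul0r add0r mulrA.
(* Were the derivative of [k] negative, [k] would be negative just after [z], and the mean value
   theorem would push [f] below [f z] there. *)
rewrite -kE leNgt; apply/negP => neg.
have k0 : k z = 0 by rewrite -D0 diff_partialE.
have [e e0 Be] : exists2 e : R, 0 < e & forall s, 0 < s < e -> k (z + s *: w) < 0.
  by have := derive_lt0_right (@diff_derivable _ _ _ _ _ w dk') neg; rewrite k0.
have [e' e'0 Be'] : exists2 e' : R, 0 < e' & forall s,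
  0 <= s < e' -> differentiable f (z + s *: w).
  have : (fun s : R => z + s *: w) s @[s --> 0] --> z.
    rewrite -[X in _ --> X]addr0 -(scale0r w); apply: cvgD; first exact: cvg_cst.
    by apply: cvgZr_tmp; exact: cvg_id.
  move/(_ _ ndf) => /nbhs_ballP[e' /= e'0 B]; exists e' => // s /andP[s0 se].
  by apply: (B s); rewrite /ball /= sub0r normrN ger0_norm.
pose s := Num.min d (Num.min e e') / 2.
have m0 : 0 < Num.min d (Num.min e e') by rewrite !lt_min d0 e0 e'0.
have s0 : 0 < s by rewrite divr_gt0.
have : s < Num.min d (Num.min e e') by rewrite ltr_pdivrMr// ltr_pMr ?ltr1n.
rewrite !lt_min => /and3P[sd se se'].
have [|t /andP[t0 ts] E] := @MVT_line _ f z w s s0.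
  move=> t /andP[t0 ts]; apply: diff_derivable.
  by apply: Be'; rewrite t0 (le_lt_trans ts).
have := H s; rewrite gtr0_norm// => /(_ sd); rewrite -subr_ge0 E leNgt => /negP; apply.
rewrite pmulr_rlt0// diff_partialE; first by apply: Be; rewrite t0 (lt_trans ts).
by apply: Be'; rewrite (ltW t0) (lt_trans ts).
Qed.

Lemma differentiable_det n k (A : 'rV[R]_n -> 'M[R]_k) x :
  (forall i j, differentiable (fun y => A y i j) x) ->
  differentiable (fun y => \det (A y)) x.
Proof.
move=> dA; rewrite /determinant; apply: differentiable_bigsum => s.
by apply: differentiableM; [exact: differentiable_cst|exact: differentiable_bigprod].
Qed.

(** Cramer's formula. It describes [invmx] only where the determinant is nonzero, which by
    continuity is the case on a neighbourhood of [x]. *)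
Lemma differentiable_invmx n k (A : 'rV[R]_n -> 'M[R]_k) x :
  (forall i j, differentiable (fun y => A y i j) x) -> A x \in unitmx ->
  forall i j, differentiable (fun y => invmx (A y) i j) x.
Proof.
move=> dA uA i j; have dd := differentiable_det dA.
have d0 : \det (A x) != 0 by rewrite -unitfE -unitmxE.
have near0 : \forall y \near x, \det (A y) != 0.
  have := differentiable_continuous dd; rewrite /continuous_at => cd.
  exact: (cd [set y | y != 0] (open_nbhs_nbhs (conj (@open_neq _ 0) d0))).
apply: (@differentiable_near _ (fun y => (\det (A y))^-1 * \adj (A y) i j)).
  apply: filterS near0 => y dy; rewrite /invmx unitmxE unitfE dy.
  by rewrite [in RHS]mxE.
apply: differentiableM; first exact: differentiableV.
have -> : (fun y => \adj (A y) i j) = (fun y => (-1) ^+ (j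
  + i) * \det (row' j (col' i (A y)))).
  by apply/funext => y; rewrite mxE.
apply: differentiableM; first exact: differentiable_cst.
apply: differentiable_det => a b.
by have -> : (fun y => row' j (col' i (A y)) a b) = (fun y => A y (lift j a) (lift i b))
  by apply/funext => y; rewrite !mxE.
Qed.

End Calculus.

(** * Points of space-time as row vectors *)

Section SpaceTime.
Variables (R : realType) (m : nat).
Local Notation sp a := (lshift 1 a : 'I_(m + 1)).
Local Notation tm := (rshift m ord0 : 'I_(m + 1)).
Local Notation E := 'rV[R]_(m + 1).
Local Notation time z := (z 0 (rshift m ord0)).

Definition stpt (x : 'rV[R]_m) (t : R) : E := row_mx x t%:M.

Lemma stpt_space x t : lsubmx (stpt x t) = x.
Proof. exact: row_mxKl. Qed.

Lemma stpt_time x t : time (stpt x t) = t.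
Proof. by rewrite row_mxEr mxE. Qed.

Lemma stptE (z : E) : z = stpt (lsubmx z) (time z).
Proof.
rewrite -{1}(hsubmxK z) /stpt; congr row_mx.
by apply/rowP => i; rewrite !ord1 !mxE eqxx.
Qed.

Lemma stptD x y s t : stpt (x + y) (s + t) = stpt x s + stpt y t.
Proof. by rewrite /stpt add_row_mx raddfD. Qed.

Lemma stptZ x (s k : R) : stpt (k *: x) (k * s) = k *: stpt x s.
Proof. by rewrite /stpt scale_row_mx scale_scalar_mx. Qed.

Lemma delta_sp a : delta_mx 0 (sp a) = stpt (delta_mx 0 a) 0.
Proof.
apply/rowP => j; rewrite mxE eqxx /=; case: (split_ordP j) => k ->.
  by rewrite row_mxEl mxE eqxx (inj_eq (@lshift_inj _ _)).
by rewrite row_mxEr !ord1 !mxE eqxx eq_rlshift.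
Qed.

Lemma delta_tm : delta_mx 0 tm = stpt 0 1.
Proof.
apply/rowP => j; rewrite mxE eqxx /=; case: (split_ordP j) => k ->.
  by rewrite row_mxEl mxE eq_lrshift.
by rewrite row_mxEr !ord1 !mxE eqxx.
Qed.

Lemma partial_sp (phi : E -> R) x t i :
  partial (sp i) phi (stpt x t) = partial i (fun y => phi (stpt y t)) x.
Proof.
have E1 : (fun h : R => h^-1 *: (phi (h *: delta_mx 0 (sp i) + stpt x t) - phi (stpt x t)))
  = (fun h : R => h^-1 *: (phi (stpt (h *: delta_mx 0 i + x) t) - phi (stpt x t))).
  apply/funext => h; rewrite delta_sp.
  by rewrite -stptZ mulr0 -stptD add0r.
by rewrite /partial /derive/= E1.
Qed.

(** Stated for the difference quotients, before any limit, so that it rewrites in [derivable] as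
    well as in [derive]. *)
Lemma derive_tm (V : normedModType R) (phi : E -> V) x t :
  (fun h : R => h^-1 *: (phi (h *: delta_mx 0 tm + stpt x t) - phi (stpt x t)))
  = (fun h : R => h^-1 *: (phi (stpt x (h + t)) - phi (stpt x t))).
Proof. by apply/funext => h; rewrite delta_tm -stptZ scaler0 mulr1 -stptD add0r. Qed.

Lemma is_derive_tm (phi : E -> R) x t : differentiable phi (stpt x t) ->
  is_derive t 1 (fun s => phi (stpt x s)) (partial tm phi (stpt x t)).
Proof.
move=> dphi; have := @diff_derivable _ _ _ phi (stpt x t) (delta_mx 0 tm) dphi.
rewrite /partial /derivable /derive/= derive_tm => dd.
have E1 : (fun h : R => h^-1 *: (phi (stpt x (h *: 1 + t)) - phi (stpt x t)))
  = (fun h : R => h^-1 *: (phi (stpt x (h + t)) - phi (stpt x t))).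
  by apply/funext => h; rewrite /GRing.scale /= mulr1.
by apply: DeriveDef; rewrite /derivable /derive/= E1.
Qed.

Lemma partial_tmE (phi : E -> R) z : partial tm phi z
  = lim (h^-1 *: (phi (stpt (lsubmx z) (h
    + time z)) - phi (stpt (lsubmx z) (time z))) @[h --> 0^']).
Proof. by rewrite {1}(stptE z) /partial /derive/= derive_tm. Qed.

Lemma stpt_cont : continuous (fun w : 'rV[R]_m * R => stpt w.1 w.2).
Proof.
move=> [x t] U /nbhs_ballP[e e0 B]; apply/nbhs_ballP; exists e => // -[y s] [/= xy ts].
apply: B; split => // i j /=; rewrite ord1; case: (split_ordP j) => k ->.
  by rewrite !row_mxEl; have [_ H] := xy; exact: H.
by rewrite !row_mxEr !ord1 !mxE eqxx.
Qed.

Lemma lsubmx_cont : continuous (fun z : E => lsubmx z).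
Proof. by move=> z; apply: differentiable_continuous; exact: differentiable_lsubmx. Qed.

Lemma time_cont : continuous (fun z : E => time z).
Proof. by move=> z; apply: differentiable_continuous; exact: differentiable_coord. Qed.

End SpaceTime.

(** * Alternating forms and quadratic forms *)

Section LinearAlgebra.
Variable R : realType.

Section Forms.
Variables (m n : nat).
Local Notation multi_index := {ffun 'I_m -> 'I_n}.
Implicit Types (u v : multi_index -> R) (V : 'M[R]_(m, n)) (x : 'rV[R]_n) (a b : 'I_m).

Definition rform u V : R := \sum_(I : multi_index) u I * \prod_a V a (I a).

(* The value of the form on the rows of [V], the row [a] being replaced by [x]. *)
Definition slot u V a x : R :=
  \sum_(I : multi_index) u I * (x 0 (I a) * \prod_(b | b != a) V b (I b)).

Definition alternating_form u :=
  forall (I : multi_index) (s : 'S_m), u [ffun a => I (s a)] = (-1) ^+ s * u I.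

Lemma slot_row u V a : slot u V a (row a V) = rform u V.
Proof. by apply: eq_bigr => I _; rewrite mxE [in RHS](bigD1 a). Qed.

Lemma slotD u V a x y : slot u V a (x + y) = slot u V a x + slot u V a y.
Proof. by rewrite -big_split; apply: eq_bigr => I _; rewrite mxE mulrDl mulrDr. Qed.

Lemma slotZ u V a k x : slot u V a (k *: x) = k * slot u V a x.
Proof. by rewrite mulr_sumr; apply: eq_bigr => I _; rewrite mxE -mulrA mulrCA. Qed.

Lemma slot0 u V a : slot u V a 0 = 0.
Proof. by rewrite -(scale0r 0) slotZ mul0r. Qed.

Lemma slot_sum (K : finType) u V a (x : K -> 'rV[R]_n) :
  slot u V a (\sum_k x k) = \sum_k slot u V a (x k).
Proof. by elim/big_ind2: _ => [|y1 y2 z1 z2 <- <-|//]; rewrite ?slot0 ?slotD. Qed.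

(** The form is evaluated on a matrix with equal rows [a] and [b]. Reindexing the multi-indices by
    the transposition of [a] and [b] changes its sign. *)
Lemma slot_alternating u V a b : alternating_form u -> b != a -> slot u V a (row b V) = 0.
Proof.
move=> altu ba; pose V' : 'M[R]_(m, n) := \matrix_(c, j) V (if c == a then b else c) j.
have -> : slot u V a (row b V) = rform u V'.
  apply: eq_bigr => I _; rewrite [in RHS](bigD1 a)//= !mxE eqxx; congr (_ * (_ * _)).
  by apply: eq_bigr => c /negPf ca; rewrite mxE ca.
suff : rform u V' = - rform u V' by lra.
pose s := tperm a b; pose h (I : multi_index) : multi_index := [ffun c => I (s c)].
have hK : involutive h by move=> I; apply/ffunP => c; rewrite !ffunE tpermK.
rewrite {1}/rform (reindex h) /=; last by exists h => I _; rewrite hK.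
rewrite -sumrN; apply: eq_bigr => I _.
rewrite /h altu odd_tperm eq_sym ba expr1 mulN1r mulNr; congr (- (_ * _)).
rewrite [RHS](reindex_inj (@perm_inj _ s)); apply: eq_bigr => c _; rewrite ffunE !mxE.
by rewrite /s; case: tpermP => [->|->|]; rewrite ?eqxx ?(negPf ba)//; case: eqP.
Qed.

(** In slot [a] only the diagonal term [B a a] of the combination survives. This is how the
    tangential part of a covariant derivative, and through [J] the normal part, acts on the
    phases. *)
Lemma slot_trace u V (B : 'M[R]_m) : alternating_form u ->
  \sum_a slot u V a (row a (B *m V)) = \tr B * rform u V.
Proof.
move=> altu; rewrite mulr_suml; apply: eq_bigr => a _.
rewrite row_mul mulmx_sum_row slot_sum (bigD1 a)//= big1 ?addr0.
  by rewrite slotZ slot_row mxE.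
by move=> b ba; rewrite slotZ slot_alternating ?mulr0.
Qed.

(** An endomorphism passes from the vector to the form. The reindexing is the involution that
    exchanges the summation index [l] of the matrix product with the entry [I a]. *)
Lemma slot_mulmx u V a x (K : 'M[R]_n) :
  slot u V a (x *m K)
  = \sum_(I : multi_index) (\sum_l K (I a) l * u (upd I a l))
      * (x 0 (I a) * \prod_(b | b != a) V b (I b)).
Proof.
have updE (I : multi_index) l : upd I a l a = l by rewrite ffunE eqxx.
have updN (I : multi_index) l b : b != a -> upd I a l b = I b by move=> /negPf ba;
  rewrite ffunE ba.
rewrite /slot (eq_bigr (fun I : multi_index => \sum_l
    u I * (x 0 l * K l (I a) * \prod_(b | b != a) V b (I b)))); last first.
  by move=> I _; rewrite mxE mulr_suml mulr_sumr.
rewrite [RHS](eq_bigr (fun I : multi_index => \sum_l K (I a) l * u (upd I a l)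
      * (x 0 (I a) * \prod_(b | b != a) V b (I b)))); last first.
  by move=> I _; rewrite mulr_suml.
rewrite !pair_big /=.
pose h (p : multi_index * 'I_n) := (upd p.1 a p.2, p.1 a).
have hK : involutive h.
  move=> [I l]; rewrite /h /= updE; congr (_, _); apply/ffunP => b.
  by rewrite ffunE; case: eqP => [->//|/eqP ba]; rewrite updN.
rewrite (reindex h) /=; last by exists h => p _; rewrite hK.
apply: eq_bigr => -[I l] _ /=; rewrite updE.
rewrite (eq_bigr (fun b => V b (I b))); last by move=> b ba; rewrite updN.
ring.
Qed.

Lemma slot_type u v V a x (K : 'M[R]_n) (c : R) :
  (forall (I : multi_index) a, \sum_l K (I a) l * u (upd I a l) = c * v I) ->
  slot u V a (x *m K) = c * slot v V a x.
Proof.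
move=> H; rewrite slot_mulmx mulr_sumr; apply: eq_bigr => I _.
by rewrite H -mulrA.
Qed.

End Forms.

(** * Inner products, positive definite matrices and Lagrangian planes *)

Section Metric.
Variable n : nat.
Implicit Types (G : 'M[R]_n) (x y : 'rV[R]_n).

Definition ip G x y : R := (x *m G *m y^T) 0 0.

Lemma ipDl G x y z : ip G (x + y) z = ip G x z + ip G y z.
Proof. by rewrite /ip !mulmxDl mxE. Qed.

Lemma ipZl G k x z : ip G (k *: x) z = k * ip G x z.
Proof. by rewrite /ip -!scalemxAl mxE. Qed.

Lemma ipBl G x y z : ip G (x - y) z = ip G x z - ip G y z.
Proof. by rewrite -scaleN1r ipDl ipZl mulN1r. Qed.

Lemma ip_suml (K : finType) G (x : K -> 'rV[R]_n) z :
  ip G (\sum_k x k) z = \sum_k ip G (x k) z.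
Proof. by rewrite /ip !mulmx_suml summxE. Qed.

Lemma ipC G x y : G^T = G -> ip G x y = ip G y x.
Proof.
move=> GT; rewrite /ip; have -> : x *m G *m y^T = (y *m G *m x^T)^T.
  by rewrite !trmx_mul trmxK GT mulmxA.
by rewrite mxE.
Qed.

(** Apply the isometry [J] to both arguments and use [J^2 = -1]. *)
Lemma ip_J G (J : 'M[R]_n) x y : J *m J = - 1%:M -> J *m G *m J^T = G ->
  ip G (x *m J) y = - ip G x (y *m J).
Proof.
move=> JJ JG; have -> : ip G x (y *m J) = ip G (x *m J) (y *m J *m J).
  by rewrite /ip -[in LHS]JG !trmx_mul !mulmxA.
have -> : y *m J *m J = - y by rewrite -mulmxA JJ mulmxN mulmx1.
by rewrite /ip linearN mulmxN; set K := (_ *m _); rewrite [in RHS]mxE opprK.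
Qed.

End Metric.

Lemma pos_def_unit k (h : 'M[R]_k) :
  (forall v : 'rV[R]_k, v != 0 -> 0 < (v *m h *m v^T) 0 0) -> h \in unitmx.
Proof.
move=> pd; rewrite -row_free_unit; apply: inj_row_free => v vh.
by apply/eqP; apply/contraT => /pd; rewrite vh mul0mx mxE ltxx.
Qed.

Lemma gram_pos_def m n (D : 'M[R]_(m, n)) (G : 'M[R]_n) : row_free D ->
  (forall v : 'rV[R]_n, v != 0 -> 0 < (v *m G *m v^T) 0 0) ->
  forall v : 'rV[R]_m, v != 0 -> 0 < (v *m (D *m G *m D^T) *m v^T) 0 0.
Proof.
move=> rD pd v v0; have := pd (v *m D); rewrite trmx_mul !mulmxA; apply.
by apply: contra v0 => /eqP vD; apply/eqP/(row_free_inj rD); rewrite vD mul0mx.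
Qed.

(** Completing the square splits off a rank one term. The complement inherits symmetry and
    positivity, which drives the inductions on the size of a matrix below. *)
Lemma schur_complement k (A : 'M[R]_(1 + k)) : A^T = A ->
  (forall v : 'rV[R]_(1 + k), v != 0 -> 0 < (v *m A *m v^T) 0 0) ->
  exists a (b : 'rV[R]_k) C, [/\ A = block_mx a%:M b b^T C, 0 < a,
    (C - a^-1 *: (b^T *m b))^T = C - a^-1 *: (b^T *m b) &
    forall v : 'rV[R]_k, v != 0 -> 0 < (v *m (C - a^-1 *: (b^T *m b)) *m v^T) 0 0].
Proof.
move=> AT pA.
set a := A 0 0; set b := ursubmx A; set C := drsubmx A.
have AE : A = block_mx a%:M b b^T C.
  rewrite -{1}(submxK A) /b trmx_ursub AT; congr block_mx.
  by rewrite [LHS]mx11_scalar !mxE; congr (A _ _)%:M; apply: val_inj.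
have a0 : 0 < a.
  have := pA (delta_mx 0 0); rewrite -rowE trmx_delta -colE !mxE; apply.
  by apply/eqP => /matrixP/(_ 0 0)/eqP; rewrite !mxE !eqxx oner_eq0.
pose v1 : 'rV[R]_(1 + k) := row_mx a%:M b; pose A' := C - a^-1 *: (b^T *m b).
have AE' : A = a^-1 *: (v1^T *m v1) + block_mx 0 0 0 A'.
  rewrite /v1 tr_row_mx mul_col_row scale_block_mx add_block_mx !addr0 AE.
  rewrite !tr_scalar_mx !mul_scalar_mx mul_mx_scalar.
  rewrite !scalerA mulVf ?gt_eqF// !scale1r.
  by rewrite /A' addrCA subrr addr0.
have A'T : A'^T = A'.
  rewrite /A' linearB linearZ /= trmx_mul trmxK; congr (_ - _).
  by rewrite /C trmx_drsub AT.
have pA' (w : 'rV[R]_k) : w != 0 -> 0 < (w *m A' *m w^T) 0 0.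
  (* This first coordinate makes the extended vector orthogonal to [v1], so that only the complement
     is left in the quadratic form. *)
  move=> w0; pose c : 'M[R]_1 := - (a^-1 *: (w *m b^T)).
  have vv : row_mx c w *m v1^T = 0.
    rewrite /v1 tr_row_mx mul_row_col tr_scalar_mx mul_mx_scalar /c scalerN scalerA.
    by rewrite mulfV ?gt_eqF// scale1r addNr.
  have := pA (row_mx c w); rewrite {1}AE' mulmxDr mulmxDl -scalemxAr mulmxA vv mul0mx.
  rewrite scaler0 mul0mx add0r mul_row_block !mulmx0 !addr0 add0r tr_row_mx mul_row_col.
  rewrite mul0mx add0r; apply; apply: contra w0 => /eqP.
  by rewrite -(row_mx0 _ 1 1 k) => /eq_row_mx[_ ->].
exists a, b, C; split => //.
Qed.

(** The rank one term of [A] contributes a nonnegative multiple of a value of the quadratic form of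
    [B]; the complement is handled by induction. For the maximum principle [A] is the inverse metric
    and [B] the Hessian of [cos alpha]. *)
Lemma trace_mul_ge0 k (A B : 'M[R]_k) : A^T = A ->
  (forall v : 'rV[R]_k, v != 0 -> 0 < (v *m A *m v^T) 0 0) ->
  (forall v : 'rV[R]_k, 0 <= (v *m B *m v^T) 0 0) ->
  0 <= \tr (A *m B).
Proof.
elim: k A B => [|k IH] A B AT pA pB; first by rewrite /mxtrace big_ord0.
rewrite -[k.+1]/(1 + k)%N in A B AT pA pB *.
have [a [b [C [AE a0 A'T pA']]]] := schur_complement AT pA.
pose v1 : 'rV[R]_(1 + k) := row_mx a%:M b; pose A' := C - a^-1 *: (b^T *m b).
have AE' : A = a^-1 *: (v1^T *m v1) + block_mx 0 0 0 A'.
  rewrite /v1 tr_row_mx mul_col_row scale_block_mx add_block_mx !addr0 AE.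
  rewrite !tr_scalar_mx !mul_scalar_mx mul_mx_scalar.
  rewrite !scalerA mulVf ?gt_eqF// !scale1r.
  by rewrite /A' addrCA subrr addr0.
have -> : \tr (A *m B) = a^-1 * (v1 *m B *m v1^T) 0 0 + \tr (A' *m drsubmx B).
  rewrite {1}AE' mulmxDl mxtraceD -scalemxAl mxtraceZ -mulmxA mxtrace_mulC; congr (_ * _ + _).
    by rewrite /mxtrace big_ord1.
  rewrite -{1}(submxK B) mulmx_block !mul0mx !add0r ?addr0.
  by rewrite mxtrace_block linear0 add0r.
apply: addr_ge0; first by rewrite mulr_ge0// invr_ge0 ltW.
apply: IH => // w; have := pB (row_mx 0 w); rewrite -{1}(submxK B) mul_row_block.
by rewrite !mul0mx !add0r tr_row_mx mul_row_col trmx0 mulmx0 add0r.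
Qed.

Lemma pos_def_det_gt0 k (A : 'M[R]_k) : A^T = A ->
  (forall v : 'rV[R]_k, v != 0 -> 0 < (v *m A *m v^T) 0 0) -> 0 < \det A.
Proof.
elim: k A => [|k IH] A AT pA; first by rewrite det_mx00.
rewrite -[k.+1]/(1 + k)%N in A AT pA *.
have [a [b [C [AE a0 A'T pA']]]] := schur_complement AT pA.
have -> : A = block_mx 1%:M 0 (a^-1 *: b^T) 1%:M *m block_mx a%:M b 0 (C - a^-1 *: (b^T *m b)).
  rewrite mulmx_block !mul1mx !mul0mx !addr0 mul_mx_scalar scalerA mulfV ?gt_eqF//.
  rewrite scale1r -scalemxAl addrCA subrr addr0; exact: AE.
rewrite det_mulmx det_lblock det_ublock !det1 !mul1r det_scalar1.
by rewrite mulr_gt0// IH.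
Qed.

(** The rows of [D] and of [D *m J] span orthogonal subspaces with the same Gram matrix, hence form
    a basis when [n = m + m]. A vector orthogonal to the first family is recovered from its products
    with the second. *)
Lemma lagrangian_decomposition m n (D : 'M[R]_(m, n)) (G J : 'M[R]_n) (x : 'rV[R]_n) :
  n = (m + m)%N -> G^T = G -> G \in unitmx ->
  J *m J = - 1%:M -> J *m G *m J^T = G -> D *m (J *m G) *m D^T = 0 ->
  D *m G *m D^T \in unitmx -> x *m G *m D^T = 0 ->
  x = x *m G *m (D *m J)^T *m invmx (D *m G *m D^T) *m D *m J.
Proof.
move=> nE GT uG JJ JG L uh xD; set h := D *m G *m D^T in uh *.
pose E := col_mx D (D *m J); pose x' := x - x *m G *m (D *m J)^T *m invmx h *m D *m J.
have L1 : D *m J *m G *m D^T = 0 by rewrite -L !mulmxA.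
have L2 : D *m G *m (D *m J)^T = 0 by apply: trmx_inj;
  rewrite !trmx_mul !trmxK GT trmx0 !mulmxA.
have L3 : D *m J *m G *m (D *m J)^T = h by rewrite trmx_mul !mulmxA -(mulmxA D) -(mulmxA D) JG.
have rE : row_free E.
  (* The Gram matrix of [E] is block diagonal with two blocks [h]; inverting it yields a right
     inverse of [E]. *)
  apply/row_freeP; exists (G *m E^T *m block_mx (invmx h) 0 0 (invmx h)).
  rewrite !mulmxA /E tr_col_mx mul_col_mx mul_col_row L1 L2 L3 -/h mulmx_block.
  by rewrite !mulmx0 !mul0mx !addr0 !add0r mulmxV// -scalar_mx_block.
(* Here the dimension enters: [E] is as high as it is wide, so independence of its rows gives that
   of its columns. *)
have rET : row_free E^T.
  by rewrite -row_leq_rank mxrank_tr; move: rE; rewrite -row_leq_rank; apply: leq_trans;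
    rewrite {1}nE.
pose Y := x *m G *m (D *m J)^T *m invmx h.
have K1 : x' *m G *m D^T = 0.
  by rewrite /x' !mulmxBl xD sub0r -/Y -(mulmxA Y) -(mulmxA Y) -(mulmxA Y) L1 mulmx0 oppr0.
have K2 : x' *m G *m (D *m J)^T = 0.
  rewrite /x' !mulmxBl -/Y -(mulmxA Y) -(mulmxA Y) -(mulmxA Y) L3 /Y mulmxKV//.
  by rewrite subrr.
have : x' *m G *m E^T = 0 by rewrite /E tr_col_mx mul_mx_row K1 K2 row_mx0.
rewrite -[RHS](mul0mx _ E^T) => /(row_free_inj rET).
rewrite -[RHS](mul0mx _ G) => /(can_inj (mulmxK uG))/eqP.
by rewrite subr_eq0 => /eqP.
Qed.

(** Lowers the index that [invmx] has raised in a Christoffel symbol, on [M] as on [N]. *)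
Lemma lower_index k (h : 'M[R]_k) (c : 'I_k -> R) j : h^T = h -> h \in unitmx ->
  \sum_i (\sum_l invmx h i l * c l) * h i j = c j.
Proof.
move=> hT uh; under eq_bigr do rewrite mulr_suml.
have iT a b : invmx h a b = invmx h b a by rewrite -[in LHS]hT -trmx_inv mxE.
rewrite exchange_big /= (bigD1 j)//= [X in _ + X]big1 => [|l lj].
  have : (invmx h *m h) j j = 1 by rewrite mulVmx// mxE eqxx.
  rewrite mxE addr0 => E; rewrite -[RHS]mul1r -E mulr_suml; apply: eq_bigr => i _.
  by rewrite mulrAC iT.
have : (invmx h *m h) l j = 0 by rewrite mulVmx// mxE (negPf lj).
rewrite mxE => E.
transitivity (\sum_i invmx h l i * h i j * c l); last by rewrite -mulr_suml E mul0r.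
by apply: eq_bigr => i _; rewrite mulrAC iT.
Qed.

End LinearAlgebra.

(** * Covariant derivatives along a map *)

(* Locked, as is [covd] below, to keep unification from comparing matrices of
   partial derivatives by computation. *)
HB.lock Definition dmx (R : realType) K p q (k : 'I_K) (A : 'rV[R]_K -> 'M[R]_(p, q))
    (z : 'rV[R]_K) : 'M[R]_(p, q) :=
  \matrix_(i, j) partial k (fun y => A y i j) z.

(** The matrix of the pullback connection: [V *m conn f z Gam k] is the Christoffel term of the
    covariant derivative of [V] in direction [k]. *)
Definition conn (R : realType) K n (f : 'rV[R]_K -> 'rV[R]_n) (z : 'rV[R]_K)
    (Gam : 'I_n -> 'I_n -> 'I_n -> R) (k : 'I_K) : 'M[R]_n :=
  \matrix_(i, b) \sum_e dmx k f z 0 e * Gam b e i.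

(* The covariant derivative of a vector field [V] along [f]. *)
HB.lock Definition covd (R : realType) K n (f : 'rV[R]_K -> 'rV[R]_n) (z : 'rV[R]_K)
    (Gam : 'I_n -> 'I_n -> 'I_n -> R) (k : 'I_K) (V : 'rV[R]_K -> 'rV[R]_n) : 'rV[R]_n :=
  dmx k V z + V z *m conn f z Gam k.

Section Covariant.
Variable R : realType.

Section MatrixCalculus.
Variable K : nat.
Implicit Type z : 'rV[R]_K.

Definition mxdiff p q (A : 'rV[R]_K -> 'M[R]_(p, q)) z :=
  forall i j, differentiable (fun y => A y i j) z.

Lemma dmxE p q (k : 'I_K) (A : 'rV[R]_K -> 'M[R]_(p, q)) z i j :
  dmx k A z i j = partial k (fun y => A y i j) z.
Proof. by rewrite dmx.unlock mxE. Qed.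

Lemma mxdiffM p q s (A : 'rV[R]_K -> 'M[R]_(p, q)) (B : 'rV[R]_K -> 'M[R]_(q, s)) z :
  mxdiff A z -> mxdiff B z -> mxdiff (fun y => A y *m B y) z.
Proof.
move=> dA dB i j; under eq_fun do rewrite mxE.
by apply: differentiable_bigsum => l; exact: differentiableM.
Qed.

Lemma dmxM p q s (A : 'rV[R]_K -> 'M[R]_(p, q)) (B : 'rV[R]_K -> 'M[R]_(q, s)) z k :
  mxdiff A z -> mxdiff B z ->
  dmx k (fun y => A y *m B y) z = dmx k A z *m B z + A z *m dmx k B z.
Proof.
move=> dA dB; apply/matrixP => i j; rewrite dmxE; under eq_fun do rewrite mxE.
rewrite partial_sum; last by move=> l; exact: differentiableM.
rewrite !mxE -big_split; apply: eq_bigr => l _ /=.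
by rewrite partialM// !dmxE.
Qed.

Lemma dmxD p q (A B : 'rV[R]_K -> 'M[R]_(p, q)) z k :
  mxdiff A z -> mxdiff B z -> dmx k (fun y => A y + B y) z = dmx k A z + dmx k B z.
Proof.
move=> dA dB; apply/matrixP => i j; rewrite mxE !dmxE; under eq_fun do rewrite mxE.
by rewrite partialD.
Qed.

Lemma mxdiffZ p q (c : 'rV[R]_K -> R) (A : 'rV[R]_K -> 'M[R]_(p, q)) z :
  differentiable c z -> mxdiff A z -> mxdiff (fun y => c y *: A y) z.
Proof.
by move=> dc dA i j; under eq_fun do rewrite mxE; exact: differentiableM.
Qed.

Lemma dmxZ p q (c : 'rV[R]_K -> R) (A : 'rV[R]_K -> 'M[R]_(p, q)) z k :
  differentiable c z -> mxdiff A z ->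
  dmx k (fun y => c y *: A y) z = partial k c z *: A z + c z *: dmx k A z.
Proof.
move=> dc dA; apply/matrixP => i j; rewrite 3!mxE !dmxE; under eq_fun do rewrite mxE.
by rewrite partialM.
Qed.

Lemma mxdiff_tr p q (A : 'rV[R]_K -> 'M[R]_(p, q)) z :
  mxdiff A z -> mxdiff (fun y => (A y)^T) z.
Proof. by move=> dA i j; under eq_fun do rewrite mxE. Qed.

Lemma dmx_tr p q (A : 'rV[R]_K -> 'M[R]_(p, q)) z k :
  dmx k (fun y => (A y)^T) z = (dmx k A z)^T.
Proof. by apply/matrixP => i j; rewrite mxE !dmxE; under eq_fun do rewrite mxE. Qed.

Lemma dmx_row p q (A : 'rV[R]_K -> 'M[R]_(p, q)) z k a :
  dmx k (fun y => row a (A y)) z = row a (dmx k A z).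
Proof. by apply/matrixP => i j; rewrite mxE !dmxE; under eq_fun do rewrite mxE. Qed.

Lemma dmx_near p q (A B : 'rV[R]_K -> 'M[R]_(p, q)) z k :
  (\forall y \near z, A y = B y) -> dmx k A z = dmx k B z.
Proof.
move=> AB; apply/matrixP => i j; rewrite !dmxE; apply: partial_near.
by apply: filterS AB => y ->.
Qed.

End MatrixCalculus.

Lemma mxdiff_comp K n p q (A : 'rV[R]_n -> 'M[R]_(p, q)) (f : 'rV[R]_K -> 'rV[R]_n) z :
  mxdiff f z -> mxdiff A (f z) -> mxdiff (fun y => A (f y)) z.
Proof. by move=> df dA i j; apply: (@differentiable_comp_rV _ _ _ (fun y => A y i j)) => //
  b; exact: df. Qed.

Lemma dmx_comp K n p q (A : 'rV[R]_n -> 'M[R]_(p, q)) (f : 'rV[R]_K -> 'rV[R]_n) z k :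
  mxdiff f z -> mxdiff A (f z) ->
  dmx k (fun y => A (f y)) z = \sum_e dmx k f z 0 e *: dmx e A (f z).
Proof.
move=> df dA; apply/matrixP => i j; rewrite summxE dmxE.
rewrite (@partial_comp _ _ _ (fun y => A y i j))//; by apply: eq_bigr => e _;
  rewrite mxE !dmxE.
Qed.

Section AlongMap.
Variables (K n : nat) (f : 'rV[R]_K -> 'rV[R]_n) (z : 'rV[R]_K).
Variable Gam : 'I_n -> 'I_n -> 'I_n -> R.
Hypothesis df : mxdiff f z.
Implicit Types (k : 'I_K) (U V W : 'rV[R]_K -> 'rV[R]_n).

Local Notation conn := (conn f z Gam).
Local Notation cov := (covd f z Gam).

Lemma covD k V W : mxdiff V z -> mxdiff W z ->
  cov k (fun y => V y + W y) = cov k V + cov k W.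
Proof. by move=> dV dW; rewrite covd.unlock dmxD// mulmxDl addrACA. Qed.

Lemma covZ k (c : 'rV[R]_K -> R) V : differentiable c z -> mxdiff V z ->
  cov k (fun y => c y *: V y) = partial k c z *: V z + c z *: cov k V.
Proof. by move=> dc dV; rewrite covd.unlock dmxZ// scalerDr addrA scalemxAl. Qed.

Lemma cov_mul p k (X : 'rV[R]_K -> 'rV[R]_p) (D : 'rV[R]_K -> 'M[R]_(p, n)) :
  mxdiff X z -> mxdiff D z ->
  cov k (fun y => X y *m D y) = dmx k X z *m D z + X z *m (dmx k D z + D z *m conn k).
Proof. by move=> dX dD; rewrite covd.unlock dmxM// mulmxDr addrA mulmxA. Qed.

Lemma cov_near k V W : (\forall y \near z, V y = W y) -> cov k V = cov k W.
Proof. by move=> VW; rewrite covd.unlock (dmx_near _ VW) (nbhs_singleton VW). Qed.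

Lemma cov_metric k (g : 'rV[R]_n -> 'M[R]_n) U V : mxdiff g (f z) ->
  (forall e i j, partial e (fun y => g y i j) (f z)
     = \sum_l (Gam l e i * g (f z) l j + Gam l e j * g (f z) i l)) ->
  mxdiff U z -> mxdiff V z ->
  partial k (fun y => ip (g (f y)) (U y) (V y)) z
  = ip (g (f z)) (cov k U) (V z) + ip (g (f z)) (U z) (cov k V).
Proof.
move=> dg Hg dU dV; have dgf := mxdiff_comp df dg.
(* The hypothesis on [g], contracted with the derivative of [f]: metric compatibility of the
   pullback connection in matrix form. *)
have gE : dmx k (fun y => g (f y)) z = conn k *m g (f z) + g (f z) *m (conn k)^T.
  rewrite dmx_comp//; apply/matrixP => i j; rewrite summxE !mxE -big_split /=.
  under eq_bigr do rewrite mxE [dmx _ g _ _ _]dmxE Hg mulr_sumr.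
  rewrite exchange_big /=; apply: eq_bigr => l _; rewrite !mxE mulr_suml mulr_sumr -big_split.
  by apply: eq_bigr => e _ /=; ring.
have := @dmxM K 1 n 1 (fun y => U y *m g (f y)) (fun y => (V y)^T) z k (mxdiffM dU dgf)
  (mxdiff_tr dV).
move=> /matrixP/(_ 0 0); rewrite dmxE => ->; rewrite dmxM// dmx_tr gE covd.unlock /ip.
have add00 (A B : 'M[R]_1) : A 0 0 + B 0 0 = (A + B) 0 0 by rewrite mxE.
rewrite add00; congr (fun_of_matrix _ 0 0).
rewrite [(_ + _)^T]linearD /= trmx_mul !mulmxDl !mulmxDr !mulmxDl !mulmxA -!addrA.
by congr (_ + (_ + _)); exact: addrC.
Qed.

Lemma cov_endo k (J : 'rV[R]_n -> 'M[R]_n) V : mxdiff J (f z) ->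
  (forall e i j, partial e (fun y => J y i j) (f z)
     + \sum_l (Gam j e l * J (f z) i l - Gam l e i * J (f z) l j) = 0) ->
  mxdiff V z -> cov k (fun y => V y *m J (f y)) = cov k V *m J (f z).
Proof.
move=> dJ HJ dV; have dJf := mxdiff_comp df dJ.
have JE : dmx k (fun y => J (f y)) z = conn k *m J (f z) - J (f z) *m conn k.
  rewrite dmx_comp//; apply/matrixP => i j; rewrite summxE !mxE -sumrB /=.
  have HJ' e : partial e (fun y => J y i j) (f z) =
    \sum_l (Gam l e i * J (f z) l j - Gam j e l * J (f z) i l).
    have /eqP := HJ e i j; rewrite addr_eq0 => /eqP ->.
    by rewrite -sumrN; apply: eq_bigr => l _; rewrite opprB.
  under eq_bigr do rewrite mxE [dmx _ J _ _ _]dmxE HJ' mulr_sumr.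
  rewrite exchange_big /=; apply: eq_bigr => l _; rewrite !mxE mulr_suml mulr_sumr -sumrB.
  by apply: eq_bigr => e _ /=; ring.
rewrite covd.unlock dmxM// JE mulmxDl mulmxBr !mulmxA.
by rewrite addrA subrK.
Qed.

(** By the Leibniz rule the derivative falls on the coefficients or on a row. For a parallel form
    the first part is exactly what [slot_mulmx] produces from the Christoffel terms of the covariant
    derivatives of the rows. *)
Lemma cov_form m k (u : 'rV[R]_n -> {ffun 'I_m -> 'I_n} -> R)
    (D : 'rV[R]_K -> 'M[R]_(m, n)) :
  (forall I, differentiable (u ^~ I) (f z)) ->
  (forall e I, partial e (u ^~ I) (f z)
     = \sum_a \sum_l Gam l e (I a) * u (f z) (upd I a l)) ->
  mxdiff D z ->
  differentiable (fun y => rform (u (f y)) (D y)) z /\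
  partial k (fun y => rform (u (f y)) (D y)) z
  = \sum_a slot (u (f z)) (D z) a (cov k (fun y => row a (D y))).
Proof.
move=> du Hu dD; rewrite /rform.
have df' b : differentiable (fun y => f y 0 b) z by exact: df.
have duf I : differentiable (fun y => u (f y) I) z.
  exact: (@differentiable_comp_rV _ _ _ (u ^~ I)).
have dP (I : {ffun 'I_m -> 'I_n}) : differentiable (fun y => \prod_a D y a (I a)) z.
  by apply: differentiable_bigprod => a; exact: dD.
split; first by apply: differentiable_bigsum => I; exact: differentiableM.
rewrite partial_sum; last by move=> I; exact: differentiableM.
under eq_bigr do rewrite partialM//.
under [RHS]eq_bigr do rewrite covd.unlock slotD slot_mulmx.
rewrite [RHS]big_split [LHS]big_split /= addrC; congr (_ + _).
  rewrite /slot exchange_big; apply: eq_bigr => I _ /=.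
  rewrite partial_prod; last by move=> a; exact: dD.
  rewrite mulr_sumr; apply: eq_bigr => a _; rewrite dmxE.
  by under [in RHS]eq_fun do rewrite mxE.
rewrite exchange_big; apply: eq_bigr => I _ /=.
rewrite (@partial_comp _ _ _ (u ^~ I))// mulr_suml.
rewrite [LHS](eq_bigr (fun e => \sum_a dmx k f z 0 e * (\sum_l Gam l e (I a)
  * u (f z) (upd I a l))
    * \prod_a D z a (I a))); last first.
  by move=> e _; rewrite Hu mulr_sumr mulr_suml dmxE.
rewrite exchange_big; apply: eq_bigr => a _ /=.
rewrite [X in _ = _ * X](_ : _ = \prod_b D z b (I b)); last by rewrite mxE [RHS](bigD1 a).
rewrite mulr_suml.
under eq_bigr do rewrite mulr_sumr mulr_suml.
rewrite exchange_big; apply: eq_bigr => l _ /=.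
rewrite mxE mulr_suml mulr_suml; apply: eq_bigr => e _; ring.
Qed.

(** Second partial derivatives commute and the connection has no torsion. *)
Lemma cov_dmxC k l : (forall b, smooth_at (fun y => f y 0 b) z) ->
  (forall b i j, Gam b i j = Gam b j i) -> cov k (dmx l f) = cov l (dmx k f).
Proof.
move=> sf GamC.
have E0 a b : (fun y => dmx a f y 0 b) = partial a (fun y => f y 0 b).
  by apply/funext => y; exact: dmxE.
have E1 : dmx k (dmx l f) z = dmx l (dmx k f) z.
  apply/rowP => b.
  rewrite (dmxE k (dmx l f)) (dmxE l (dmx k f)) (E0 l b) (E0 k b).
  exact: (@partialC _ _ (fun y => f y 0 b) z l k (sf b)).
have E2 : dmx l f z *m conn k = dmx k f z *m conn l.
  apply/rowP => b; rewrite mxE [RHS]mxE.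
  under eq_bigr do rewrite [conn k _ _]mxE mulr_sumr.
  under [RHS]eq_bigr do rewrite [conn l _ _]mxE mulr_sumr.
  rewrite exchange_big; apply: eq_bigr => c _; apply: eq_bigr => e _.
  by rewrite GamC mulrCA.
by rewrite covd.unlock E1 E2.
Qed.

End AlongMap.

End Covariant.

(* Otherwise unification unfolds derivatives down to limits. *)
Local Opaque partial.

(** * The flow equation in a pair of charts *)

Section LocalModel.
Variable R : realType.
Variables (m n : nat).

Local Notation sp a := (lshift 1 a : 'I_(m + 1)).
Local Notation tm := (rshift m ord0 : 'I_(m + 1)).
Local Notation E := 'rV[R]_(m + 1).

(* A Calabi-Yau structure read in a chart with image [W]: [Gam] are the
   Christoffel symbols, [u] and [v] the real and imaginary parts of
   [e^(- i phi0) dz]. *)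
Record cy_local (W : set 'rV[R]_n) (g J : 'rV[R]_n -> 'M[R]_n)
    (Gam : 'rV[R]_n -> 'I_n -> 'I_n -> 'I_n -> R)
    (u v : 'rV[R]_n -> {ffun 'I_m -> 'I_n} -> R) : Prop := CyLocal {
  cy_g_diff : forall y, W y -> mxdiff g y;
  cy_J_diff : forall y, W y -> mxdiff J y;
  cy_u_diff : forall y, W y -> forall I, differentiable (u ^~ I) y;
  cy_v_diff : forall y, W y -> forall I, differentiable (v ^~ I) y;
  cy_g_sym : forall y, W y -> (g y)^T = g y;
  cy_g_pos : forall y, W y ->
    forall x : 'rV[R]_n, x != 0 -> 0 < (x *m g y *m x^T) 0 0;
  cy_J_sqr : forall y, W y -> J y *m J y = - 1%:M;
  cy_J_isom : forall y, W y -> J y *m g y *m (J y)^T = g y;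
  cy_Gam_sym : forall y, W y -> forall b i j, Gam y b i j = Gam y b j i;
  cy_g_parallel : forall y, W y -> forall e i j, partial e (fun y => g y i j) y
    = \sum_l (Gam y l e i * g y l j + Gam y l e j * g y i l);
  cy_J_parallel : forall y, W y -> forall e i j, partial e (fun y => J y i j) y
    + \sum_l (Gam y j e l * J y i l - Gam y l e i * J y l j) = 0;
  cy_u_parallel : forall y, W y -> forall e I, partial e (u ^~ I) y
    = \sum_a \sum_l Gam y l e (I a) * u y (upd I a l);
  cy_v_parallel : forall y, W y -> forall e I, partial e (v ^~ I) y
    = \sum_a \sum_l Gam y l e (I a) * v y (upd I a l);
  cy_u_alt : forall y, W y -> alternating_form (u y);
  cy_v_alt : forall y, W y -> alternating_form (v y);
  cy_u_type : forall y, W y -> forall (I : {ffun 'I_m -> 'I_n}) a,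
    \sum_l J y (I a) l * u y (upd I a l) = -1 * v y I;
  cy_v_type : forall y, W y -> forall (I : {ffun 'I_m -> 'I_n}) a,
    \sum_l J y (I a) l * v y (upd I a l) = 1 * u y I }.

Variables (f : E -> 'rV[R]_n) (g J : 'rV[R]_n -> 'M[R]_n).
Variable (Gam : 'rV[R]_n -> 'I_n -> 'I_n -> 'I_n -> R).

(** From here to [fmean], the geometry of the slices at fixed time is restated for functions on
    space-time, so that it can be differentiated in time as well. *)
Definition tang (z : E) : 'M[R]_(m, n) :=
  \matrix_(a, b) partial (sp a) (fun y => f y 0 b) z.

Definition fmetric (z : E) : 'M[R]_m := tang z *m g (f z) *m (tang z)^T.

Definition fchristoffel (z : E) (k i j : 'I_m) : R :=
  2^-1 * \sum_l invmx (fmetric z) k l *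
    (partial (sp i) (fun y => fmetric y j l) z
     + partial (sp j) (fun y => fmetric y i l) z
     - partial (sp l) (fun y => fmetric y i j) z).

Definition fsecond (z : E) (i j : 'I_m) : 'rV[R]_n :=
  \row_b (partial (sp i) (partial (sp j) (fun y => f y 0 b)) z
          - \sum_k fchristoffel z k i j * tang z k b
          + \sum_a \sum_e Gam (f z) b a e * tang z i a * tang z j e).

Definition fmean (z : E) : 'rV[R]_n :=
  \sum_i \sum_j invmx (fmetric z) i j *: fsecond z i j.

Variables (W : set 'rV[R]_n) (u v : 'rV[R]_n -> {ffun 'I_m -> 'I_n} -> R).

(* The flow and its angle read in charts, as functions of (x, t), on an open
   set of positive times; [r] is the Riemannian density. *)
Record flow_local (O : set E) (alpha r : E -> R) : Prop := FlowLocal {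
  fl_open : open O;
  fl_smooth : forall z, O z -> forall b, smooth_at (fun y => f y 0 b) z;
  fl_alpha_smooth : forall z, O z -> smooth_at alpha z;
  fl_sub : forall z, O z -> W (f z);
  fl_free : forall z, O z -> row_free (tang z);
  fl_lagrangian : forall z, O z ->
    tang z *m (J (f z) *m g (f z)) *m (tang z)^T = 0;
  fl_gt0 : forall z, O z -> 0 < r z;
  fl_phase_u : forall z, O z -> rform (u (f z)) (tang z) = r z * cos (alpha z);
  fl_phase_v : forall z, O z -> rform (v (f z)) (tang z) = r z * sin (alpha z);
  fl_flow : forall z, O z ->
    dmx tm f z = fmean z - tan (alpha z) *: (fmean z *m J (f z)) }.

Hypothesis nE : n = (m + m)%N.
Hypothesis CY : cy_local W g J Gam u v.
Variables (O : set E) (alpha r : E -> R).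
Hypothesis FL : flow_local O alpha r.

Local Notation D := tang.
Local Notation h := fmetric.
Local Notation covz z k V := (covd f z (Gam (f z)) k V).
(** Both [k] and [l] may be the time direction. In space directions this is the second fundamental
    form before its correction by the Christoffel symbols of the induced metric. *)
Definition nabla_df z k l : 'rV[R]_n := covz z k (dmx l f).
Definition dalpha (z : E) : 'rV[R]_m := \row_a partial (sp a) alpha z.
Definition grad_alpha (z : E) : 'rV[R]_m := dalpha z *m invmx (h z).
(* < A (d/dx^i, d/dx^a), J d/dx^b >, which is totally symmetric because [J] is
   parallel; [d alpha] is its trace, and so is [Theta_H]. *)
Definition cubic_form z i a b : R :=
  ip (g (f z)) (nabla_df z (sp i) (sp a)) (dmx (sp b) f z *m J (f z)).

Lemma fl_nbhs z : O z -> \forall y \near z, O y.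
Proof. by move=> Oz; apply: open_nbhs_nbhs; split => //; exact: fl_open FL. Qed.

Lemma row_tang z a : row a (D z) = dmx (sp a) f z.
Proof. by apply/rowP => b; rewrite dmxE !mxE. Qed.

Lemma f_diff z : O z -> mxdiff f z.
Proof. by move=> Oz i b; rewrite ord1; exact/smooth_at_differentiable/(fl_smooth FL Oz). Qed.

Lemma df_diff z k : O z -> mxdiff (dmx k f) z.
Proof.
move=> Oz i b; rewrite ord1; under eq_fun do rewrite dmxE.
exact/smooth_at_differentiable/smooth_at_partial/(fl_smooth FL Oz).
Qed.

Lemma tang_diff z : O z -> mxdiff D z.
Proof.
move=> Oz a b; under eq_fun do rewrite mxE.
exact/smooth_at_differentiable/smooth_at_partial/(fl_smooth FL Oz).
Qed.

Lemma gf_diff z : O z -> mxdiff (fun y => g (f y)) z.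
Proof. by move=> Oz; exact: mxdiff_comp (f_diff Oz) (cy_g_diff CY (fl_sub FL Oz)). Qed.

Lemma Jf_diff z : O z -> mxdiff (fun y => J (f y)) z.
Proof. by move=> Oz; exact: mxdiff_comp (f_diff Oz) (cy_J_diff CY (fl_sub FL Oz)). Qed.

Lemma fmetric_diff z : O z -> mxdiff h z.
Proof.
move=> Oz; exact: mxdiffM (mxdiffM (tang_diff Oz) (gf_diff Oz)) (mxdiff_tr (tang_diff Oz)).
Qed.

Lemma fmetric_pos z : O z -> forall x : 'rV[R]_m, x != 0 -> 0 < (x *m h z *m x^T) 0 0.
Proof. by move=> Oz; exact: gram_pos_def (fl_free FL Oz) (cy_g_pos CY (fl_sub FL Oz)). Qed.

Lemma fmetric_unit z : O z -> h z \in unitmx.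
Proof. by move=> Oz; exact/pos_def_unit/fmetric_pos. Qed.

Lemma fmetric_sym z : O z -> (h z)^T = h z.
Proof. by move=> Oz; rewrite /fmetric !trmx_mul trmxK (cy_g_sym CY (fl_sub FL Oz)) mulmxA. Qed.

Lemma ip_row k (G : 'M[R]_n) (x : 'rV[R]_n) (A : 'M[R]_(k, n)) b :
  ip G x (row b A) = (x *m G *m A^T) 0 b.
Proof. by rewrite /ip tr_row colE mulmxA -colE mxE. Qed.

Lemma fmetricE z a b : h z a b = ip (g (f z)) (dmx (sp a) f z) (dmx (sp b) f z).
Proof. by rewrite -!row_tang ip_row -!row_mul [RHS]mxE. Qed.

Lemma nabla_dfC z k l : O z -> nabla_df z k l = nabla_df z l k.
Proof. by move=> Oz; exact: cov_dmxC (fl_smooth FL Oz) (cy_Gam_sym CY (fl_sub FL Oz)). Qed.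

Lemma partial_fmetric z k a b : O z -> partial k (fun y => h y a b) z
  = ip (g (f z)) (nabla_df z k (sp a)) (dmx (sp b) f z)
    + ip (g (f z)) (dmx (sp a) f z) (nabla_df z k (sp b)).
Proof.
move=> Oz; under eq_fun do rewrite fmetricE.
have Wz := fl_sub FL Oz.
by rewrite (cov_metric (f_diff Oz) _ (cy_g_diff CY Wz) (cy_g_parallel CY Wz) (df_diff _ Oz)
  (df_diff _ Oz)).
Qed.

Lemma ip_fC z x y : O z -> ip (g (f z)) x y = ip (g (f z)) y x.
Proof. by move=> Oz; apply/ipC/(cy_g_sym CY (fl_sub FL Oz)). Qed.

(** The tangential part of the ambient second derivative is the Levi-Civita connection of the
    induced metric. Of the six products given by [partial_fmetric], the symmetry of [nabla_df]
    cancels four and leaves the same one twice. *)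
Lemma koszul z i j l : O z -> \sum_k fchristoffel z k i j * h z k l
  = ip (g (f z)) (nabla_df z (sp i) (sp j)) (dmx (sp l) f z).
Proof.
move=> Oz; rewrite -(lower_index (fun l => ip (g (f z)) (nabla_df z (sp i) (sp j))
  (dmx (sp l) f z)) l
  (fmetric_sym Oz) (fmetric_unit Oz)).
apply: eq_bigr => k _; congr (_ * _); rewrite /fchristoffel mulr_sumr.
apply: eq_bigr => l' _; rewrite !partial_fmetric// (nabla_dfC (sp j) (sp i) Oz)
  (nabla_dfC (sp l') (sp i) Oz).
rewrite (nabla_dfC (sp l') (sp j) Oz).
rewrite (ip_fC (dmx (sp j) f z) _ Oz) (ip_fC (dmx (sp i) f z) _ Oz).
move: (ip _ _ _) (ip _ _ _) (ip _ _ _) (invmx _ _ _) => p1 p2 p3 p4; lra.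
Qed.

Lemma fsecondE z i j : O z ->
  fsecond z i j = nabla_df z (sp i) (sp j) - \sum_k fchristoffel z k i j *: dmx (sp k) f z.
Proof.
move=> Oz; apply/rowP => b; rewrite /nabla_df covd.unlock !mxE addrAC summxE dmxE.
have -> : (fun y => dmx (sp j) f y 0 b) = partial (sp j) (fun y => f y 0 b).
  by apply/funext => y; exact: dmxE.
congr (_ - _ + _); first by apply: eq_bigr => k _; rewrite !mxE dmxE.
under [RHS]eq_bigr do rewrite mxE mulr_sumr.
rewrite exchange_big; apply: eq_bigr => e _; apply: eq_bigr => c _ /=.
by rewrite (cy_Gam_sym CY (fl_sub FL Oz) b c e) /tang !mxE !dmxE; ring.
Qed.

Lemma fsecond_normal z i j l : O z -> ip (g (f z)) (fsecond z i j) (dmx (sp l) f z) = 0.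
Proof.
move=> Oz; rewrite fsecondE// ipBl ip_suml -(koszul i j l Oz); apply/eqP;
  rewrite subr_eq0; apply/eqP.
by apply: eq_bigr => k _; rewrite ipZl fmetricE.
Qed.

Lemma lagrangian_ip z a b : O z -> ip (g (f z)) (dmx (sp a) f z *m J (f z))
  (dmx (sp b) f z) = 0.
Proof.
move=> Oz; rewrite -!row_tang ip_row -!row_mul mxE.
by have := fl_lagrangian FL Oz; rewrite !mulmxA => ->; rewrite mxE.
Qed.

Lemma cov_J z k V : O z -> mxdiff V z ->
  covz z k (fun y => V y *m J (f y)) = covz z k V *m J (f z).
Proof.
move=> Oz dV; have Wz := fl_sub FL Oz.
by rewrite (cov_endo (f_diff Oz) _ (cy_J_diff CY Wz) (cy_J_parallel CY Wz) dV).
Qed.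

(** Differentiate the Lagrangian condition [< J d_a f, d_b f > = 0] in direction [i]. As [J] is
    parallel and skew, the two terms are the two cubic forms with opposite signs. *)
Lemma cubic_formCr z i a b : O z -> cubic_form z i a b = cubic_form z i b a.
Proof.
move=> Oz.
have : partial (sp i) (fun y => ip (g (f y)) (dmx (sp a) f y *m J (f y)) (dmx (sp b) f y))
  z = 0.
  rewrite -[RHS](@partial_cst R _ 0 z (sp i)); apply: partial_near.
  by apply: filterS (fl_nbhs Oz) => y Oy; exact: lagrangian_ip.
rewrite (cov_metric (f_diff Oz) _ (cy_g_diff CY (fl_sub FL Oz))
  (cy_g_parallel CY (fl_sub FL Oz))
  (mxdiffM (df_diff _ Oz) (Jf_diff Oz)) (df_diff _ Oz)).
rewrite (cov_J _ Oz (df_diff _ Oz)) (ip_J _ _ (cy_J_sqr CY (fl_sub FL Oz))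
  (cy_J_isom CY (fl_sub FL Oz))).
rewrite addrC => /eqP; rewrite subr_eq0 => /eqP E1.
by rewrite /cubic_form -E1 ip_fC.
Qed.

Lemma cubic_formCl z i a b : O z -> cubic_form z i a b = cubic_form z a i b.
Proof. by move=> Oz; rewrite /cubic_form nabla_dfC. Qed.

Lemma fsecond_J z i j l : O z ->
  ip (g (f z)) (fsecond z i j) (dmx (sp l) f z *m J (f z)) = cubic_form z i j l.
Proof.
move=> Oz; rewrite fsecondE// ipBl ip_suml big1 ?subr0// => k _.
by rewrite ipZl ip_fC// lagrangian_ip// mulr0.
Qed.

Lemma normal_decomp z (x : 'rV[R]_n) (c : 'rV[R]_m) : O z ->
  (forall l, ip (g (f z)) x (dmx (sp l) f z) = 0) ->
  (forall l, ip (g (f z)) x (dmx (sp l) f z *m J (f z)) = c 0 l) ->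
  x = c *m invmx (h z) *m D z *m J (f z).
Proof.
move=> Oz H0 H1; have Wz := fl_sub FL Oz.
rewrite {1}(@lagrangian_decomposition _ _ _ (D z) (g (f z)) (J (f z)) x nE (cy_g_sym CY Wz)
  (pos_def_unit (cy_g_pos CY Wz)) (cy_J_sqr CY Wz) (cy_J_isom CY Wz) (fl_lagrangian FL Oz)
    (fmetric_unit Oz)).
  congr (_ *m _ *m _ *m _); apply/rowP => l.
  by rewrite -H1 -row_tang -row_mul ip_row.
by apply/rowP => l; rewrite [RHS]mxE -(H0 l) -row_tang ip_row.
Qed.

Definition phase_re z : R := rform (u (f z)) (D z).
Definition phase_im z : R := rform (v (f z)) (D z).

Lemma row_tangE a : (fun y => row a (D y)) = dmx (sp a) f.
Proof. by apply/funext => y; exact: row_tang. Qed.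

Lemma phase_re_diff z : O z -> differentiable phase_re z.
Proof.
move=> Oz; have Wz := fl_sub FL Oz.
exact: (cov_form (f_diff Oz) (rshift m ord0) (cy_u_diff CY Wz) (cy_u_parallel CY Wz)
  (tang_diff Oz)).1.
Qed.

Lemma phase_im_diff z : O z -> differentiable phase_im z.
Proof.
move=> Oz; have Wz := fl_sub FL Oz.
exact: (cov_form (f_diff Oz) (rshift m ord0) (cy_v_diff CY Wz) (cy_v_parallel CY Wz)
  (tang_diff Oz)).1.
Qed.

Lemma partial_phase_re z k : O z -> partial k phase_re z
  = \sum_a slot (u (f z)) (D z) a (nabla_df z k (sp a)).
Proof.
move=> Oz; have Wz := fl_sub FL Oz.
rewrite /phase_re (cov_form (f_diff Oz) k (cy_u_diff CY Wz) (cy_u_parallel CY Wz)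
  (tang_diff Oz)).2.
by apply: eq_bigr => a _; rewrite row_tangE.
Qed.

Lemma partial_phase_im z k : O z -> partial k phase_im z
  = \sum_a slot (v (f z)) (D z) a (nabla_df z k (sp a)).
Proof.
move=> Oz; have Wz := fl_sub FL Oz.
rewrite /phase_im (cov_form (f_diff Oz) k (cy_v_diff CY Wz) (cy_v_parallel CY Wz)
  (tang_diff Oz)).2.
by apply: eq_bigr => a _; rewrite row_tangE.
Qed.

Lemma slot_u_J z a x : O z -> slot (u (f z)) (D z) a (x *m J (f z))
  = - slot (v (f z)) (D z) a x.
Proof. by move=> Oz; rewrite (slot_type _ _ _ (cy_u_type CY (fl_sub FL Oz))) mulN1r. Qed.

Lemma slot_v_J z a x : O z -> slot (v (f z)) (D z) a (x *m J (f z)) = slot (u (f z)) (D z) a x.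
Proof. by move=> Oz; rewrite (slot_type _ _ _ (cy_v_type CY (fl_sub FL Oz))) mul1r. Qed.

(** Comes from [phase_im * cos alpha = phase_re * sin alpha], where the density [r] has been
    eliminated before differentiating: [flow_local] controls only its values. *)
Lemma phase_partial z k : O z ->
  r z * partial k alpha z = cos (alpha z) * partial k phase_im z
    - sin (alpha z) * partial k phase_re z.
Proof.
move=> Oz; have da := smooth_at_differentiable (fl_alpha_smooth FL Oz).
have dc : differentiable (fun y => cos (alpha y)) z by apply: differentiable_comp1.
have ds : differentiable (fun y => sin (alpha y)) z by apply: differentiable_comp1.
have E1 : partial k (fun y => phase_im y * cos (alpha y)) z
  = partial k (fun y => phase_re y * sin (alpha y)) z.
  apply: partial_near; apply: filterS (fl_nbhs Oz) => y Oy.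
  by rewrite /phase_re /phase_im (fl_phase_u FL Oy) (fl_phase_v FL Oy); ring.
rewrite !partialM in E1; [|exact: phase_re_diff|exact: ds|exact: phase_im_diff|exact: dc].
have pc : partial k (fun y => cos (alpha y)) z = - sin (alpha z) * partial k alpha z.
  by rewrite partial_comp1// derive_val.
have ps : partial k (fun y => sin (alpha y)) z = cos (alpha z) * partial k alpha z.
  by rewrite partial_comp1// derive_val.
rewrite pc ps /phase_re /phase_im (fl_phase_u FL Oz) (fl_phase_v FL Oz) in E1.
have cs := cos2Dsin2 (alpha z).
move: (partial k phase_im z) (partial k phase_re z) (partial k alpha z) (r z) (cos _)
  (sin _) E1 cs => p1 p2 p3 p4 c s.
by move=> E1 cs; rewrite -[LHS]mulr1 -cs; lra.
Qed.

Lemma slot_sum_u z (A B : 'M[R]_m) : O z ->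
  \sum_a slot (u (f z)) (D z) a (row a (A *m D z) + row a (B *m D z) *m J (f z))
  = \tr A * phase_re z - \tr B * phase_im z.
Proof.
move=> Oz; have Wz := fl_sub FL Oz.
under eq_bigr do rewrite slotD slot_u_J//.
by rewrite sumrB !slot_trace//; [exact: cy_v_alt CY _ Wz|exact: cy_u_alt CY _ Wz].
Qed.

Lemma slot_sum_v z (A B : 'M[R]_m) : O z ->
  \sum_a slot (v (f z)) (D z) a (row a (A *m D z) + row a (B *m D z) *m J (f z))
  = \tr A * phase_im z + \tr B * phase_re z.
Proof.
move=> Oz; have Wz := fl_sub FL Oz.
under eq_bigr do rewrite slotD slot_v_J//.
by rewrite big_split /= !slot_trace//; [exact: cy_u_alt CY _ Wz|exact: cy_v_alt CY _ Wz].
Qed.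

Lemma mul_tang p z (B : 'M[R]_(p, m)) a :
  row a (B *m D z) = \sum_l B a l *: dmx (sp l) f z.
Proof.
rewrite row_mul mulmx_sum_row; apply: eq_bigr => l _.
by rewrite row_tang mxE.
Qed.

Definition christoffel_mx z k : 'M[R]_m := \matrix_(a, l) fchristoffel z l k a.
Definition cubic_mx z k : 'M[R]_m := (\matrix_(a, l) cubic_form z k a l) *m invmx (h z).

(** The Gauss decomposition, the normal space being [J] of the tangent space. The phases will see
    only the traces of the two coefficient matrices. *)
Lemma nabla_df_decomp z k a : O z -> nabla_df z (sp k) (sp a)
  = row a (christoffel_mx z k *m D z) + row a (cubic_mx z k *m D z) *m J (f z).
Proof.
move=> Oz; have := fsecondE k a Oz => /eqP; rewrite eq_sym subr_eq addrC => /eqP ->.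
congr (_ + _); first by rewrite mul_tang; apply: eq_bigr => l _; rewrite mxE.
rewrite (@normal_decomp z _ (row a (\matrix_(a,
  l) cubic_form z k a l)) Oz (fun l => fsecond_normal k a l Oz)).
  by rewrite /cubic_mx !row_mul.
by move=> l; rewrite fsecond_J// !mxE.
Qed.

Lemma partial_phase_re_space z k : O z ->
  partial (sp k) phase_re z = \tr (christoffel_mx z k) * phase_re z
    - \tr (cubic_mx z k) * phase_im z.
Proof.
move=> Oz; rewrite partial_phase_re// -slot_sum_u//; apply: eq_bigr => a _.
by rewrite nabla_df_decomp.
Qed.

Lemma partial_phase_im_space z k : O z ->
  partial (sp k) phase_im z = \tr (christoffel_mx z k) * phase_im z
    + \tr (cubic_mx z k) * phase_re z.
Proof.
move=> Oz; rewrite partial_phase_im// -slot_sum_v//; apply: eq_bigr => a _.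
by rewrite nabla_df_decomp.
Qed.

(** In [phase_partial] the traces of the Christoffel part cancel, and [cos^2 + sin^2 = 1] leaves the
    trace of the cubic form. *)
Lemma dalphaE z k : O z -> partial (sp k) alpha z = \tr (cubic_mx z k).
Proof.
move=> Oz; apply: (mulfI (lt0r_neq0 (fl_gt0 FL Oz)));
  rewrite phase_partial// partial_phase_re_space// partial_phase_im_space//.
rewrite /phase_re /phase_im (fl_phase_u FL Oz) (fl_phase_v FL Oz).
have cs := cos2Dsin2 (alpha z); rewrite -[RHS]mulr1 -cs; ring.
Qed.

(** This is [H = J grad alpha]. The traces that give [H] and [d alpha] run over different slots of
    the cubic form, and its total symmetry identifies them. *)
Lemma fmeanE z : O z -> fmean z = grad_alpha z *m D z *m J (f z).
Proof.
move=> Oz; apply: normal_decomp => // l.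
  rewrite /fmean ip_suml big1// => i _; rewrite ip_suml big1// => j _.
  by rewrite ipZl fsecond_normal// mulr0.
rewrite mxE dalphaE// /fmean ip_suml /mxtrace.
under [RHS]eq_bigr do rewrite mxE.
rewrite exchange_big; apply: eq_bigr => i _ /=; rewrite ip_suml; apply: eq_bigr => j _.
by rewrite ipZl fsecond_J// mxE mulrC (cubic_formCl i j l Oz) (cubic_formCr j i l Oz)
  (cubic_formCl j l i Oz).
Qed.

Lemma velocityE z : O z ->
  dmx tm f z = grad_alpha z *m D z *m J (f z) + tan (alpha z) *: (grad_alpha z *m D z).
Proof.
move=> Oz; rewrite (fl_flow FL Oz) fmeanE// -(mulmxA _ (J (f z))) (cy_J_sqr CY (fl_sub FL Oz)).
by rewrite mulmxN mulmx1 scalerN opprK.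
Qed.

Lemma grad_alpha_diff z : O z -> mxdiff grad_alpha z.
Proof.
move=> Oz; apply: mxdiffM.
  move=> i j; under eq_fun do rewrite mxE.
  exact/smooth_at_differentiable/smooth_at_partial/(fl_alpha_smooth FL Oz).
by move=> i j; apply: differentiable_invmx; [exact: fmetric_diff|exact: fmetric_unit].
Qed.

Lemma tan_diff z : O z -> cos (alpha z) != 0 -> differentiable (fun y => tan (alpha y)) z.
Proof.
move=> Oz c0; apply: differentiable_comp1; first exact: derivable_tan.
exact/smooth_at_differentiable/(fl_alpha_smooth FL Oz).
Qed.

Lemma partial_tan z k : O z -> cos (alpha z) != 0 ->
  partial k (fun y => tan (alpha y)) z = (cos (alpha z))^-2 * partial k alpha z.
Proof.
move=> Oz c0; rewrite partial_comp1; [|exact: derivable_tan|].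
  by have [_ ->] := is_derive_tan c0.
exact/smooth_at_differentiable/(fl_alpha_smooth FL Oz).
Qed.

(** The divergence of [grad alpha] without its Christoffel term, which the derivatives of the phases
    supply in the next lemmas. *)
Definition coord_div z : R := \sum_a partial (sp a) (fun y => grad_alpha y 0 a) z.

Definition nabla_grad z a : 'rV[R]_n := covz z (sp a) (fun y => grad_alpha y *m D y).

Lemma nabla_gradE z a : O z ->
  nabla_grad z a = row a (\matrix_(a, l) partial (sp a) (fun y => grad_alpha y 0 l) z *m D z)
    + \sum_l grad_alpha z 0 l *: nabla_df z (sp l) (sp a).
Proof.
move=> Oz; rewrite /nabla_grad cov_mul; [|exact: grad_alpha_diff|exact: tang_diff].
congr (_ + _).
  by rewrite row_mul; congr (_ *m _); apply/rowP => l; rewrite dmxE !mxE.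
rewrite mulmx_sum_row; apply: eq_bigr => l _; congr (_ *: _).
rewrite nabla_dfC// /nabla_df covd.unlock linearD /= row_mul row_tang; congr (_ + _).
by rewrite -dmx_row row_tangE.
Qed.

(** Cartan's formula in coordinates: with [X = grad_alpha], the exterior derivative of the
    contraction by [X] is the sum of the [d_l (X^l phase_re)]. *)
Lemma slot_u_nabla_grad z : O z -> \sum_a slot (u (f z)) (D z) a (nabla_grad z a)
  = coord_div z * phase_re z + \sum_l grad_alpha z 0 l * partial (sp l) phase_re z.
Proof.
move=> Oz; under eq_bigr do rewrite nabla_gradE// slotD.
rewrite big_split /= slot_trace; last exact: cy_u_alt CY _ (fl_sub FL Oz).
congr (_ * _ + _); first by apply: eq_bigr => a _; rewrite mxE.
under eq_bigr do rewrite slot_sum; rewrite exchange_big; apply: eq_bigr => l _ /=.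
by rewrite partial_phase_re// mulr_sumr; apply: eq_bigr => a _; rewrite slotZ.
Qed.

Lemma slot_v_nabla_grad z : O z -> \sum_a slot (v (f z)) (D z) a (nabla_grad z a)
  = coord_div z * phase_im z + \sum_l grad_alpha z 0 l * partial (sp l) phase_im z.
Proof.
move=> Oz; under eq_bigr do rewrite nabla_gradE// slotD.
rewrite big_split /= slot_trace; last exact: cy_v_alt CY _ (fl_sub FL Oz).
congr (_ * _ + _); first by apply: eq_bigr => a _; rewrite mxE.
under eq_bigr do rewrite slot_sum; rewrite exchange_big; apply: eq_bigr => l _ /=.
by rewrite partial_phase_im// mulr_sumr; apply: eq_bigr => a _; rewrite slotZ.
Qed.

(* [nabla_t d/dx^a f = nabla_a (df/dt)], where [df/dt] is given by [velocityE]. *)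
Lemma nabla_df_time z a : O z -> cos (alpha z) != 0 -> nabla_df z tm (sp a)
  = nabla_grad z a *m J (f z) + tan (alpha z) *: nabla_grad z a
    + row a (((cos (alpha z))^-2 *: ((dalpha z)^T *m grad_alpha z)) *m D z).
Proof.
move=> Oz c0; rewrite nabla_dfC//.
have dW : mxdiff (fun y => grad_alpha y *m D y) z by apply: mxdiffM;
  [exact: grad_alpha_diff|exact: tang_diff].
have -> : nabla_df z (sp a) tm = covz z (sp a)
    (fun y => grad_alpha y *m D y *m J (f y) + tan (alpha y) *: (grad_alpha y *m D y)).
  by apply: cov_near; apply: filterS (fl_nbhs Oz) => y Oy; exact: velocityE.
rewrite covD; [|by apply: mxdiffM => //; exact: Jf_diff|by apply: mxdiffZ => //;
  exact: tan_diff].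
rewrite cov_J// covZ//; last exact: tan_diff.
rewrite -addrA; congr (_ + _); rewrite addrC; congr (_ + _).
rewrite partial_tan// -scalemxAl -[row a _]/(row a (_ *: _)) linearZ /= -scalerA;
  congr (_ *: _).
rewrite 2!row_mul [row a (dalpha z)^T](_ : _ = (partial (sp a) alpha z)%:M).
  by rewrite mul_scalar_mx -scalemxAl.
by apply/matrixP => i j; rewrite !ord1 !mxE eqxx.
Qed.

Definition grad_sqnorm z : R := \sum_l grad_alpha z 0 l * partial (sp l) alpha z.

(* The normal part of the velocity changes [cos alpha dmu], but the tangential
   part [tan alpha . grad alpha] transports it by exactly the opposite amount. *)
Lemma partial_phase_re_time z : O z -> cos (alpha z) != 0 -> partial tm phase_re z = 0.
Proof.
move=> Oz c0; have Wz := fl_sub FL Oz.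
have trE : \tr ((cos (alpha z))^-2 *: ((dalpha z)^T *m grad_alpha z))
  = (cos (alpha z))^-2 * grad_sqnorm z.
  rewrite mxtraceZ; congr (_ * _); apply: eq_bigr => l _.
  by rewrite mxE big_ord1 !mxE mulrC.
rewrite partial_phase_re//; under eq_bigr do rewrite nabla_df_time// !slotD slotZ slot_u_J//.
rewrite big_split /= slot_trace; last exact: cy_u_alt CY _ Wz.
rewrite big_split /= sumrN -mulr_sumr slot_u_nabla_grad// slot_v_nabla_grad// trE.
(* The divergence terms cancel thanks to the factor [tan alpha]. What is left is this contraction of
   [phase_partial] with the gradient, balanced by the derivative of [tan alpha]. *)
have E : cos (alpha z) * (\sum_l grad_alpha z 0 l * partial (sp l) phase_im z) -
    sin (alpha z) * (\sum_l grad_alpha z 0 l * partial (sp l) phase_re z)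
      = r z * grad_sqnorm z.
  rewrite /grad_sqnorm !mulr_sumr -sumrB; apply: eq_bigr => l _.
  by rewrite [RHS]mulrCA phase_partial//; ring.
apply: (mulfI c0); rewrite mulr0.
rewrite /tan /phase_re /phase_im (fl_phase_u FL Oz) (fl_phase_v FL Oz).
move: E; set A := \sum_l _; set B := \sum_l _;
  move: A B (grad_sqnorm z) (coord_div z) (r z) (sin _) (cos _) c0.
move=> A B q d rz s c c0 E.
have -> : c * (- (d * (rz * s) + A) + s / c * (d * (rz * c) + B) + c ^- 2 * q * (rz * c))
  = rz * q - (c * A - s * B) by field.
by rewrite E subrr.
Qed.

Definition hess_alpha z : 'M[R]_m := \matrix_(a, b) partial (sp a) (partial (sp b) alpha) z.

(** At a critical point of [alpha] the derivative of the inverse metric drops out of [coord_div],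
    which becomes the trace of the Hessian. As [phase_re] is stationary, [phase_partial] reads the
    time derivative of [alpha] off that of [phase_im]. *)
Lemma partial_alpha_time z : O z -> cos (alpha z) != 0 -> dalpha z = 0 ->
  partial tm alpha z = \tr (hess_alpha z *m invmx (h z)).
Proof.
move=> Oz c0 g0; have Wz := fl_sub FL Oz.
have X0 : grad_alpha z = 0 by rewrite /grad_alpha g0 mul0mx.
have divE : coord_div z = \tr (hess_alpha z *m invmx (h z)).
  apply: eq_bigr => a _; rewrite mxE.
  have -> : (fun y => grad_alpha y 0 a) = (fun y => \sum_b partial (sp b) alpha y
    * invmx (h y) b a).
    by apply/funext => y; rewrite mxE; apply: eq_bigr => b _; rewrite mxE.
  have dg b : differentiable (partial (sp b) alpha) z.
    exact/smooth_at_differentiable/smooth_at_partial/(fl_alpha_smooth FL Oz).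
  have di b : differentiable (fun y => invmx (h y) b a) z.
    by apply: differentiable_invmx; [exact: fmetric_diff|exact: fmetric_unit].
  rewrite partial_sum; last by move=> b; exact: differentiableM.
  apply: eq_bigr => b _; rewrite partialM// [hess_alpha z a b]mxE.
  have -> : partial (sp b) alpha z = 0 by have /rowP/(_ b) := g0; rewrite !mxE.
  by rewrite mul0r addr0.
rewrite -divE; apply: (mulfI (lt0r_neq0 (fl_gt0 FL Oz))).
rewrite phase_partial// partial_phase_re_time// mulr0 subr0 partial_phase_im//.
under eq_bigr do rewrite nabla_df_time// !slotD slotZ slot_v_J//.
rewrite X0 mulmx0 scaler0 mul0mx.
rewrite big_split /= [grad_alpha in _ * (_ + grad_alpha)]big1 ?addr0; last first.
  by move=> a _; rewrite row0 slot0.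
rewrite big_split /= -mulr_sumr slot_u_nabla_grad// slot_v_nabla_grad//.
have Z (k : 'I_m -> R) : \sum_l grad_alpha z 0 l * k l = 0.
  by rewrite big1// => l _; rewrite X0 mxE mul0r.
rewrite !Z !addr0 /tan /phase_re /phase_im (fl_phase_u FL Oz) (fl_phase_v FL Oz).
have cs := cos2Dsin2 (alpha z); rewrite -[RHS]mulr1 -cs.
by field.
Qed.

End LocalModel.

(** * Change of charts *)

Section Twist.
Variable R : realType.
Implicit Types (w : R[i]) (x : R).

(** With [x = - phi0], [twRe] and [twIm] turn the complex form [e^(- i phi0) dz] into two real
    forms, to which the real calculus above applies. *)
Definition twRe x w : R := cos x * complex.Re w - sin x * complex.Im w.
Definition twIm x w : R := cos x * complex.Im w + sin x * complex.Re w.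

Lemma twE x w : cis x * w = (twRe x w +i* twIm x w)%C.
Proof. by case: w => a b; rewrite /twRe /twIm /=; congr Complex; rewrite addrC. Qed.

Lemma twRe_sum x (I : Type) (r : seq I) (P : pred I) (F : I -> R[i]) :
  twRe x (\sum_(i <- r | P i) F i) = \sum_(i <- r | P i) twRe x (F i).
Proof.
apply: (big_morph (twRe x)); last by rewrite /twRe /= !mulr0 subrr.
by move=> [a b] [c d]; rewrite /twRe /=; ring.
Qed.

Lemma twIm_sum x (I : Type) (r : seq I) (P : pred I) (F : I -> R[i]) :
  twIm x (\sum_(i <- r | P i) F i) = \sum_(i <- r | P i) twIm x (F i).
Proof.
apply: (big_morph (twIm x)); last by rewrite /twIm /= !mulr0 addr0.
by move=> [a b] [c d]; rewrite /twIm /=; ring.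
Qed.

Lemma twReZ x (k : R) w : twRe x ((k%:C)%C * w) = k * twRe x w.
Proof. by case: w => a b; rewrite /twRe /=; ring. Qed.

Lemma twImZ x (k : R) w : twIm x ((k%:C)%C * w) = k * twIm x w.
Proof. by case: w => a b; rewrite /twIm /=; ring. Qed.

Lemma twRe_i x w : twRe x ((0 +i* 1)%C * w) = - twIm x w.
Proof. by case: w => a b; rewrite /twRe /twIm /=; ring. Qed.

Lemma twIm_i x w : twIm x ((0 +i* 1)%C * w) = twRe x w.
Proof. by case: w => a b; rewrite /twRe /twIm /=; ring. Qed.

Lemma twRe_sign x (b : bool) w : twRe x ((-1) ^+ b * w) = (-1) ^+ b * twRe x w.
Proof. by case: w b => a c [|]; rewrite /twRe ?expr0 ?expr1 ?mul1r//= ; ring. Qed.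

Lemma twIm_sign x (b : bool) w : twIm x ((-1) ^+ b * w) = (-1) ^+ b * twIm x w.
Proof. by case: w b => a c [|]; rewrite /twIm ?expr0 ?expr1 ?mul1r//= ; ring. Qed.

Lemma realC_prod (I : Type) (r : seq I) (P : pred I) (F : I -> R) :
  (\prod_(i <- r | P i) (F i)%:C)%C = ((\prod_(i <- r | P i) F i)%:C)%C.
Proof.
apply/esym; apply: (big_morph (fun a : R => (a%:C)%C)) => // a b.
by rewrite /GRing.mul/= !mulr0 !mul0r subr0 addr0.
Qed.

Lemma twRe_form x m n (w : {ffun 'I_m -> 'I_n} -> R[i]) (V : 'M[R]_(m, n)) :
  twRe x (form_eval w V) = rform (fun I => twRe x (w I)) V.
Proof.
rewrite twRe_sum; apply: eq_bigr => I _.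
by rewrite realC_prod mulrC twReZ mulrC.
Qed.

Lemma twIm_form x m n (w : {ffun 'I_m -> 'I_n} -> R[i]) (V : 'M[R]_(m, n)) :
  twIm x (form_eval w V) = rform (fun I => twIm x (w I)) V.
Proof.
rewrite twIm_sum; apply: eq_bigr => I _.
by rewrite realC_prod mulrC twImZ mulrC.
Qed.

(** Here [w] is the pullback of [w'] by [K]. The identity expands a product of sums into a sum over
    all multi-indices. *)
Lemma rform_mulmx m n (w w' : {ffun 'I_m -> 'I_n} -> R) (V : 'M[R]_(m, n)) (K : 'M[R]_n) :
  (forall I, w I = rform w' (\matrix_(a, j) K (I a) j)) ->
  rform w' (V *m K) = rform w V.
Proof.
move=> H; rewrite /rform; transitivity (\sum_(I : {ffun 'I_m ->
  'I_n}) \sum_(I' : {ffun 'I_m -> 'I_n})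
   w' I' * \prod_a (V a (I a) * K (I a) (I' a))); last first.
  apply: eq_bigr => I _; rewrite H /rform mulr_suml; apply: eq_bigr => I' _.
  rewrite -mulrA -big_split; congr (_ * _); apply: eq_bigr => a _ /=; rewrite mxE.
  exact: mulrC.
rewrite exchange_big; apply: eq_bigr => I' _ /=; rewrite -mulr_sumr; congr (_ * _).
under eq_bigr do rewrite mxE.
exact: (bigA_distr_bigA (fun a j => V a j * K j (I' a))).
Qed.

End Twist.

Section Charts.
Variable R : realType.

Section OneManifold.
Variables (X : topologicalType) (n : nat) (A : manifold R X n).
Implicit Types (c d : chart R X n) (p : X) (x : 'rV[R]_n).

Lemma cinv_dom c x : atlas A c -> cimg c x -> cdom c (cinv c x).
Proof. by move=> Ac [p cp <-]; rewrite (chart_cancel (atlas_chart Ac)). Qed.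

Lemma cmapK c x : atlas A c -> cimg c x -> cmap c (cinv c x) = x.
Proof. by move=> Ac [p cp <-]; rewrite (chart_cancel (atlas_chart Ac)). Qed.

Lemma cmap_img c p : cdom c p -> cimg c (cmap c p).
Proof. by move=> cp; exists p. Qed.

Lemma cinvK c p : atlas A c -> cdom c p -> cinv c (cmap c p) = p.
Proof. by move=> Ac; exact: (chart_cancel (atlas_chart Ac)). Qed.

Lemma nbhs_cimg c x : atlas A c -> cimg c x -> nbhs x (cimg c).
Proof. by move=> Ac cx; apply: open_nbhs_nbhs; split => //;
  exact: chart_open_img (atlas_chart Ac). Qed.

Lemma nbhs_cdom c p : atlas A c -> cdom c p -> nbhs p (cdom c).
Proof. by move=> Ac cx; apply: open_nbhs_nbhs; split => //;
  exact: chart_open_dom (atlas_chart Ac). Qed.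

Lemma cinv_cont c x : atlas A c -> cimg c x -> {for x, continuous (cinv c)}.
Proof.
move=> Ac cx; have := chart_cinv_continuous (atlas_chart Ac).
rewrite continuous_open_subspace; last exact: chart_open_img (atlas_chart Ac).
by apply; rewrite inE.
Qed.

Lemma cmap_cont c p : atlas A c -> cdom c p -> {for p, continuous (cmap c)}.
Proof.
move=> Ac cp; have := chart_cmap_continuous (atlas_chart Ac).
rewrite continuous_open_subspace; last exact: chart_open_dom (atlas_chart Ac).
by apply; rewrite inE.
Qed.

Lemma csmooth_at c (f : X -> R) x : atlas A c -> cimg c x -> csmooth c f ->
  smooth_at (f \o cinv c) x.
Proof. by move=> Ac cx sf; apply: smooth_on_at sf _; exact: nbhs_cimg. Qed.

Lemma cpartialE c (f : X -> R) x i : atlas A c -> cimg c x ->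
  cpartial c i f (cinv c x) = partial i (fun y => f (cinv c y)) x.
Proof. by move=> Ac cx; rewrite /cpartial cmapK. Qed.

End OneManifold.

Section ChartChange.
Variables (X Y : topologicalType) (m n : nat) (AX : manifold R X m) (AY : manifold R Y n).

Lemma jac_smooth d d' y j : atlas AY d -> atlas AY d' -> cimg d y -> cdom d' (cinv d y) ->
  smooth_at (fun y => cmap d' (cinv d y) 0 j) y.
Proof.
move=> Ad Ad' dy d'y; apply: (smooth_on_at (atlas_compatible Ad Ad' j)).
have H : \forall y' \near y, cdom d' (cinv d y')
  by exact: (cinv_cont Ad dy (nbhs_cdom Ad' d'y)).
apply: filterS2 H (nbhs_cimg Ad dy) => y' d'y' dy'; exists (cinv d y').
  by split => //; exact: (cinv_dom Ad).
exact: (cmapK Ad).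
Qed.

(** The chain rule for [cmap d' \o cinv d] after the expression of [F] in [d]. Continuity of [F]
    keeps nearby values in the domain of [d], where [cinv d] undoes [cmap d]. *)
Lemma dmap_change c d d' (F : X -> Y) p : atlas AX c -> atlas AY d -> atlas AY d' ->
  cdom c p -> cdom d (F p) -> cdom d' (F p) -> {for p, continuous F} ->
  (forall a, smooth_at (fun x => cmap d (F (cinv c x)) 0 a) (cmap c p)) ->
  dmap c d' F p = dmap c d F p *m jac d d' (F p).
Proof.
move=> Ac Ad Ad' cp dp d'p cF sF; apply/matrixP => i a; rewrite !mxE /cpartial.
set f := (fun x => cmap d (F (cinv c x))).
transitivity (partial i (fun x => cmap d' (cinv d (f x)) 0 a) (cmap c p)).
  apply: partial_near.
  have cFc : {for cmap c p, continuous (F \o cinv c)}.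
    apply: continuous_comp; first by apply: (cinv_cont Ac); exact: cmap_img.
    by rewrite (cinvK Ac).
  have H : \forall x \near cmap c p, cdom d (F (cinv c x)).
    by apply: (cFc (cdom d)); rewrite /= (cinvK Ac cp); exact: (nbhs_cdom Ad dp).
  by apply: filterS H => x /= dx; rewrite /f (cinvK Ad).
have dpf : cimg d (f (cmap c p)) by rewrite /f (cinvK Ac cp); exact: cmap_img.
rewrite (@partial_comp _ _ _ (fun y => cmap d' (cinv d y) 0 a) f).
- apply: eq_bigr => b _; rewrite !mxE /cpartial /f /= (cinvK Ac cp).
  congr (_ * partial _ _ _); apply/funext => y.
- by move=> b; exact: smooth_at_differentiable (sF b).
- apply: smooth_at_differentiable; apply: (jac_smooth _ Ad Ad' dpf).
  by rewrite /f (cinvK Ac cp) (cinvK Ad).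
Qed.

End ChartChange.

(** * The Calabi-Yau structure in one chart *)

Section CalabiYauChart.
Variables (N : topologicalType) (m : nat) (CY : calabi_yau R N m) (phi0 : R).
Variable d : chart R N (2 * m).
Local Notation n := (2 * m)%N.
Local Notation AN := (cy_manifold CY).
Hypothesis Ad : atlas AN d.

Definition loc_g (y : 'rV[R]_n) : 'M[R]_n := cy_metric CY d (cinv d y).
Definition loc_J (y : 'rV[R]_n) : 'M[R]_n := cy_J CY d (cinv d y).
Definition loc_Gam (y : 'rV[R]_n) b i j : R := christoffel (cy_metric CY) d (cinv d y) b i j.
Definition loc_u (y : 'rV[R]_n) (I : {ffun 'I_m ->
  'I_n}) : R := twRe (- phi0) (cy_dz CY d (cinv d y) I).
Definition loc_v (y : 'rV[R]_n) (I : {ffun 'I_m ->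
  'I_n}) : R := twIm (- phi0) (cy_dz CY d (cinv d y) I).

Local Notation W := (cimg d).

Lemma loc_g_smooth y i j : W y -> smooth_at (fun y => loc_g y i j) y.
Proof.
move=> Wy; have := metric_smooth (kahler_metric (cy_kahler CY)) Ad i j.
exact: (csmooth_at Ad Wy).
Qed.

Lemma loc_J_smooth y i j : W y -> smooth_at (fun y => loc_J y i j) y.
Proof.
move=> Wy; have := kahler_J_smooth (cy_kahler CY) Ad i j.
exact: (csmooth_at Ad Wy).
Qed.

Lemma loc_dz_smooth y I : W y ->
  smooth_at (fun y => complex.Re (cy_dz CY d (cinv d y) I)) y /\
  smooth_at (fun y => complex.Im (cy_dz CY d (cinv d y) I)) y.
Proof.
move=> Wy; have [s1 s2] := form_smooth (cy_dz_form CY) Ad I.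
by split; [have := csmooth_at Ad Wy s1|have := csmooth_at Ad Wy s2].
Qed.

Lemma loc_g_sym y : W y -> (loc_g y)^T = loc_g y.
Proof. by move=> Wy; exact: (Defs.metric_sym (kahler_metric (cy_kahler CY)) Ad
  (cinv_dom Ad Wy)). Qed.

Lemma loc_g_pos y : W y -> forall x : 'rV[R]_n, x != 0 -> 0 < (x *m loc_g y *m x^T) 0 0.
Proof. by move=> Wy; exact: (metric_pos (kahler_metric (cy_kahler CY)) Ad
  (cinv_dom Ad Wy)). Qed.

Lemma loc_gC y i j : W y -> loc_g y i j = loc_g y j i.
Proof. by move=> Wy; rewrite -[in LHS](loc_g_sym Wy) mxE. Qed.

Lemma partial_gC y e i j : W y ->
  partial e (fun y => loc_g y i j) y = partial e (fun y => loc_g y j i) y.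
Proof.
move=> Wy; apply: partial_near; apply: filterS (nbhs_cimg Ad Wy) => y' Wy'; exact: loc_gC.
Qed.

Lemma loc_GamE y b i j : W y -> loc_Gam y b i j
  = 2^-1 * \sum_l invmx (loc_g y) b l *
      (partial i (fun y => loc_g y j l) y + partial j (fun y => loc_g y i l) y
       - partial l (fun y => loc_g y i j) y).
Proof.
move=> Wy; rewrite /loc_Gam /christoffel; congr (_ * _); apply: eq_bigr => l _.
by rewrite !(cpartialE _ _ Ad Wy).
Qed.

Lemma loc_Gam_sym y b i j : W y -> loc_Gam y b i j = loc_Gam y b j i.
Proof.
move=> Wy; rewrite !loc_GamE//; congr (_ * _); apply: eq_bigr => l _;
  rewrite (partial_gC l j i Wy).
by rewrite [X in _ * (X - _)]addrC.
Qed.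

(** The Christoffel symbols of the first kind. Adding the versions with [i] and [j] exchanged gives
    [nabla g = 0] in [cy_local_chart]. *)
Lemma loc_Gam_lower y e i j : W y -> \sum_l loc_Gam y l e i * loc_g y l j
  = 2^-1 * (partial e (fun y => loc_g y i j) y + partial i (fun y => loc_g y e j) y
       - partial j (fun y => loc_g y e i) y).
Proof.
move=> Wy; rewrite -(lower_index (fun j => 2^-1 * (partial e (fun y => loc_g y i j) y
   + partial i (fun y => loc_g y e j) y - partial j (fun y => loc_g y e i) y)) j
   (loc_g_sym Wy) (pos_def_unit (loc_g_pos Wy))).
apply: eq_bigr => l _; rewrite loc_GamE// mulr_sumr; congr (_ * _).
by apply: eq_bigr => k _; rewrite mulrCA.
Qed.

Lemma loc_twE y I : W y ->
  (forall e, partial e (loc_u ^~ I) y = twRe (- phi0)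
    (ccpartial d e (fun q => cy_dz CY d q I) (cinv d y)))
  /\ (forall e, partial e (loc_v ^~ I) y
    = twIm (- phi0) (ccpartial d e (fun q => cy_dz CY d q I) (cinv d y))).
Proof.
move=> Wy; have [s1 s2] := loc_dz_smooth I Wy.
have d1 := smooth_at_differentiable s1; have d2 := smooth_at_differentiable s2.
have dc (k : R) : differentiable (fun=> k : R) y by exact: differentiable_cst.
split => e; rewrite /ccpartial !(cpartialE _ _ Ad Wy).
  rewrite /loc_u /twRe /= partialB; [|exact: differentiableM..].
  by rewrite !partialM// !partial_cst !mul0r !add0r.
rewrite /loc_v /twIm /= partialD; [|exact: differentiableM..].
by rewrite !partialM// !partial_cst !mul0r !add0r.
Qed.

Lemma cy_local_chart : cy_local W loc_g loc_J loc_Gam loc_u loc_v.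
Proof.
split.
- by move=> y Wy i j; exact/smooth_at_differentiable/loc_g_smooth.
- by move=> y Wy i j; exact/smooth_at_differentiable/loc_J_smooth.
- move=> y Wy I; have [s1 s2] := loc_dz_smooth I Wy; rewrite /loc_u /twRe.
  by apply: differentiableB; apply: differentiableM; try exact: differentiable_cst;
     exact: smooth_at_differentiable.
- move=> y Wy I; have [s1 s2] := loc_dz_smooth I Wy; rewrite /loc_v /twIm.
  by apply: differentiableD; apply: differentiableM; try exact: differentiable_cst;
     exact: smooth_at_differentiable.
- exact: loc_g_sym.
- exact: loc_g_pos.
- by move=> y Wy; exact: (kahler_J_sqr (cy_kahler CY) Ad (cinv_dom Ad Wy)).
- by move=> y Wy; exact: (kahler_hermitian (cy_kahler CY) Ad (cinv_dom Ad Wy)).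
- by move=> y Wy b i j; exact: loc_Gam_sym.
- move=> y Wy e i j; rewrite big_split /= loc_Gam_lower//.
  have -> : \sum_l loc_Gam y l e j * loc_g y i l = \sum_l loc_Gam y l e j * loc_g y l i.
    by apply: eq_bigr => l _; rewrite loc_gC.
  rewrite loc_Gam_lower// (partial_gC e j i Wy).
  by lra.
- move=> y Wy e i j; have := kahler_J_parallel (cy_kahler CY) Ad (cinv_dom Ad Wy) e i j.
  by rewrite /nabla_endo (cpartialE _ _ Ad Wy).
- move=> y Wy e I; rewrite (loc_twE I Wy).1.
  have /eqP := cy_dz_parallel Ad (cinv_dom Ad Wy) e I; rewrite subr_eq0 => /eqP ->.
  rewrite twRe_sum; apply: eq_bigr => a _; rewrite twRe_sum; apply: eq_bigr => l _.
  by rewrite twReZ.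
- move=> y Wy e I; rewrite (loc_twE I Wy).2.
  have /eqP := cy_dz_parallel Ad (cinv_dom Ad Wy) e I; rewrite subr_eq0 => /eqP ->.
  rewrite twIm_sum; apply: eq_bigr => a _; rewrite twIm_sum; apply: eq_bigr => l _.
  by rewrite twImZ.
- move=> y Wy I s; rewrite /loc_u (form_alternating (cy_dz_form CY) Ad (cinv_dom Ad Wy)).
  exact: twRe_sign.
- move=> y Wy I s; rewrite /loc_v (form_alternating (cy_dz_form CY) Ad (cinv_dom Ad Wy)).
  exact: twIm_sign.
- move=> y Wy I a; rewrite mulN1r -twRe_i -(cy_dz_type Ad (cinv_dom Ad Wy) I a) twRe_sum.
  by apply: eq_bigr => l _; rewrite twReZ.
- move=> y Wy I a; rewrite mul1r /loc_u -twIm_i -(cy_dz_type Ad (cinv_dom Ad Wy) I a) twIm_sum.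
  by apply: eq_bigr => l _; rewrite twImZ.
Qed.

End CalabiYauChart.

(** * Pullbacks computed in an arbitrary chart of the target *)

Section Immersion.
Variables (M N : topologicalType) (m : nat) (AM : manifold R M m) (CY : calabi_yau R N m).
Variables (G : M -> N) (imG : lagrangian_immersion AM CY G).
Local Notation AN := (cy_manifold CY).
Local Notation n := (2 * m)%N.
Variables (c : chart R M m) (p : M).
Hypotheses (Ac : atlas AM c) (cp : cdom c p).

Lemma imm_cont : continuous G.
Proof. by have [+ _] := immersion_smooth imG. Qed.

Lemma imm_smooth_at d b : atlas AN d -> cdom d (G p) ->
  smooth_at (fun x => cmap d (G (cinv c x)) 0 b) (cmap c p).
Proof.
move=> Ad dp; have [_ /(_ c d Ac Ad b) sG] := immersion_smooth imG.
apply: (smooth_on_at sG).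
have cGc : {for cmap c p, continuous (G \o cinv c)}.
  apply: continuous_comp; first by apply: (cinv_cont Ac); exact: cmap_img.
  exact: imm_cont.
have H : \forall x \near cmap c p, cdom d (G (cinv c x)).
  by apply: (cGc (cdom d)); rewrite /= (cinvK Ac cp); exact: (nbhs_cdom Ad dp).
apply: filterS2 H (nbhs_cimg Ac (cmap_img cp)) => x dx cx; exists (cinv c x).
  by split => //; exact: (cinv_dom Ac).
exact: (cmapK Ac).
Qed.

Lemma imm_dmap d d' : atlas AN d -> atlas AN d' -> cdom d (G p) -> cdom d' (G p) ->
  dmap c d' G p = dmap c d G p *m jac d d' (G p).
Proof.
move=> Ad Ad' dp d'p; apply: (dmap_change Ac Ad Ad' cp dp d'p); first exact: imm_cont.
by move=> a; exact: imm_smooth_at.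
Qed.

Local Notation d0 := (chart_at AN (G p)).
Let Ad0 : atlas AN d0 := chart_at_atlas AN (G p).
Let d0p : cdom d0 (G p) := chart_at_dom AN (G p).

(** The chart [chart_at AN (G p)] of the definition varies with [p] without any regularity.
    Derivatives need a fixed chart [d], to which this lemma and the next ones convert. *)
Lemma pullback_metricE d : atlas AN d -> cdom d (G p) ->
  pullback_metric CY G c p = dmap c d G p *m cy_metric CY d (G p) *m (dmap c d G p)^T.
Proof.
move=> Ad dp; rewrite /pullback_metric (imm_dmap Ad Ad0 dp d0p).
rewrite (metric_change (kahler_metric (cy_kahler CY)) Ad Ad0 dp d0p).
by rewrite trmx_mul !mulmxA.
Qed.

Lemma pullback_kahlerE d : atlas AN d -> cdom d (G p) ->
  pullback_kahler CY G c p = dmap c d G p *m (cy_J CY d (G p) *m cy_metric CY d (G p)) *m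
    (dmap c d G p)^T.
Proof.
move=> Ad dp; rewrite /pullback_kahler /kahler_form (imm_dmap Ad Ad0 dp d0p).
rewrite (metric_change (kahler_metric (cy_kahler CY)) Ad Ad0 dp d0p).
have HJ := kahler_J_change (cy_kahler CY) Ad Ad0 dp d0p.
by rewrite trmx_mul !mulmxA -(mulmxA _ (cy_J CY d (G p))) HJ !mulmxA.
Qed.

Lemma pullback_dz_twRe x d : atlas AN d -> cdom d (G p) ->
  twRe x (pullback_dz CY G c p) = rform (fun I => twRe x (cy_dz CY d (G p) I)) (dmap c d G p).
Proof.
move=> Ad dp; rewrite /pullback_dz (imm_dmap Ad Ad0 dp d0p) twRe_form.
apply: rform_mulmx => I.
by rewrite (form_change (cy_dz_form CY) Ad Ad0 dp d0p) twRe_form.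
Qed.

Lemma pullback_dz_twIm x d : atlas AN d -> cdom d (G p) ->
  twIm x (pullback_dz CY G c p) = rform (fun I => twIm x (cy_dz CY d (G p) I)) (dmap c d G p).
Proof.
move=> Ad dp; rewrite /pullback_dz (imm_dmap Ad Ad0 dp d0p) twIm_form.
apply: rform_mulmx => I.
by rewrite (form_change (cy_dz_form CY) Ad Ad0 dp d0p) twIm_form.
Qed.

Lemma pullback_metric_sym : (pullback_metric CY G c p)^T = pullback_metric CY G c p.
Proof.
rewrite /pullback_metric !trmx_mul trmxK mulmxA.
by rewrite (Defs.metric_sym (kahler_metric (cy_kahler CY)) Ad0 d0p).
Qed.

Lemma pullback_metric_pos (x : 'rV[R]_m) : x != 0 ->
  0 < (x *m pullback_metric CY G c p *m x^T) 0 0.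
Proof.
move=> x0; apply: gram_pos_def => //; first exact: (immersion_injective imG Ac Ad0 cp d0p).
exact: (metric_pos (kahler_metric (cy_kahler CY)) Ad0 d0p).
Qed.

Lemma pullback_det_gt0 : 0 < \det (pullback_metric CY G c p).
Proof. exact: pos_def_det_gt0 pullback_metric_sym pullback_metric_pos. Qed.

End Immersion.
End Charts.

(** * From the flow on manifolds to the local model *)

Section FlowChart.
Variables (R : realType) (m : nat) (N : topologicalType) (CY : calabi_yau R N m).
Variables (M : topologicalType) (AM : manifold R M m).
Variables (phi0 : R) (T : \bar R) (F : M -> R -> N) (alpha : M -> R -> R).
Hypothesis F_smooth : smooth_spacetime_map AM CY T F.
Hypothesis F_lagrangian : forall t, time_interval T t -> lagrangian_immersion AM CY (F^~ t).
Hypothesis alpha_smooth : smooth_spacetime_fun AM T alpha.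
Hypothesis alpha_phase : forall t, time_interval T t ->
       phase_equation AM CY phi0 (F^~ t) (alpha^~ t).
Hypothesis F_flow : reparametrized_LMCF AM CY T F alpha.

Local Notation AN := (cy_manifold CY).
Local Notation n := (2 * m)%N.
Local Notation sp a := (lshift 1 a : 'I_(m + 1)).
Local Notation tm := (rshift m ord0 : 'I_(m + 1)).
Local Notation E := 'rV[R]_(m + 1).
Local Notation time z := (z 0 (rshift m ord0)).

Definition cos_density (c : chart R M m) p t : R :=
  cos (alpha p t) * Num.sqrt (\det (pullback_metric CY (F^~ t) c p)).

Lemma cos_densityE c p t : atlas AM c -> cdom c p -> time_interval T t ->
  cos_density c p t = twRe (- phi0) (pullback_dz CY (F^~ t) c p).
Proof.
move=> Ac cp Tt; have := alpha_phase Tt Ac cp.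
by rewrite twE /cis /cos_density => /(congr1 (@complex.Re R)) /= ->; rewrite mulr0 subr0.
Qed.

Lemma open_time_nbhs t : 0 < t -> (t%:E < T)%E -> \forall s \near t, 0 < s /\ (s%:E < T)%E.
Proof.
move=> t0 tT; have H1 : \forall s \near t, 0 < s.
  by apply: open_nbhs_nbhs; split => //; exact: open_gt.
have H2 : \forall s \near t, (s%:E < T)%E.
  case: T tT => [r| |]//; last by move=> _; apply: filterE => s; rewrite ltry.
  by rewrite lte_fin => tr; apply: open_nbhs_nbhs; split => //; exact: open_lt.
exact: filterS2 H1 H2.
Qed.

Lemma F_cont p t : 0 < t -> (t%:E < T)%E ->
  {for (p, t), continuous (fun w : M * R => F w.1 w.2)}.
Proof.
move=> t0 tT; have [cF _] := F_smooth.
have I : interior [set w : M * R | time_interval T w.2] (p, t).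
  have : \forall w \near (p, t), 0 < (w : M * R).2 /\ (w.2%:E < T)%E.
    exact: (cvg_snd (open_time_nbhs t0 tT)).
  by apply: filterS => w [w0 wT]; split => //; exact: ltW.
have := cF (p, t); rewrite /prop_for /continuous_at.
by rewrite -(nbhs_subspace_interior I).
Qed.

Section TwoCharts.
Variables (c : chart R M m) (d : chart R N n).
Hypotheses (Ac : atlas AM c) (Ad : atlas AN d).

Definition chart_flow (z : E) : 'rV[R]_n := cmap d (F (cinv c (lsubmx z)) (time z)).
Definition chart_angle (z : E) : R := alpha (cinv c (lsubmx z)) (time z).
Definition chart_density (z : E) : R :=
  Num.sqrt (\det (pullback_metric CY (F^~ (time z)) c (cinv c (lsubmx z)))).

Definition chart_dom : set E := [set z | [/\ cimg c (lsubmx z), time_interval T (time z) &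
                    cdom d (F (cinv c (lsubmx z)) (time z))]].
(** Removing time 0 makes the domain open in space-time, as the local model requires. *)
Definition chart_dom_gt0 : set E := [set z | chart_dom z /\ 0 < time z].

(** Each [F_t] is continuous on its own, at time 0 too, so that spatial derivatives can be compared
    on slices up to the initial time. *)
Lemma chart_dom_slice x t : chart_dom (stpt x t) -> \forall y \near x, chart_dom (stpt y t).
Proof.
rewrite /chart_dom /= stpt_space stpt_time => -[cx Tt dx].
have cG : {for x, continuous ((F^~ t) \o cinv c)}.
  by apply: continuous_comp; [exact: cinv_cont Ac cx|exact: imm_cont (F_lagrangian Tt) _].
have H : \forall y \near x, cdom d (F (cinv c y) t).
  by apply: (cG (cdom d)); exact: (nbhs_cdom Ad dx).
by apply: filterS2 H (nbhs_cimg Ac cx) => y dy cy; rewrite stpt_space stpt_time.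
Qed.

Lemma open_chart_dom_gt0 : open chart_dom_gt0.
Proof.
rewrite openE => z [[cx [_ tT] dx] t0].
have cz : {for z, continuous (fun z : E => (cinv c (lsubmx z), time z))}.
  have A : (fun y : E => cinv c (lsubmx y)) y @[y --> z] --> cinv c (lsubmx z).
    by apply: (@continuous_comp _ _ _ (fun z : E => lsubmx z) (cinv c) z);
      [exact: lsubmx_cont|exact: (cinv_cont Ac cx)].
  have B : (fun y : E => time y) y @[y --> z] --> time z by exact: time_cont.
  exact: cvg_pair A B.
have H1 : \forall y \near z, cimg c (lsubmx y) by exact: (lsubmx_cont (nbhs_cimg Ac cx)).
have H2 : \forall y \near z, (fun y : E => 0 < time y /\ ((time y)%:E < T)%E) y.
  exact: (time_cont (open_time_nbhs t0 tT)).
have H3 : \forall y \near z, cdom d (F (cinv c (lsubmx y)) (time y)).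
  have cFz : {for z, continuous ((fun w : M * R => F w.1 w.2) \o
      (fun z : E => (cinv c (lsubmx z), time z)))}.
    by apply: continuous_comp; [exact: cz|exact: F_cont].
  by apply: (cFz (cdom d)); exact: (nbhs_cdom Ad dx).
apply: filterS3 H1 H2 H3 => y y1 [y2 y3] y4; split => //; split => //.
by split => //; exact: ltW.
Qed.

Lemma nbhs_chart_dom_gt0 z : chart_dom_gt0 z -> nbhs z chart_dom_gt0.
Proof. by move=> z0; apply: open_nbhs_nbhs; split => //; exact: open_chart_dom_gt0. Qed.

Lemma chart_flow_smooth z b : chart_dom_gt0 z -> smooth_at (fun y => chart_flow y 0 b) z.
Proof.
move=> z0; have := F_smooth.2 c d Ac Ad b => /smooth_on_at; apply.
by apply: filterS (nbhs_chart_dom_gt0 z0) => y [].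
Qed.

Lemma chart_angle_smooth z : chart_dom_gt0 z -> smooth_at chart_angle z.
Proof.
move=> z0; have := alpha_smooth Ac => /smooth_on_at; apply.
by apply: filterS (nbhs_chart_dom_gt0 z0) => y [[]].
Qed.

Lemma dmap_tang x t : cimg c x -> dmap c d (F^~ t) (cinv c x) = tang chart_flow (stpt x t).
Proof.
move=> cx; apply/matrixP => i b; rewrite !mxE partial_sp (cpartialE _ _ Ac cx).
have -> // : (fun y => chart_flow (stpt y t) 0 b) = (fun y => cmap d (F (cinv c y) t) 0 b).
by apply/funext => y; rewrite /chart_flow stpt_space stpt_time.
Qed.

Lemma loc_gE z : chart_dom z -> loc_g CY d (chart_flow z)
  = cy_metric CY d (F (cinv c (lsubmx z)) (time z)).
Proof. by move=> [cx Tt dx]; rewrite /loc_g /chart_flow (cinvK Ad dx). Qed.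

Lemma pullback_fmetric z : chart_dom z ->
  pullback_metric CY (F^~ (time z)) c (cinv c (lsubmx z)) = fmetric chart_flow (loc_g CY d) z.
Proof.
move=> z0; have [cx Tt dx] := z0.
rewrite (pullback_metricE (F_lagrangian Tt) Ac (cinv_dom Ac cx) Ad dx).
by rewrite dmap_tang// -stptE /fmetric loc_gE.
Qed.

Lemma rform_u z : chart_dom z -> rform (loc_u CY phi0 d (chart_flow z)) (tang chart_flow z)
  = chart_density z * cos (chart_angle z).
Proof.
move=> z0; have [cx Tt dx] := z0.
have := cos_densityE Ac (cinv_dom Ac cx) Tt; rewrite /cos_density mulrC => ->.
rewrite (pullback_dz_twRe (F_lagrangian Tt) Ac (cinv_dom Ac cx) _ Ad dx).
by rewrite dmap_tang// -stptE /loc_u /chart_flow (cinvK Ad dx).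
Qed.

Lemma rform_v z : chart_dom z -> rform (loc_v CY phi0 d (chart_flow z)) (tang chart_flow z)
  = chart_density z * sin (chart_angle z).
Proof.
move=> z0; have [cx Tt dx] := z0.
have := alpha_phase Tt Ac (cinv_dom Ac cx).
rewrite twE /cis => /(congr1 (@complex.Im R)) /=; rewrite mulr0 add0r mulrC => <-.
rewrite (pullback_dz_twIm (F_lagrangian Tt) Ac (cinv_dom Ac cx) _ Ad dx).
by rewrite dmap_tang// -stptE /loc_v /chart_flow (cinvK Ad dx).
Qed.

Lemma pullback_partial x t i j l : chart_dom (stpt x t) ->
  cpartial c i (fun q => pullback_metric CY (F^~ t) c q j l) (cinv c x)
  = partial (sp i) (fun z => fmetric chart_flow (loc_g CY d) z j l) (stpt x t).
Proof.
move=> z0; have := z0; rewrite /chart_dom /= stpt_space stpt_time => -[cx Tt dx].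
rewrite (cpartialE _ _ Ac cx) partial_sp; apply: partial_near.
apply: filterS (chart_dom_slice z0) => y dy.
by rewrite -pullback_fmetric// stpt_space stpt_time.
Qed.

Lemma second_partial x t i j b : chart_dom (stpt x t) ->
  cpartial c i (cpartial c j (fun q => cmap d (F q t) 0 b)) (cinv c x)
  = partial (sp i) (partial (sp j) (fun z => chart_flow z 0 b)) (stpt x t).
Proof.
move=> z0; have := z0; rewrite /chart_dom /= stpt_space stpt_time => -[cx Tt dx].
rewrite (cpartialE _ _ Ac cx) partial_sp; apply: partial_near.
apply: filterS (nbhs_cimg Ac cx) => y cy; rewrite (cpartialE _ _ Ac cy) partial_sp.
have -> // : (fun y => chart_flow (stpt y t) 0 b) = (fun y => cmap d (F (cinv c y) t) 0 b).
by apply/funext => y'; rewrite /chart_flow stpt_space stpt_time.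
Qed.

Lemma mean_curvatureE x t : chart_dom (stpt x t) ->
  mean_curvature CY (F^~ t) c d (cinv c x)
  = fmean chart_flow (loc_g CY d) (loc_Gam CY d) (stpt x t).
Proof.
move=> z0; have := z0; rewrite /chart_dom /= stpt_space stpt_time => -[cx Tt dx].
have hE := pullback_fmetric z0; rewrite stpt_space stpt_time in hE.
rewrite /mean_curvature /fmean hE; apply: eq_bigr => i _; apply: eq_bigr => j _.
congr (_ *: _); apply/rowP => b; rewrite !mxE second_partial//.
have tE k b' : dmap c d (F^~ t) (cinv c x) k b' = tang chart_flow (stpt x t) k b'
  by rewrite dmap_tang.
have cE k : christoffel (pullback_metric CY (F^~ t)) c (cinv c x) k i j
    = fchristoffel chart_flow (loc_g CY d) (stpt x t) k i j.
  rewrite /christoffel /fchristoffel hE; apply: (congr1 (fun a => 2^-1 * a));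
    apply: eq_bigr => l _.
  by rewrite (pullback_partial _ _ _ z0) (pullback_partial _ _ _ z0)
    (pullback_partial _ _ _ z0).
have gE a e : christoffel (cy_metric CY) d (F (cinv c x) t) b a e
    = loc_Gam CY d (chart_flow (stpt x t)) b a e.
  by rewrite /loc_Gam /chart_flow stpt_space stpt_time (cinvK Ad dx).
congr (_ - _ + _).
  by apply: eq_bigr => k _; rewrite (cE k) (tE k b).
by apply: eq_bigr => a _; apply: eq_bigr => e _; rewrite (gE a e) (tE i a) (tE j e).
Qed.

(** At a positive time [[0, T[] is a neighbourhood of [t], so the limit within it is a full
    two-sided limit. *)
Lemma velocityP p t V : 0 < t -> (t%:E < T)%E -> velocity T F d p t V ->
  forall b, h^-1 *: (cmap d (F p (h + t)) 0 b - cmap d (F p t) 0 b) @[h --> 0^'] --> V 0 b.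
Proof.
move=> t0 tT vel b.
have shc : (fun h : R => h + t) h @[h --> 0] --> t.
  by rewrite -[X in _ --> X]add0r; apply: cvgD; [exact: cvg_id|exact: cvg_cst].
have sh : (fun h : R => h + t) h @[h --> 0^'] --> within (time_interval T) t^'.
  move=> U; rewrite /within /dnbhs /within /= => HU.
  have H1 : \forall h \near (0 : R), h + t != t -> time_interval T (h + t) -> U (h + t).
    exact: (shc _ HU).
  have H2 : \forall h \near (0 : R), 0 < h + t /\ ((h + t)%:E < T)%E.
    exact: (shc _ (open_time_nbhs t0 tT)).
  suff : \forall h \near (0 : R), h != 0 -> U (h + t) by [].
  apply: filterS2 H1 H2 => h {}HU [h0 hT] hn; apply: HU; last by split => //; exact: ltW.
  by rewrite -subr_eq0 addrK.
have H : h^-1 *: (cmap d (F p (h + t)) - cmap d (F p t)) @[h --> 0^'] --> V.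
  have := cvg_comp _ _ sh vel; apply: cvg_trans; apply: near_eq_cvg.
  by apply: filterE => h /=; rewrite addrK.
have cc : {for V, continuous (fun W : 'rV[R]_n => W 0 b)}.
  by apply: differentiable_continuous; exact: differentiable_coord.
have := cvg_comp _ _ H cc; apply: cvg_trans; apply: near_eq_cvg.
by apply: filterE => h /=; rewrite !mxE.
Qed.

Lemma flow_local_chart : flow_local chart_flow (loc_g CY d) (loc_J CY d) (loc_Gam CY d)
  (cimg d)
  (loc_u CY phi0 d) (loc_v CY phi0 d) chart_dom_gt0 chart_angle chart_density.
Proof.
split.
- exact: open_chart_dom_gt0.
- by move=> z z0 b; exact: chart_flow_smooth.
- exact: chart_angle_smooth.
- by move=> z [[cx Tt dx] _]; exact: cmap_img.
- move=> z [[cx Tt dx] _]; rewrite (stptE z) -dmap_tang//.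
  exact: (immersion_injective (F_lagrangian Tt) Ac Ad (cinv_dom Ac cx) dx).
- move=> z [z0 _]; have [cx Tt dx] := z0.
  rewrite {1 4}(stptE z) -dmap_tang// loc_gE// /loc_J /chart_flow (cinvK Ad dx).
  rewrite -(pullback_kahlerE (F_lagrangian Tt) Ac (cinv_dom Ac cx) Ad dx).
  exact: (immersion_lagrangian (F_lagrangian Tt) Ac (cinv_dom Ac cx)).
- move=> z [[cx Tt dx] _]; rewrite sqrtr_gt0.
  exact: (pullback_det_gt0 (F_lagrangian Tt) Ac (cinv_dom Ac cx)).
- by move=> z [z0 _]; exact: rform_u.
- by move=> z [z0 _]; exact: rform_v.
- move=> z z0; have [zd tz] := z0; have [cx Tt dx] := zd.
  have := F_flow Ac Ad Tt (cinv_dom Ac cx) dx => /=.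
  have zd' := zd; rewrite (stptE z) in zd'.
  rewrite (mean_curvatureE zd') -stptE.
  have -> : loc_J CY d (chart_flow z) = cy_J CY d (F (cinv c (lsubmx z)) (time z)).
    by rewrite /loc_J /chart_flow (cinvK Ad dx).
  move=> /(velocityP tz Tt.2) vel; apply/rowP => b.
  rewrite dmxE partial_tmE; apply: cvg_lim => //.
  have E1 : (fun h : R => h^-1 *: (chart_flow (stpt (lsubmx z) (h
    + time z)) 0 b - chart_flow (stpt (lsubmx z) (time z)) 0 b))
    = (fun h : R => h^-1 *: (cmap d (F (cinv c (lsubmx z)) (h + time z)) 0 b
                              - cmap d (F (cinv c (lsubmx z)) (time z)) 0 b)).
    by apply/funext => h; rewrite /chart_flow !stpt_space !stpt_time.
  by rewrite E1; exact: vel.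
Qed.

End TwoCharts.
End FlowChart.

(** * Conservation of the density and maximum principle *)

Section RealAnalysis.
Variable R : realType.

(* Look at the first time at which [f] is at most half of its initial value. *)
Lemma const_while_pos (f : R -> R) (t : R) : 0 < t ->
  {within `[0, t], continuous f} -> 0 < f 0 ->
  (forall s, 0 < s < t -> 0 < f s -> is_derive s 1 f 0) -> f t = f 0.
Proof.
move=> t0 cf f0 df.
have key s : 0 < s <= t -> (forall s', 0 < s' < s -> 0 < f s') -> f s = f 0.
  move=> /andP[s0 st] pos.
  have [||x xs] := @MVT R f (fun=> 0) 0 s s0.
  - move=> x; rewrite in_itv/= => /andP[x0 xs]; apply: df;
    first by rewrite x0 (lt_le_trans xs).
    by apply: pos; rewrite x0.
  - apply: continuous_subspaceW cf => x; rewrite /= !in_itv/= => /andP[-> xs].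
    exact: le_trans xs st.
  by rewrite mul0r => /eqP; rewrite subr_eq0 => /eqP.
pose a := f 0 / 2; have a0 : 0 < a by rewrite divr_gt0.
have af : a < f 0 by rewrite ltr_pdivrMr// ltr_pMr// ltr1n.
pose A := `[0, t]%classic `&` f @^-1` [set x | x <= a].
have [A0|/set0P A0] := eqVneq A set0.
  apply: key; first by rewrite t0 lexx.
  move=> s /andP[s0 st]; rewrite (lt_trans a0)// ltNge; apply/negP => fsa.
  suff : A s by rewrite A0.
  by split => //=; rewrite in_itv/= !ltW.
have cA : compact A.
  have : closed (f @^-1` [set x | x <= a] : set (subspace `[0, t]%classic)).
    by move: cf => /continuous_closedP; apply; exact: closed_le.
  move=> /closed_subspaceP[V cV VE]; rewrite /A setIC -VE setIC.
  by apply: compact_closedI => //; exact: segment_compact.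
have cI : {within A, continuous (id : R -> R)}.
  by apply: continuous_subspaceT => x; exact: cvg_id.
have [s sA smin] := compact_EVT_min A0 cA cI.
move: sA; rewrite inE => -[]; rewrite /= in_itv/= => /andP[s0 st] fsa.
have s0' : 0 < s.
  rewrite lt_neqAle s0 andbT; apply/eqP => s00; move: fsa; rewrite -s00.
  by rewrite leNgt af.
suff : f s = f 0 by move=> E; move: fsa; rewrite E leNgt af.
apply: key; first by rewrite s0'.
move=> s' /andP[s'0 s's]; rewrite (lt_trans a0)// ltNge; apply/negP => fs'a.
have : s' \in A by rewrite inE; split => //=; rewrite in_itv/= (ltW s'0) (le_trans (ltW s's)).
by move=> /smin; rewrite leNgt s's.
Qed.

Lemma invmx_pos k (h : 'M[R]_k) : h^T = h ->
  (forall v : 'rV[R]_k, v != 0 -> 0 < (v *m h *m v^T) 0 0) ->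
  (invmx h)^T = invmx h /\
  forall v : 'rV[R]_k, v != 0 -> 0 < (v *m invmx h *m v^T) 0 0.
Proof.
move=> hT ph; have uh := pos_def_unit ph.
have iT : (invmx h)^T = invmx h by rewrite trmx_inv hT.
split => // v v0; have := ph (v *m invmx h); rewrite trmx_mul iT mulmxKV// mulmxA; apply.
by apply: contra v0 => /eqP E; rewrite -(mulmxKV uh v) E mul0mx.
Qed.

End RealAnalysis.

Section Evolution.
Variables (R : realType) (m : nat) (N : topologicalType) (CY : calabi_yau R N m).
Variables (M : topologicalType) (AM : manifold R M m).
Variables (phi0 : R) (T : \bar R) (F : M -> R -> N) (alpha : M -> R -> R).
Hypothesis F_smooth : smooth_spacetime_map AM CY T F.
Hypothesis F_lagrangian : forall t, time_interval T t -> lagrangian_immersion AM CY (F^~ t).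
Hypothesis alpha_smooth : smooth_spacetime_fun AM T alpha.
Hypothesis alpha_phase : forall t, time_interval T t ->
       phase_equation AM CY phi0 (F^~ t) (alpha^~ t).
Hypothesis F_flow : reparametrized_LMCF AM CY T F alpha.

Local Notation AN := (cy_manifold CY).
Local Notation n := (2 * m)%N.
Local Notation sp a := (lshift 1 a : 'I_(m + 1)).
Local Notation tm := (rshift m ord0 : 'I_(m + 1)).
Local Notation E := 'rV[R]_(m + 1).
Local Notation time z := (z 0 (rshift m ord0)).
Local Notation cos_density := (cos_density CY F alpha).

Lemma time_interval0 t : time_interval T t -> time_interval T 0.
Proof. by move=> [t0 tT]; split => //; apply: le_lt_trans tT; rewrite lee_fin. Qed.

Lemma two_mulE : n = (m + m)%N.
Proof. by rewrite mul2n addnn. Qed.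

Lemma stpt_dom c d p t : atlas AM c -> cdom c p -> time_interval T t -> cdom d (F p t) ->
  chart_dom T F c d (stpt (cmap c p) t).
Proof.
move=> Ac cp Tt dp; rewrite /chart_dom /= stpt_space stpt_time (cinvK Ac cp).
by split => //; exact: cmap_img.
Qed.

Lemma stpt_time_cont (x : 'rV[R]_m) t : (fun s => stpt x s) s @[s --> t] --> stpt x t.
Proof.
have A : (fun=> x) s @[s --> t] --> x by exact: cvg_cst.
have B : (fun s : R => s) s @[s --> t] --> t by exact: cvg_id.
have := cvg_comp _ _ (cvg_pair A B) (@stpt_cont R m (x, t)).
exact.
Qed.

Lemma stpt_space_cont (y : 'rV[R]_m) s : (fun y' => stpt y' s) y' @[y' --> y] --> stpt y s.
Proof.
move=> U /(@stpt_cont R m (y, s)) [[P Q] /= [Py Qs] PQ].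
by apply: filterS Py => y' Py'; apply: (PQ (y', s)); split => //=; exact: nbhs_singleton.
Qed.

Lemma cos_density_derive c p t : atlas AM c -> cdom c p -> 0 < t -> (t%:E < T)%E ->
  cos (alpha p t) != 0 -> is_derive t 1 (cos_density c p) 0.
Proof.
move=> Ac cp t0 tT c0; have Tt : time_interval T t by split => //; exact: ltW.
pose d := chart_at AN (F p t).
have Ad : atlas AN d := chart_at_atlas _ _; have dp : cdom d (F p t) := chart_at_dom _ _.
have FL := flow_local_chart F_smooth F_lagrangian alpha_smooth alpha_phase F_flow Ac Ad.
have CL := cy_local_chart phi0 Ad.
have z0 : chart_dom_gt0 T F c d (stpt (cmap c p) t).
  by split; [exact: stpt_dom|rewrite stpt_time].
have angleE : chart_angle alpha c (stpt (cmap c p) t) = alpha p t.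
  by rewrite /chart_angle stpt_space stpt_time (cinvK Ac cp).
rewrite -angleE in c0.
have := is_derive_tm (phase_re_diff CL FL z0);
  rewrite (partial_phase_re_time two_mulE CL FL z0 c0).
apply: near_eq_is_derive.
have H : \forall s \near t, chart_dom_gt0 T F c d (stpt (cmap c p) s).
  by apply: (stpt_time_cont (nbhs_chart_dom_gt0 F_smooth Ac Ad z0)).
apply: filterS H => s [zs _].
rewrite /phase_re (rform_u F_lagrangian alpha_phase Ac Ad zs) /chart_density /chart_angle
  stpt_space stpt_time (cinvK Ac cp).
by rewrite /cos_density mulrC.
Qed.

Lemma F_time_cont p t : time_interval T t ->
  F p s @[s --> within (time_interval T) (nbhs t)] --> F p t.
Proof.
move=> Tt; have [/subspace_continuousP cF _] := F_smooth.
have := cF (p, t) Tt => /= H U /H.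
rewrite /within /=  => -[[P Q] /= [Pp Qt] PQ].
apply: filterS Qt => s Qs Ts.
by apply: (PQ (p, s)) => //=; split => //; exact: nbhs_singleton.
Qed.

(** The density involves spatial derivatives of [F], whose continuity in time is not immediate at
    [t = 0]. The components of [F] are replaced by smooth extensions [hh] near the point; the
    density is then the restriction of [Psi], which is differentiable because it is built from first
    derivatives of [hh]. *)
Lemma cos_density_cont c p t : atlas AM c -> cdom c p -> time_interval T t ->
  cos_density c p s @[s --> within (time_interval T) (nbhs t)] --> cos_density c p t.
Proof.
move=> Ac cp Tt; set x := cmap c p; pose z0 := stpt x t.
pose d := chart_at AN (F p t).
have Ad : atlas AN d := chart_at_atlas _ _; have dp : cdom d (F p t) := chart_at_dom _ _.
have dz0 : chart_dom T F c d z0 by exact: stpt_dom.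
have /choice[h hP] : forall b, exists h : E -> R, exists V : set E,
    [/\ open V, V z0, (forall r, Cr r V h) &
     forall z, V z -> chart_dom T F c d z -> chart_flow F c d z 0 b = h z].
  move=> b; have [V [h [oV Vz0 hr hE]]] := F_smooth.2 c d Ac Ad b z0 dz0.
  by exists h, V.
have {hP} /choice[V hP] := hP.
pose hh (z : E) : 'rV[R]_n := \row_b h b z.
have hs b : smooth_at (h b) z0 by have [oV Vz0 hr _] := hP b; exists (V b).
have oVV : open [set z | forall b, V b z].
  rewrite openE => z /= Vz; apply: (@filter_forall _ 'I_n V (nbhs z) _) => b.
  by have [oV _ _ _] := hP b; exact: open_nbhs_nbhs.
have nV : \forall z \near z0, forall b, V b z.
  by apply: open_nbhs_nbhs; split => // b; have [] := hP b.
have ffE z : (forall b, V b z) -> chart_dom T F c d z -> chart_flow F c d z = hh z.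
  by move=> Vz dz; apply/rowP => b; rewrite mxE; have [_ _ _] := hP b; apply.
(* A slice of the domain is open in space, so the agreement of [chart_flow] with [hh] passes to
   spatial derivatives, even at time 0. *)
have tangE y s : (forall b, V b (stpt y s)) -> chart_dom T F c d (stpt y s) ->
    tang (chart_flow F c d) (stpt y s) = tang hh (stpt y s).
  move=> Vz dz; apply/matrixP => a b; rewrite !mxE !partial_sp; apply: partial_near.
  have H1 : \forall y' \near y, forall b, V b (stpt y' s).
    exact: (stpt_space_cont (open_nbhs_nbhs (conj oVV Vz))).
  apply: filterS2 H1 (chart_dom_slice F_lagrangian Ac Ad dz) => y' Vy' dy'.
  by rewrite (ffE _ Vy' dy') mxE.
pose Psi z := rform (loc_u CY phi0 d (hh z)) (tang hh z).
have hh0 : hh z0 = chart_flow F c d z0 by rewrite ffE//; exact: nbhs_singleton nV.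
have dPsi : differentiable Psi z0.
  have CL := cy_local_chart phi0 Ad.
  have Wz : cimg d (hh z0) by rewrite hh0 /chart_flow /z0 stpt_space stpt_time
    (cinvK Ac cp); exact: cmap_img.
  have dhh : mxdiff hh z0.
    move=> i b; rewrite ord1; have -> : (fun y => hh y 0 b) = h b by apply/funext => y;
      rewrite mxE.
    exact: smooth_at_differentiable (hs b).
  have dD : mxdiff (tang hh) z0.
    move=> a b; have -> : (fun y => tang hh y a b) = partial (sp a) (h b).
      apply/funext => y; rewrite mxE; congr (partial _ _ _).
      by apply/funext => y'; rewrite mxE.
    exact/smooth_at_differentiable/smooth_at_partial.
  exact: (cov_form dhh tm (cy_u_diff CL Wz) (cy_u_parallel CL Wz) dD).1.
have cPsi : (fun s => Psi (stpt x s)) s @[s --> within (time_interval T) (nbhs t)] --> Psi z0.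
  have c1 : (fun s => stpt x s) s @[s --> within (time_interval T) (nbhs t)] --> z0.
    move=> Q HQ.
    have H : \forall s \near t, Q (stpt x s) by exact: (stpt_time_cont HQ).
    suff : \forall s \near t, time_interval T s -> Q (stpt x s) by [].
    by apply: filterS H.
  exact: cvg_comp _ _ c1 (differentiable_continuous dPsi).
have psiPsi s : (forall b, V b (stpt x s)) -> time_interval T s -> cdom d (F p s) ->
    cos_density c p s = Psi (stpt x s).
  move=> Vs Ts ds; have dz : chart_dom T F c d (stpt x s) by exact: stpt_dom.
  rewrite /Psi -(ffE _ Vs dz) -(tangE _ _ Vs dz) (rform_u F_lagrangian alpha_phase Ac Ad dz).
  by rewrite /chart_density /chart_angle stpt_space stpt_time (cinvK Ac cp) /cos_density mulrC.
have -> : cos_density c p t = Psi z0 by apply: psiPsi => //; exact: nbhs_singleton nV.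
apply: cvg_trans cPsi; apply: near_eq_cvg.
have H1 : \forall s \near within (time_interval T) (nbhs t), forall b, V b (stpt x s).
  by apply: cvg_within; exact: (stpt_time_cont nV).
have H2 : \forall s \near within (time_interval T) (nbhs t), cdom d (F p s).
  exact: (F_time_cont Tt (nbhs_cdom Ad dp)).
have H3 : \forall s \near within (time_interval T) (nbhs t), time_interval T s.
  exact: withinT.
by apply: filterS3 H1 H2 H3 => s Vs ds Ts; apply/esym/psiPsi.
Qed.

(** Positivity is tracked on the density itself: where it is positive the cosine is nonzero, the
    velocity is the intended one and the derivative is zero, which is what [const_while_pos] asks
    for. *)
Lemma cos_density_const c p t : atlas AM c -> cdom c p -> 0 < cos (alpha p 0) ->
  time_interval T t -> cos_density c p t = cos_density c p 0.
Proof.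
move=> Ac cp c0 Tt; have [t0 tT] := Tt.
have [->//|tn0] := eqVneq t 0.
have {tn0}t0' : 0 < t by rewrite lt_neqAle eq_sym tn0 t0.
apply: const_while_pos => //.
- apply/subspace_continuousP => s; rewrite /= in_itv/= => /andP[s0 st].
  have Ts : time_interval T s by split => //; apply: le_lt_trans tT; rewrite lee_fin.
  have := cos_density_cont Ac cp Ts; apply: cvg_trans; apply: cvg_app.
  apply: within_subset => s' /=; rewrite in_itv/= => /andP[s'0 s't].
  by split => //; apply: le_lt_trans tT; rewrite lee_fin.
- rewrite /cos_density mulr_gt0// sqrtr_gt0.
  exact: (pullback_det_gt0 (F_lagrangian (time_interval0 Tt)) Ac cp).
- move=> s /andP[s0 st] ps; apply: cos_density_derive => //.
    by apply: lt_le_trans (ltW tT); rewrite lte_fin.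
  by apply/eqP => c00; move: ps; rewrite /cos_density c00 mul0r ltxx.
Qed.

(** The conserved density is positive at time 0, and its other factor [sqrt (det h)] is positive at
    every time. *)
Lemma cos_gt0_preserved p t : 0 < cos (alpha p 0) -> time_interval T t -> 0 < cos (alpha p t).
Proof.
move=> c0 Tt; pose c := chart_at AM p.
have Ac : atlas AM c := chart_at_atlas _ _; have cp : cdom c p := chart_at_dom _ _.
have := cos_density_const Ac cp c0 Tt.
have p0 : 0 < cos_density c p 0.
  by rewrite /cos_density mulr_gt0// sqrtr_gt0;
    exact: (pullback_det_gt0 (F_lagrangian (time_interval0 Tt)) Ac cp).
have := pullback_det_gt0 (F_lagrangian Tt) Ac cp; rewrite -sqrtr_gt0 => rp E1.
by move: p0; rewrite -E1 /cos_density (pmulr_lgt0 _ rp).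
Qed.

Lemma angle_cont :
  {within [set w : M * R | time_interval T w.2], continuous (fun w => alpha w.1 w.2)}.
Proof.
apply/subspace_continuousP => -[p t] /= Tt.
pose c := chart_at AM p.
have Ac : atlas AM c := chart_at_atlas _ _; have cp : cdom c p := chart_at_dom _ _.
pose z0 := stpt (cmap c p) t.
have [|U [h [oU Uz0 hr hE]]] := alpha_smooth Ac (x := z0).
  by rewrite /= stpt_space stpt_time; split => //; exact: cmap_img.
have ch : {for z0, continuous h} by apply: smooth_at_continuous; exists U.
have cz : (fun w : M * R => stpt (cmap c w.1) w.2) w @[w --> (p, t)] --> z0.
  have A : (fun w : M * R => cmap c w.1) w @[w --> (p, t)] --> cmap c p.
    by apply: (@continuous_comp _ _ _ fst (cmap c) (p, t));
      [exact: cvg_fst|exact: cmap_cont Ac cp].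
  have B : (fun w : M * R => w.2) w @[w --> (p, t)] --> t by exact: cvg_snd.
  exact: cvg_comp _ _ (cvg_pair A B) (@stpt_cont R m (cmap c p, t)).
have aE w : cdom c w.1 -> time_interval T w.2 -> U (stpt (cmap c w.1) w.2) ->
    alpha w.1 w.2 = h (stpt (cmap c w.1) w.2).
  move=> cw Tw Uw; rewrite -hE//; last first.
    by rewrite /= stpt_space stpt_time; split => //; exact: cmap_img.
  by rewrite stpt_space stpt_time (cinvK Ac cw).
have E0 : alpha p t = h z0 := aE (p, t) cp Tt Uz0.
move=> Q HQ; have {}HQ : nbhs (h z0) Q by rewrite -E0.
have H1 : \forall w \near (p, t), Q (h (stpt (cmap c (w : M * R).1) w.2)).
  exact: (cz _ (ch Q HQ)).
have H2 : \forall w \near (p, t), U (stpt (cmap c (w : M * R).1) w.2).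
  exact: (cz _ (open_nbhs_nbhs (conj oU Uz0))).
have H3 : \forall w \near (p, t), cdom c (w : M * R).1.
  exact: (cvg_fst (nbhs_cdom Ac cp)).
suff : \forall w \near (p, t), time_interval T (w : M * R).2 -> Q (alpha w.1 w.2) by [].
by apply: filterS3 H1 H2 H3 => w w1 w2 w3 Tw; rewrite aE.
Qed.

Lemma nbhs_line (V : normedModType R) (A : set V) (z w : V) : nbhs z A ->
  exists2 e : R, 0 < e & forall s, `|s| < e -> A (z + s *: w).
Proof.
move=> zA; have : (fun s : R => z + s *: w) s @[s --> 0] --> z.
  rewrite -[X in _ --> X]addr0 -(scale0r w); apply: cvgD; first exact: cvg_cst.
  by apply: cvgZr_tmp; exact: cvg_id.
move/(_ _ zA) => /nbhs_ballP[e /= e0 B]; exists e => // s se.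
by apply: (B s); rewrite /ball /= sub0r normrN.
Qed.

(* At a minimum of [cos alpha + delta t] the gradient of [alpha] vanishes, so
   that [alpha_t] is the Laplacian of [alpha]; [cos alpha] has a nonnegative
   Laplacian, hence [cos alpha + delta t] a positive time derivative. *)
Lemma no_interior_min p s (delta : R) : 0 < delta -> 0 < s -> (s%:E < T)%E ->
  0 < cos (alpha p s) < 1 ->
  (forall q t, 0 <= t <= s ->
     cos (alpha p s) + delta * s <= cos (alpha q t) + delta * t) -> False.
Proof.
move=> d0 s0 sT /andP[c0 c1] pmin; have Ts : time_interval T s by split => //; exact: ltW.
pose c := chart_at AM p; pose d := chart_at AN (F p s).
have Ac : atlas AM c := chart_at_atlas _ _; have cp : cdom c p := chart_at_dom _ _.
have Ad : atlas AN d := chart_at_atlas _ _; have dp : cdom d (F p s) := chart_at_dom _ _.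
have FL := flow_local_chart F_smooth F_lagrangian alpha_smooth alpha_phase F_flow Ac Ad.
have CL := cy_local_chart phi0 Ad.
set z := stpt (cmap c p) s.
have z0 : chart_dom_gt0 T F c d z by split; [exact: stpt_dom|rewrite stpt_time].
have tz : time z = s by rewrite stpt_time.
pose a := chart_angle alpha c; pose ca y := cos (a y).
have az : a z = alpha p s by rewrite /a /chart_angle stpt_space stpt_time (cinvK Ac cp).
have caz y : chart_dom_gt0 T F c d y -> time y <= s ->
  ca z + delta * s <= ca y + delta * time y.
  by move=> [_ ty] tys; rewrite /ca az; apply: pmin; rewrite (ltW ty).
have nz : \forall y \near z, chart_dom_gt0 T F c d y
  by exact: (nbhs_chart_dom_gt0 F_smooth Ac Ad z0).
have sa y : chart_dom_gt0 T F c d y -> smooth_at a y by exact: fl_alpha_smooth FL y.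
have dca y : chart_dom_gt0 T F c d y -> differentiable ca y.
  by move=> y0; apply: differentiable_comp1 => //; exact: smooth_at_differentiable (sa y y0).
have pca k y : chart_dom_gt0 T F c d y -> partial k ca y = - sin (a y) * partial k a y.
  move=> y0; rewrite partial_comp1//; last exact: smooth_at_differentiable (sa y y0).
  by rewrite derive_val.
have dsin : differentiable (fun y => - sin (a y)) z.
  by apply: differentiableN; apply: differentiable_comp1 => //;
    exact: smooth_at_differentiable (sa z z0).
have dpa k : differentiable (partial k a) z.
  exact/smooth_at_differentiable/smooth_at_partial/sa.
have dpca k : differentiable (partial k ca) z.
  apply: (@differentiable_near _ _ (fun y => - sin (a y) * partial k a y)).
    by apply: filterS nz => y y0; rewrite pca.
  exact: differentiableM.
(* This is the use of [cos alpha < 1]: the critical points of [cos alpha] are then critical for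
   [alpha]. *)
have sn0 : sin (a z) != 0.
  apply/eqP => sn; have := cos2Dsin2 (a z); rewrite sn expr0n addr0 az => c21.
  by move: c1; rewrite -(expr_lt1 (n := 2)) ?ltW// c21 ltxx.
have lmin (w0 : 'rV[R]_m) : 'D_(stpt w0 0) ca z = 0 /\
    0 <= \sum_i \sum_j stpt w0 0 0 i * stpt w0 0 0 j * partial i (partial j ca) z.
  have [e e0 He] := nbhs_line (stpt w0 0) nz.
  apply: (local_min_line e0) => //; first by apply: filterS nz.
  move=> x xe; have := caz _ (He x xe).
  have -> : time (z + x *: stpt w0 0) = s.
    by rewrite mxE tz -stptZ stpt_time mulr0 addr0.
  by rewrite lexx lerD2r; apply.
have g0 k : partial (sp k) a z = 0.
  have [+ _] := lmin (delta_mx 0 k); rewrite -delta_sp -/(partial _ _ _).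
  have -> : 'D_(delta_mx 0 (sp k)) ca z = partial (sp k) ca z by [].
  by rewrite pca// => /eqP; rewrite mulf_eq0 oppr_eq0 (negPf sn0) => /eqP.
have grad0 : dalpha a z = 0 by apply/rowP => k; rewrite !mxE g0.
(* The term in which [sin alpha] is differentiated carries a factor [d alpha], which is zero
   here. *)
have hca i j : partial (sp i) (partial (sp j) ca) z = - sin (a z) * hess_alpha a z i j.
  rewrite mxE; transitivity (partial (sp i) (fun y => - sin (a y) * partial (sp j) a y) z).
    by apply: partial_near; apply: filterS nz => y y0; rewrite pca.
  by rewrite partialM// g0 mulr0 add0r.
have psd (w0 : 'rV[R]_m) : 0 <= (w0 *m (- sin (a z) *: hess_alpha a z) *m w0^T) 0 0.
  have [_] := lmin w0; rewrite big_split_ord /= [X in _ + X]big1 ?addr0; last first.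
    move=> i _; rewrite big1// => j _; rewrite {1}/stpt row_mxEr ord1.
    by rewrite !mxE eqxx !mul0r.
  have -> : (w0 *m (- sin (a z) *: hess_alpha a z) *m w0^T) 0 0
     = \sum_i \sum_j w0 0 i * (- sin (a z) * hess_alpha a z i j) * w0 0 j.
    rewrite mxE exchange_big; apply: eq_bigr => j _; rewrite !mxE mulr_suml.
    by apply: eq_bigr => i _; rewrite !mxE.
  rewrite (eq_bigr (fun i => \sum_j w0 0 i * (- sin (a z) * hess_alpha a z i j)
    * w0 0 j))// => i _.
  rewrite big_split_ord /= [X in _ + X]big1 ?addr0; last first.
    move=> j _; rewrite [stpt w0 0 0 (rshift _ _)]row_mxEr ord1.
    by rewrite [_%:M 0 0]mxE eqxx mulr0 mul0r.
  by apply: eq_bigr => j _; rewrite hca !row_mxEl mulrAC.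
have [iT ipos] := invmx_pos (fmetric_sym CL FL z0) (fmetric_pos CL FL z0).
have tr0 := trace_mul_ge0 iT ipos psd.
have dt0 : 0 <= partial tm ca z.
  rewrite pca// (partial_alpha_time two_mulE CL FL z0 _ grad0); last by rewrite -/a az gt_eqF.
  by rewrite -mxtraceZ scalemxAl mxtrace_mulC.
have dphi : differentiable (fun y => ca y + delta * time y) z.
  apply: differentiableD; first exact: dca.
  apply: differentiableM; first exact: differentiable_cst.
  exact: differentiable_coord.
(* The comparison holds only for times up to [s], hence the derivative backwards in time. It is
   nonnegative at a minimum, yet equals minus a sum that is at least [delta]. *)
have [e e0 He] := nbhs_line (- delta_mx 0 tm) nz.
have : 0 <= 'D_(- delta_mx 0 tm) (fun y => ca y + delta * time y) z.
  apply: (derive_ge0_right e0); first exact: diff_derivable.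
  move=> x /andP[x0 xe].
  have tE : time (z + x *: - delta_mx 0 tm) = s - x.
    by rewrite mxE tz scalerN mxE delta_tm -stptZ stpt_time mulr1.
  rewrite tz; apply: caz; first by apply: He; rewrite gtr0_norm.
  by rewrite tE lerBlDr lerDl ltW.
have ptime : partial tm (fun y : E => time y) z = 1.
  have dtime : differentiable (fun y : E => time y) z by exact: differentiable_coord.
  have [_ <-] := is_derive_tm dtime.
  have -> : (fun x => time (stpt (cmap c p) x)) = id by apply/funext => x; exact: stpt_time.
  by rewrite derive_id.
have pphi : partial tm (fun y => ca y + delta * time y) z = partial tm ca z + delta.
  rewrite partialD; [|exact: dca|by apply: differentiableM;
    [exact: differentiable_cst|exact: differentiable_coord]].
  rewrite partialM; [|exact: differentiable_cst|exact: differentiable_coord].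
  by rewrite partial_cst ptime mul0r add0r mulr1.
rewrite derive_dirN//.
have -> : 'D_(delta_mx 0 tm) (fun y => ca y + delta * time y) z
  = partial tm (fun y => ca y + delta * time y) z by [].
by rewrite pphi oppr_ge0 leNgt ltr_wpDl.
Qed.

(** If the bound fails at [(q, t)], the minimum of [cos alpha + delta * time] on the compact set [M
    x [0, t]] is below [eps]. It therefore lies at a positive time and at a point where
    [cos alpha < eps <= 1], which [no_interior_min] excludes. *)
Lemma cos_ge_preserved (eps : R) : compact [set: M] ->
  (forall p, 0 < cos (alpha p 0)) -> (forall p, eps <= cos (alpha p 0)) ->
  forall p t, time_interval T t -> eps <= cos (alpha p t).
Proof.
move=> cM pos0 eps0 q t Tt; rewrite leNgt; apply/negP => lt_eps; have [t0 tT] := Tt.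
have t0' : 0 < t.
  by rewrite lt_neqAle t0 andbT; apply/eqP => E; move: lt_eps; rewrite -E ltNge eps0.
(* At time [t] the perturbation makes up half of the gap to [eps], so the perturbed function is
   still below [eps] at [(q, t)]. *)
pose delta := (eps - cos (alpha q t)) / 2 / t.
have d0 : 0 < delta by rewrite !divr_gt0// subr_gt0.
have dt : delta * t = (eps - cos (alpha q t)) / 2 by rewrite divfK// gt_eqF.
pose f (w : M * R) := cos (alpha w.1 w.2) + delta * w.2.
pose K : set (M * R) := setT `*` `[0, t]%classic.
have cK : compact K by apply: compact_setX => //; exact: segment_compact.
have TK (w : M * R) : K w -> time_interval T w.2.
  move=> [_]; rewrite /= in_itv/= => /andP[w0 wt]; split => //.
  by apply: le_lt_trans tT; rewrite lee_fin.
have cf : {within K, continuous f}.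
  apply/subspace_continuousP => -[p1 s1] Kw; set w := (p1, s1).
  have ca : alpha w'.1 w'.2 @[w' --> within K (nbhs w)] --> alpha w.1 w.2.
    have := (subspace_continuousP _ _).1 angle_cont w (TK w Kw).
    by apply: cvg_trans; apply: cvg_app; apply: within_subset => w'; exact: TK.
  apply: cvgD.
    by move=> Q HQ; apply: (ca [set a | Q (cos a)]); exact: continuous_cos HQ.
  apply: cvgM; first exact: cvg_cst.
  move=> Q HQ; have H : \forall w' \near w, Q (w' : M * R).2 by exact: (cvg_snd HQ).
  suff : \forall w' \near w, K w' -> Q (w' : M * R).2 by [].
  by apply: filterS H.
have K0 : K !=set0 by exists (q, t); split => //=; rewrite in_itv/= t0 lexx.
have [[p s] pK fmin] := compact_EVT_min K0 cK cf.
move: pK; rewrite inE => -[_]; rewrite /= in_itv/= => /andP[s0 st].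
have fle q' t' : 0 <= t' <= t -> f (p, s) <= f (q', t').
  by move=> tt; apply: fmin; rewrite inE; split => //=; rewrite in_itv.
have feps : f (p, s) < eps.
  by apply: le_lt_trans (fle q t _) _; rewrite ?t0 ?lexx// /f /= dt; lra.
have s0' : 0 < s.
  rewrite lt_neqAle s0 andbT; apply/eqP => E; move: feps; rewrite /f -E /= mulr0 addr0.
  by rewrite ltNge eps0.
have sT : (s%:E < T)%E by apply: le_lt_trans tT; rewrite lee_fin.
apply: (@no_interior_min p s delta d0 s0' sT).
  apply/andP; split; first by apply: cos_gt0_preserved => //; split.
  apply: lt_le_trans (cos_le1 (alpha p 0)); apply: lt_le_trans (eps0 p).
  by apply: le_lt_trans feps; rewrite /f /= lerDl mulr_ge0// ltW.
move=> q' t' /andP[t'0 t's]; apply: fle; rewrite t'0 /=; exact: le_trans t's st.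
Qed.

End Evolution.

(** * Comparison of volumes *)

Section VolumeComparison.
Variable R : realType.
Local Open Scope ereal_scope.

(* The integral of a nonnegative function, measurable or not, is the supremum
   of the integrals of the simple functions below it. *)
Lemma ge0_integral_scale_le d (T : measurableType d)
    (mu : {measure set T -> \bar R}) (k : R) (f g : T -> \bar R) :
  (0 < k)%R -> (forall x, 0 <= f x) -> (forall x, 0 <= g x) ->
  (forall x, k%:E * f x <= g x) ->
  k%:E * \int[mu]_x f x <= \int[mu]_x g x.
Proof.
move=> k0 f0 g0 fg; rewrite -lee_pdivlMl// !ge0_integralTE//.
apply: ge_ereal_sup => _ [h /= hf <-].
rewrite lee_pdivlMl// -sintegralrM.
apply: ereal_sup_ubound; exists (scale_nnsfun h (ltW k0)) => //= x.
apply: le_trans (fg x); rewrite EFinM lee_wpmul2l//.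
by rewrite lee_fin ltW.
Qed.

Lemma lebesgue_int_ge0 n (f : 'rV[R]_n -> \bar R) :
  (forall x, 0 <= f x) -> 0 <= lebesgue_int f.
Proof.
elim: n f => [|n IH] f f0 /=; first exact: f0.
by apply: integral_ge0 => x _; apply: IH.
Qed.

Lemma lebesgue_int_scale_le n (k : R) (f g : 'rV[R]_n -> \bar R) :
  (0 < k)%R -> (forall x, 0 <= f x) -> (forall x, 0 <= g x) ->
  (forall x, k%:E * f x <= g x) ->
  k%:E * lebesgue_int f <= lebesgue_int g.
Proof.
move=> k0; elim: n f g => [|n IH] f g f0 g0 fg /=; first exact: fg.
apply: ge0_integral_scale_le => // x.
- exact: lebesgue_int_ge0.
- exact: lebesgue_int_ge0.
- exact: IH.
Qed.

Variables (M : ptopologicalType) (m : nat) (A : manifold R M m).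
Variables (h1 h2 : chart R M m -> M -> 'M[R]_m).
Variables (mu1 mu2 : {measure set (borel M) -> \bar R}).
Hypothesis mu1_h1 : is_riemannian_measure A h1 mu1.
Hypothesis mu2_h2 : is_riemannian_measure A h2 mu2.
Variable k : R.
Hypothesis k_gt0 : (0 < k)%R.
Hypothesis density_le : forall c p, atlas A c -> cdom c p ->
  (k * Num.sqrt (\det (h1 c p)) <= Num.sqrt (\det (h2 c p)))%R.

Lemma chart_measure_le c (B : set (borel M)) :
  atlas A c -> measurable B -> B `<=` cdom c -> k%:E * mu1 B <= mu2 B.
Proof.
move=> Ac mB Bc; rewrite (mu1_h1 Ac mB Bc) (mu2_h2 Ac mB Bc).
apply: lebesgue_int_scale_le => // x.
rewrite lee_fin !indicE.
have [|_] := boolP (x \in _); last by rewrite !mul0r mulr0.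
rewrite inE => -[p Bp <-]; rewrite !mul1r.
by rewrite (chart_cancel (atlas_chart Ac) (Bc _ Bp)); apply: density_le => //; apply: Bc.
Qed.

(** Finitely many chart domains cover [B]. By induction on their list, the part of [B] in the first
    domain is compared in that chart and the rest is covered by the others. *)
Lemma compact_measure_le (B : set (borel M)) :
  compact [set: M] -> measurable B -> k%:E * mu1 B <= mu2 B.
Proof.
move=> cM mB.
have mdom p : measurable (cdom (chart_at A p) : set (borel M)).
  apply: sub_sigma_algebra.
  exact: chart_open_dom (atlas_chart (chart_at_atlas A p)).
move: cM; rewrite compact_cover => /(_ M [set: M] (fun p => cdom (chart_at A p))).
case=> [p _|p _|D _ cov].
- exact: chart_open_dom (atlas_chart (chart_at_atlas A p)).
- by exists p => //; exact: chart_at_dom.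
have {cov} : B `<=` \bigcup_(p in [set` finmap.enum_fset D]) cdom (chart_at A p).
  by move=> q _; apply: (cov q).
elim: (finmap.enum_fset D) B mB => [|p s IH] B mB Bs.
  suff -> : B = set0 by rewrite !measure0 mule0.
  by apply/seteqP; split=> // q /Bs[r].
rewrite (measureDI mu1 mB (mdom p)) (measureDI mu2 mB (mdom p)).
rewrite ge0_muleDr ?measure_ge0//; apply: leeD.
  apply: IH; first exact: measurableD.
  move=> q [Bq nq]; have [r /=] := Bs _ Bq.
  rewrite inE => /orP[/eqP->//|rs] qr; by exists r.
apply: chart_measure_le (chart_at_atlas A p) _ _; first exact: measurableI.
by move=> q [].
Qed.

End VolumeComparison.

Theorem theoremA (R : realType) (m : nat)
    (N : topologicalType) (CY : calabi_yau R N m)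
    (M : ptopologicalType) (AM : manifold R M m)
    (M_oriented : oriented AM) (M_compact : compact [set: M])
    (F0 : M -> N) (F0_lagrangian : lagrangian_immersion AM CY F0)
    (phi0 : R) (alpha0 : M -> R)
    (F0_calibrated : almost_calibrated_with AM CY phi0 F0 alpha0)
    (T : \bar R) (T_gt0 : (0%:E < T)%E)
    (F : M -> R -> N) (F_smooth : smooth_spacetime_map AM CY T F)
    (F_init : forall p, F p 0 = F0 p)
    (F_lagrangian : forall t, time_interval T t ->
       lagrangian_immersion AM CY (F^~ t))
    (alpha : M -> R -> R) (alpha_smooth : smooth_spacetime_fun AM T alpha)
    (alpha_init : forall p, alpha p 0 = alpha0 p)
    (alpha_phase : forall t, time_interval T t ->
       phase_equation AM CY phi0 (F^~ t) (alpha^~ t))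
    (F_flow : reparametrized_LMCF AM CY T F alpha)
    (vol : R -> {measure set (borel M) -> \bar R})
    (vol_riemannian : forall t, time_interval T t ->
       is_riemannian_measure AM (pullback_metric CY (F^~ t)) (vol t)) :
  exists eps : R,
    [/\ is_minimum (range (fun p : M => cos (alpha p 0))) eps,
        0 < eps &
        forall (Omega : set (borel M)) (t : R),
          measurable Omega -> time_interval T t ->
          (eps%:E * vol 0%R Omega <= vol t Omega <= (1 / eps)%:E * vol 0%R Omega)%E].
Proof.
have T0 : time_interval T 0 by split.
have cos0_gt0 p : 0 < cos (alpha p 0).
  by rewrite alpha_init; have [_ _] := F0_calibrated; exact.
(* The angle is jointly continuous on [M x [0, T[]; its restriction to the slice at time 0 is what
   is needed for a minimum to exist. *)
have cos0_cont : {within [set: M], continuous (fun p => cos (alpha p 0))}.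
  apply: continuous_subspaceT => p Q HQ.
  have := (subspace_continuousP _ _).1 (angle_cont alpha_smooth) (p, 0) T0.
  move=> /(_ [set a | Q (cos a)] (continuous_cos HQ)) [[P1 P2] /= [P1p P20] PQ].
  apply: filterS P1p => q P1q; apply: (PQ (q, 0)) => //.
  by split => //=; exact: nbhs_singleton.
have [|p0 _ p0_min] := compact_EVT_min _ M_compact cos0_cont; first by exists point.
pose eps := cos (alpha p0 0).
have cos0_ge p : eps <= cos (alpha p 0) by apply: p0_min; rewrite inE.
exists eps; split=> [||Omega t mOmega Tt].
- by split; [exists p0|move=> _ [p _ <-]].
- exact: cos0_gt0.
pose vol_dens t c p := Num.sqrt (\det (pullback_metric CY (F^~ t) c p)).
have dens_const c p : atlas AM c -> cdom c p ->
    cos (alpha p t) * vol_dens t c p = cos (alpha p 0) * vol_dens 0 c p.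
  move=> Ac cp.
  exact: (cos_density_const F_smooth F_lagrangian alpha_smooth alpha_phase F_flow Ac cp).
have cost_ge p : eps <= cos (alpha p t).
  exact: (cos_ge_preserved F_smooth F_lagrangian alpha_smooth alpha_phase F_flow M_compact).
have dens_ge0 s c p : 0 <= vol_dens s c p by exact: sqrtr_ge0.
(* The chain is [eps dmu_0 <= cos alpha_0 dmu_0 = cos alpha_t dmu_t <= dmu_t]. *)
have dens_le c p : atlas AM c -> cdom c p -> eps * vol_dens 0 c p <= vol_dens t c p.
  move=> Ac cp; apply: (@le_trans _ _ (cos (alpha p 0) * vol_dens 0 c p)).
    exact: ler_wpM2r.
  by rewrite -dens_const// ler_piMl// cos_le1.
(* The same chain with the two times exchanged; the maximum principle enters through
   [eps <= cos alpha_t]. *)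
have dens_ge c p : atlas AM c -> cdom c p -> eps * vol_dens t c p <= vol_dens 0 c p.
  move=> Ac cp; apply: (@le_trans _ _ (cos (alpha p t) * vol_dens t c p)).
    exact: ler_wpM2r.
  by rewrite dens_const// ler_piMl// cos_le1.
have vol0 := vol_riemannian _ T0; have volt := vol_riemannian _ Tt.
apply/andP; split.
  by have := compact_measure_le vol0 volt (cos0_gt0 p0) dens_le M_compact mOmega.
rewrite div1r lee_pdivlMl; last exact: cos0_gt0.
by have := compact_measure_le volt vol0 (cos0_gt0 p0) dens_ge M_compact mOmega.
Qed.
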